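(* Let $\alpha\in(0,2]$, $\beta\in(0,1]$, let $\xi$ be an $(\alpha,\beta)$-superprocess in $\mathbb{R}^d$, and let $\mu$ be any $\sigma$-finite measure on $\mathbb{R}^d$. Then for any fixed $t>0$ the following two conditions are equivalent: (i) $\xi_t$ is locally finite a.s. under $P_\mu$; (ii) the measure $E_\mu\xi_t$ is locally finite. Furthermore, (i) and (ii) hold for every $t>0$ if and only if (iii) $\mu p_\alpha(t,\cdot)<\infty$ for all $t>0$; and if $\alpha<2$, then (iii) is equivalent to (iv) $\mu p_\alpha(t,\cdot)<\infty$ for some $t>0$.
   Context: For a measure $\mu$ and $f\ge0$, $\mu f=\int f\,d\mu$. A measure is locally finite if it is finite on bounded Borel sets. $p_\alpha(t,x)$ is the transition density of the symmetric (rotation-invariant) $\alpha$-stable process in $\mathbb{R}^d$ with generator $\frac12\Delta_\alpha$, $\Delta_\alpha=-(-\Delta)^{\alpha/2}$; for $\alpha=2$, $p_2(t,x)=p_t(x)=(2\pi t)^{-d/2}e^{-|x|^2/(2t)}$. An $(\alpha,\beta)$-superprocess $\xi=(\xi_t)_{t\ge0}$ in $\mathbb{R}^d$ is a vaguely rcll measure-valued strong Markov process with $E_\mu e^{-\xi_t f}=e^{-\mu v_t}$ for suitable (e.g. bounded measurable) $f\ge0$, where $v$ is the unique (mild) solution of $\dot v=\frac12\Delta_\alpha v-v^{1+\beta}$, $v_0=f$. For a $\sigma$-finite initial measure $\mu$, the process is constructed by additivity, as a sum of countably many independent copies with finite initial measures summing to $\mu$. $P_\mu,E_\mu$ refer to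 initial measure $\mu$. *)

(* Defs.v *)
From HB Require Import structures.
From mathcomp Require Import all_boot all_order all_algebra.
From mathcomp Require Import all_classical all_reals all_analysis.
From mathcomp Require Import measurable_realfun.

Set Implicit Arguments.
Unset Strict Implicit.
Unset Printing Implicit Defensive.

Import Order.TTheory GRing.Theory Num.Theory.
Import numFieldNormedType.Exports.

Local Open Scope classical_set_scope.
Local Open Scope ring_scope.

(* Borel sigma-algebra on matrices; R^d is ['rV[R]_d]. *)
HB.instance Definition _ (R : realType) (m n : nat) := @isMeasurable.Build
  (sigma_display (@open 'M[R]_(m, n))) 'M[R]_(m, n) <<s @open 'M[R]_(m, n) >>
  (@sigma_algebra0 _ setT _) (@sigma_algebraC _ _)
  (@sigma_algebra_bigcup _ setT _).

Section lebesgue_measure_rV.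
Context {R : realType}.

Definition cons_rV n (z : measurableTypeR R * 'rV[R]_n) : 'rV[R]_n.+1 :=
  \row_j oapp (z.2 ord0) z.1 (unlift ord0 j).

Lemma cons_rV0 n (z : measurableTypeR R * 'rV[R]_n) : cons_rV z ord0 ord0 = z.1.
Proof. by rewrite mxE unlift_none. Qed.

Lemma cons_rVS n (z : measurableTypeR R * 'rV[R]_n) (j : 'I_n) :
  cons_rV z ord0 (lift ord0 j) = z.2 ord0 j.
Proof. by rewrite mxE liftK. Qed.

Lemma cons_rV_inj n : injective (@cons_rV n).
Proof.
move=> [x u] [y v] E; congr pair.
  by have := congr1 (fun w : 'rV_n.+1 => w ord0 ord0) E; rewrite !cons_rV0.
apply/rowP => j; have := congr1 (fun w : 'rV_n.+1 => w ord0 (lift ord0 j)) E.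
by rewrite !cons_rVS.
Qed.

Lemma measurable_cons_rV n : measurable_fun setT (@cons_rV n).
Proof.
apply: (measurability (@open 'rV[R]_n.+1)) => //.
move=> _ [U oU <-]; rewrite [X in measurable X]setTI.
pose box (i : rat * 'rV[rat]_n * nat) : set (measurableTypeR R * 'rV[R]_n) :=
  (ball (ratr i.1.1 : R) i.2.+1%:R^-1 : set R) `*`
  ball (map_mx ratr i.1.2 : 'rV[R]_n) i.2.+1%:R^-1.
pose F i := if `[< box i `<=` @cons_rV n @^-1` U >] then box i else set0.
have -> : @cons_rV n @^-1` U = \bigcup_i F i.
  apply/seteqP; split=> [[x u] /= Uxu|z [i _]]; last first.
    by rewrite /F; case: asboolP => // + zi; exact.
  have /nbhs_ballP[e /= e0 eU] : nbhs (cons_rV (x, u)) U by exact: open_nbhs_nbhs.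
  have [k ke] : exists k : nat, k.+1%:R^-1 < e / 2.
    have e20 : 0 < e / 2 by rewrite divr_gt0.
    by have [k _ /(_ k (leqnn k))] := near_infty_natSinv_lt (PosNum e20); exists k.
  have k0 : 0 < k.+1%:R^-1 :> R by rewrite invr_gt0.
  have rat_near (y : R) : {q : rat | ball (ratr q : R) k.+1%:R^-1 y}.
    apply: cid.
    have /rat_in_itvoo[q] : y - k.+1%:R^-1 < y + k.+1%:R^-1.
      by rewrite ltrD2l gtrN.
    rewrite in_itv /= => /andP[h1 h2]; exists q.
    by rewrite /ball /= ltr_distl h1 h2.
  pose q := sval (rat_near x).
  pose r : 'rV[rat]_n := \row_j sval (rat_near (u ord0 j)).
  have xuB : box (q, r, k) (x, u).
    split; first exact: (svalP (rat_near x)).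
    split=> // i j; rewrite ord1 2!mxE; exact: (svalP (rat_near (u ord0 j))).
  exists (q, r, k) => //; rewrite /F; case: asboolP => // -[] [y v] [/= yB [_ vB]].
  apply: eU; split=> // i j; rewrite ord1.
  case: xuB => /= xB [_ uB].
  apply: (@le_ball _ _ _ (k.+1%:R^-1 + k.+1%:R^-1)).
    by rewrite [leRHS]splitr lerD// ltW.
  case: (unliftP ord0 j) => [l ->|->].
    rewrite !cons_rVS /=; apply: ball_triangle; last exact: vB.
    by apply: ball_sym; exact: uB.
  by rewrite !cons_rV0 /=; apply: ball_triangle; [apply: ball_sym; exact: xB|].
apply: countable_bigcupT_measurable => // i; rewrite /F; case: asboolP => // _.
apply: measurableX; first exact: measurable_ball.
by apply: sub_sigma_algebra; exact: ball_open.
Qed.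

HB.instance Definition _ n :=
  isMeasurableFun.Build _ _ _ _ (@cons_rV n) (@measurable_cons_rV n).

Definition lebesgue_cons n (m : {sigma_finite_measure set 'rV[R]_n -> \bar R}) :
  set 'rV[R]_n.+1 -> \bar R :=
  pushforward (@lebesgue_measure R \x m)%E (@cons_rV n).

Section lebesgue_cons.
Context n (m : {sigma_finite_measure set 'rV[R]_n -> \bar R}).

Let lebesgue_cons0 : lebesgue_cons m set0 = 0%E.
Proof. exact: measure0. Qed.

Let lebesgue_cons_ge0 A : (0 <= lebesgue_cons m A)%E.
Proof. exact: measure_ge0. Qed.

Let lebesgue_cons_sigma_additive : semi_sigma_additive (lebesgue_cons m).
Proof. exact: measure_semi_sigma_additive. Qed.

HB.instance Definition _ := isMeasure.Build _ _ _ (lebesgue_cons m)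
  lebesgue_cons0 lebesgue_cons_ge0 lebesgue_cons_sigma_additive.

Let lebesgue_cons_sigma_finite : sigma_finite setT (lebesgue_cons m).
Proof.
have [F TF Foo] : sigma_finite setT (@lebesgue_measure R \x m)%E.
  have /sigma_finiteP[F [TF ndF Foo]] := sigma_finiteT (@lebesgue_measure R).
  have /sigma_finiteP[G [TG ndG Goo]] := sigma_finiteT m.
  exists (fun k => F k `*` G k).
    rewrite -setXTT TF TG predeqE => -[x y]; split.
      move=> [/= [k _ Fkx] [l _ Gly]]; exists (maxn k l) => //; split.
      - by move: x Fkx; exact/subsetPset/ndF/leq_maxl.
      - by move: y Gly; exact/subsetPset/ndG/leq_maxr.
    by move=> [k _ []/= ? ?]; split; exists k.
  move=> k; have [? ?] := Foo k; have [? ?] := Goo k.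
  split; first exact: measurableX.
  by rewrite product_measure1E// lte_mul_pinfty// ge0_fin_numE.
pose uncons (w : 'rV[R]_n.+1) : measurableTypeR R * 'rV[R]_n :=
  (w ord0 ord0, \row_j w ord0 (lift ord0 j)).
have consK : cancel (@cons_rV n) uncons.
  move=> [x u]; rewrite /uncons cons_rV0; congr pair.
  by apply/rowP => j; rewrite mxE cons_rVS.
have munc : measurable_fun setT uncons.
  apply/measurable_fun_pairP; split.
    apply: (measurability _ (RGenOpens.measurableE R)).
    move=> _ [_ [a [b ->]] <-]; rewrite [X in measurable X]setTI.
    apply: sub_sigma_algebra.
    suff: open ((fst \o uncons) @^-1` `]a, b[) by [].
    rewrite openE => w /= wab.
    have /nbhs_ballP[e /= e0 eab] : nbhs (w ord0 ord0 : R) (`]a, b[%classic : set R).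
      by apply: open_nbhs_nbhs; split => //; exact: interval_open.
    by apply/nbhs_ballP; exists e => //= v [_ wv]; apply: eab; exact: wv.
  apply: (measurability (@open 'rV[R]_n)) => //.
  move=> _ [U oU <-]; rewrite [X in measurable X]setTI.
  apply: sub_sigma_algebra.
  suff: open ((snd \o uncons) @^-1` U) by [].
  rewrite openE => w /= wU.
  have /nbhs_ballP[e /= e0 eU] : nbhs (uncons w).2 U by exact: open_nbhs_nbhs.
  apply/nbhs_ballP; exists e => //= v [_ wv]; apply: eU.
  by split=> // i j; rewrite !mxE; exact: wv.
exists (fun k => uncons @^-1` F k); first by rewrite -preimage_bigcup -TF.
move=> k; have [mF Fk] := Foo k; split.
  by rewrite -[X in measurable X]setTI; exact: munc.
by rewrite /lebesgue_cons /pushforward -comp_preimage (_ : _ \o _ = id) //;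
  apply/funext => z; exact: consK.
Qed.

HB.instance Definition _ := Measure_isSigmaFinite.Build _ _ _ (lebesgue_cons m)
  lebesgue_cons_sigma_finite.

End lebesgue_cons.

Fixpoint lebesgue_rV n : {sigma_finite_measure set 'rV[R]_n -> \bar R} :=
  if n is n'.+1 then lebesgue_cons (lebesgue_rV n') else \d_(0 : 'rV[R]_0).

End lebesgue_measure_rV.

Notation finite_measure_rV R d := {finite_measure set 'rV[R]_d -> \bar R}.

Section stable_density.
Context {R : realType} {d : nat}.
Implicit Types (p v : R -> 'rV[R]_d -> R) (f : 'rV[R]_d -> R).

Definition dot (u x : 'rV[R]_d) : R := \sum_(i < d) u ord0 i * x ord0 i.

(* the norm [`|x|] of the library is the sup norm *)
Definition euclidean_norm (x : 'rV[R]_d) : R := Num.sqrt (dot x x).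

Definition locally_finite (m : set 'rV[R]_d -> \bar R) : Prop :=
  forall B : set 'rV[R]_d, measurable B -> bounded_set B -> (m B < +oo)%E.

(* The generator [- (-Delta)^(alpha/2) / 2] is the Fourier multiplier
   [- |u|^alpha / 2], whence the characteristic function
   [exp (- t |u|^alpha / 2)]; continuity selects the version of the density. *)
Record stable_transition_density (alpha : R) p : Prop := {
  stable_ge0 : forall (t : R) x, 0 < t -> 0 <= p t x ;
  stable_mass : forall t : R, 0 < t -> (\int[lebesgue_rV d]_x (p t x)%:E = 1)%E ;
  stable_continuous : forall (t : R) x, 0 < t ->
    {for (t, x), continuous (fun z : R * 'rV[R]_d => p z.1 z.2)} ;
  stable_chapman_kolmogorov : forall (s t : R) x, 0 < s -> 0 < t ->
    ((p (s + t) x)%:E = \int[lebesgue_rV d]_y (p s (x - y) * p t y)%:E)%E ;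
  stable_charfun_re : forall (t : R) u, 0 < t ->
    \int[lebesgue_rV d]_x (cos (dot u x) * p t x) =
    expR (- (t * euclidean_norm u `^ alpha / 2)) ;
  stable_charfun_im : forall (t : R) u, 0 < t ->
    \int[lebesgue_rV d]_x (sin (dot u x) * p t x) = 0 ;
  stable_gaussian : alpha = 2 -> forall (t : R) x, 0 < t ->
    p t x = (2 * pi * t) `^ (- (d%:R / 2)) *
            expR (- (euclidean_norm x ^+ 2 / (2 * t))) }.

Definition stable_semigroup p (t : R) f (x : 'rV[R]_d) : \bar R :=
  (\int[lebesgue_rV d]_y (p t (x - y) * f y)%:E)%E.

(* Mild form of [v' = Delta_alpha v / 2 - v^(1+beta)], [v 0 = f]; the
   subtracted nonnegative term is moved to the left-hand side. *)
Record mild_solution p (beta : R) f v : Prop := {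
  mild_ge0 : forall (t : R) x, 0 <= t -> 0 <= v t x ;
  mild_bounded : forall T : R, exists c, forall (t : R) x, 0 <= t <= T -> v t x <= c ;
  mild_measurable :
    measurable_fun [set z : R * 'rV[R]_d | 0 <= z.1] (fun z => v z.1 z.2) ;
  mild_initial : forall x, v 0 x = f x ;
  mild_eq : forall (t : R) x, 0 < t ->
    ((v t x)%:E +
       \int[lebesgue_measure]_(s in `[0%R, t[)
         stable_semigroup p (t - s)%R (fun y => v s y `^ (1 + beta))%R x =
     stable_semigroup p t f x)%E }.

End stable_density.

Section superprocess.
Context {R : realType} {d : nat} {dO : measure_display}
  {Omega : measurableType dO}.
Local Notation M := (finite_measure_rV R d).
Implicit Types (P : M -> probability Omega R) (xi : R -> Omega -> M)
  (tau : Omega -> \bar R).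

Definition measures_measurable : set (set M) :=
  <<s [set C | exists2 B : set 'rV[R]_d, measurable B &
         exists2 D : set (\bar R), measurable D &
           C = [set m : M | D (m B)]] >>.

(* Time is [0, +oo[; values of paths at negative times are irrelevant. *)
Definition paths_measurable : set (set (R -> M)) :=
  <<s [set G | exists2 t : R, 0 <= t &
         exists2 C, measures_measurable C & G = [set x | C (x t)]] >>.

Definition natural_filtration xi (t : R) : set (set Omega) :=
  <<s [set A | exists2 s : R, 0 <= s <= t &
         exists2 C, measures_measurable C & A = xi s @^-1` C] >>.

Definition stopping_time xi tau : Prop :=
  (forall w, 0 <= tau w)%E /\
  forall t : R, 0 <= t -> natural_filtration xi t [set w | (tau w <= t%:E)%E].

Definition stopped_sigma_algebra xi tau : set (set Omega) :=
  [set A | forall t : R, 0 <= t ->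
     natural_filtration xi t (A `&` [set w | (tau w <= t%:E)%E])].

Definition strong_markov P xi : Prop :=
  forall (mu : M) tau (A : set Omega) (G : set (R -> M)),
    stopping_time xi tau -> stopped_sigma_algebra xi tau A ->
    paths_measurable G ->
    let D := A `&` [set w | (tau w < +oo)%E] in
    (P mu (D `&` [set w | G (fun t => xi (fine (tau w) + t)%R w)]) =
     \int[P mu]_(w in D)
       P (xi (fine (tau w)) w) [set w' | G (fun t => xi t w')])%E.

Definition vaguely_rcll xi : Prop :=
  let test := [set f : 'rV[R]_d -> R | continuous f /\
                 compact (closure [set x | f x != 0])] in
  forall w,
    (forall (t : R) f, 0 <= t -> test f ->
       \int[xi s w]_x f x @[s --> t^'+] --> \int[xi t w]_x f x) /\
    (forall t : R, 0 < t ->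
       exists2 nu : {measure set 'rV[R]_d -> \bar R}, locally_finite nu &
         forall f, test f ->
           \int[xi s w]_x f x @[s --> t^'-] --> \int[nu]_x f x).

(* [P mu] is the law of the process started at the finite measure [mu];
   [p] is the transition density of the underlying motion. *)
Record superprocess (p : R -> 'rV[R]_d -> R) (beta : R) P xi : Prop := {
  super_measurable : forall (t : R) C, 0 <= t -> measures_measurable C ->
    measurable (xi t @^-1` C) ;
  super_kernel : forall G (D : set (\bar R)), paths_measurable G ->
    measurable D ->
    measures_measurable [set mu | D (P mu [set w | G (fun t => xi t w)])] ;
  super_initial : forall mu,
    {ae P mu, forall w, forall B, measurable B -> xi 0 w B = mu B} ;
  super_rcll : vaguely_rcll xi ;
  super_markov : strong_markov P xi ;
  super_laplace : forall f : 'rV[R]_d -> R,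
    measurable_fun setT f -> (forall x, 0 <= f x) ->
    (exists c, forall x, f x <= c) ->
    exists2 v, mild_solution p beta f v &
      forall (mu : M) (t : R), 0 <= t ->
        ('E_(P mu)[fun w => expR (- \int[xi t w]_x f x)] =
         (expR (- \int[mu]_x v t x))%:E)%E }.

Section sigma_finite_initial_measure.
Context {dW : measure_display} {W : measurableType dW} (Q : probability W R).

Record independent_copies P xi (mu_ : nat -> M) (Y : nat -> R -> W -> M) :
    Prop := {
  copies_measurable : forall i (t : R) C, 0 <= t -> measures_measurable C ->
    measurable (Y i t @^-1` C) ;
  copies_law : forall i G, paths_measurable G ->
    Q [set w | G (fun t => Y i t w)] =
    P (mu_ i) [set w | G (fun t => xi t w)] ;
  copies_independent : forall n (G : nat -> set (R -> M)),
    (forall i, paths_measurable (G i)) ->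
    (Q (\bigcap_(i in `I_n) [set w | G i (fun t => Y i t w)]) =
     \prod_(i < n) Q [set w | G i (fun t => Y i t w)])%E }.

(* [X], defined on the probability space [(W, Q)], is a version of the process
   [xi] started at the possibly infinite measure [mu]. *)
Definition superprocess_from P xi (mu : {measure set 'rV[R]_d -> \bar R})
    (X : R -> W -> {measure set 'rV[R]_d -> \bar R}) : Prop :=
  exists (mu_ : nat -> M) (Y : nat -> R -> W -> M),
    [/\ forall B, measurable B -> (mu B = \sum_(0 <= i <oo) mu_ i B)%E,
        independent_copies P xi mu_ Y &
        forall (t : R) w B, 0 <= t -> measurable B ->
          (X t w B = \sum_(0 <= i <oo) Y i t w B)%E].

Definition mean_measure (X : R -> W -> {measure set 'rV[R]_d -> \bar R})
    (t : R) (B : set 'rV[R]_d) : \bar R :=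
  (\int[Q]_w X t w B)%E.

End sigma_finite_initial_measure.

End superprocess.

(* Main.v *)
From HB Require Import structures.
Require Import Defs.
From mathcomp Require Import all_boot all_order all_algebra.
From mathcomp Require Import all_classical all_reals all_analysis.
From mathcomp Require Import measurable_realfun.
From mathcomp Require Import ring lra.
Import Order.TTheory GRing.Theory Num.Theory.
Import numFieldNormedType.Exports.
Set Implicit Arguments.
Unset Strict Implicit.
Unset Printing Implicit Defensive.
Local Open Scope classical_set_scope.
Local Open Scope ring_scope.

(** Write [S_t(B)] for the integral over [x] of [T_t 1_B (x)] against [mu],
    where [T_t] is the semigroup with density [p t]; this is
    [semigroup_mass p t B mu].

    For small [l] the solution [v] of the mild equation started at [l 1_B]
    satisfies [l T_t 1_B / 2 <= v_t <= l T_t 1_B]: the upper bound drops the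
    nonlinear term, and feeding it back into the equation shows that this term is
    at most [t l ^ beta] times [l T_t 1_B] ([mild_solution_bounds]). Through the
    Laplace functional, the upper bound yields [E X_t(B) <= S_t(B)] as [l] tends
    to [0] ([mean_mass_le], [mean_X_mass_le]). The lower bound serves for the
    converse: if [X_t(B)], a sum of independent contributions [Y_i(B)], is almost
    surely finite, it is bounded with positive probability, so the products of
    the [E exp (- l Y_i(B))] stay away from [0] and [S_t(B)] is finite
    ([semigroup_mass_finite]). So almost sure local finiteness gives
    [S_t(B) < oo] for bounded [B], which gives local finiteness of the mean, which
    gives back almost sure local finiteness because countably many boxes exhaust
    the bounded sets.

    There remains to see that [S_t(B) < oo] for all [t > 0] and all bounded [B]
    if and only if [mu p_t < oo] for all [t > 0]. This follows from inequalities
    [p t (x - y) <= C * p s x] for [y] in a bounded set ([stable_comparison]).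
    For [alpha = 2] the density is explicit and [s = 2 t] works. For [alpha < 2]
    any [s] works ([stable_comparison_lt2]), because every [p t x] lies between
    two multiples of [(1 + |x|) ^ (- n - alpha)] in dimension [n]
    ([stable_density_upper], [stable_density_lower]); taking [y = 0], finiteness
    of [mu p_t] then does not depend on [t].

    These two-sided bounds are derived from the characteristic function alone.
    First, [p t] is radially nonincreasing ([stable_unimodal]): the function
    [exp (- c |u| ^ alpha)] is a pointwise limit of nonnegative combinations of
    centred Gaussian functions of [u] ([stable_exponential_approx]), so its
    Fourier transform, tempered by a Gaussian factor to stay integrable, is a
    limit of nonnegative combinations of centred Gaussian functions. Second, the
    average [L s] of [1 - exp (- s ^ 2 |x| ^ 2 / 2)] under [p t] equals, by
    Parseval's identity, a Gaussian average of [1 - exp (- t |u| ^ alpha / 2)] at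
    scale [s] ([stable_gauss_deficit]), hence is comparable to [s ^ alpha] for
    [s <= 1]. This controls the mass of [p t] in shells of radius [r = 1 / s], and
    monotonicity turns masses of shells into pointwise bounds. *)

(** * Integration and measurability on [R^n] *)

Section integral_mono.
Import HBNNSimple.

(** The integral of a nonnegative function is a supremum over the simple functions
    below it, so monotonicity holds without measurability; this matters for the
    time integral in the mild equation. *)
Lemma ge0_integral_mono {d} {T : measurableType d} {R : realType}
    (mu : {measure set T -> \bar R}) (D : set T) (f g : T -> \bar R) :
  (forall x, D x -> 0 <= f x)%E -> (forall x, D x -> f x <= g x)%E ->
  (\int[mu]_(x in D) f x <= \int[mu]_(x in D) g x)%E.
Proof.
move=> f0 fg.
rewrite !ge0_integralE//; last by move=> x Dx; exact: le_trans (f0 _ Dx) (fg _ Dx).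
apply: ereal_sup_le => _ /= [h hf <-].
exists h => // x; apply: le_trans (hf x) _.
by rewrite /patch; case: ifPn => // /[!inE]; exact: fg.
Qed.
End integral_mono.

Section borel_rV.
Context {R : realType}.

Lemma continuous_measurable_rV n (f : 'rV[R]_n -> R) :
  continuous f -> measurable_fun setT f.
Proof.
move=> cf; apply: (measurability _ (RGenOpens.measurableE R)).
move=> _ [_ [a [b ->]] <-]; rewrite setTI.
apply: sub_sigma_algebra; apply: (open_comp (fun x _ => cf x)).
exact: interval_open.
Qed.

Lemma measurable_coord n (j : 'I_n) :
  measurable_fun setT (fun x : 'rV[R]_n => x ord0 j).
Proof. by apply: continuous_measurable_rV; exact: coord_continuous. Qed.

Lemma measurable_fun_rV {dT} {T : measurableType dT} n
    (f : T -> 'rV[R]_n) :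
  (forall j, measurable_fun setT (fun t => f t ord0 j)) -> measurable_fun setT f.
Proof.
elim: n f => [f _|n IH f mf].
  have -> : f = cst 0 by apply/funext => t; apply/rowP => -[].
  exact: measurable_cst.
pose tl t : 'rV[R]_n := \row_j f t ord0 (lift ord0 j).
have -> : f = @cons_rV R n \o (fun t => (f t ord0 ord0, tl t)).
  apply/funext => t /=; apply/rowP => j.
  case: (unliftP ord0 j) => [l ->|->]; last by rewrite cons_rV0.
  by rewrite cons_rVS mxE.
apply: measurableT_comp; first exact: measurable_cons_rV.
apply: measurable_fun_pair; first exact: mf.
by apply: IH => j; under eq_fun do rewrite mxE; exact: mf.
Qed.

Lemma measurable_fun_rVB {dT} {T : measurableType dT} n
    (f g : T -> 'rV[R]_n) : measurable_fun setT f -> measurable_fun setT g ->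
  measurable_fun setT (fun t => f t - g t).
Proof.
move=> mf mg; apply: measurable_fun_rV => j.
under eq_fun do rewrite !mxE.
by apply: measurable_funB; exact: (measurableT_comp (measurable_coord j)).
Qed.

Lemma measurable_dot n {dT} {T : measurableType dT}
    (f g : T -> 'rV[R]_n) : measurable_fun setT f -> measurable_fun setT g ->
  measurable_fun setT (fun t => dot (f t) (g t)).
Proof.
move=> mf mg; rewrite /dot; apply: measurable_sum => i.
by apply: measurable_funM; exact: (measurableT_comp (measurable_coord i)).
Qed.

Lemma integral_lebesgue_cons n (f : 'rV[R]_n.+1 -> \bar R) :
  measurable_fun setT f -> (forall x, 0 <= f x)%E ->
  (\int[lebesgue_rV n.+1]_x f x =
   \int[lebesgue_measure]_t \int[lebesgue_rV n]_u f (cons_rV (t, u)))%E.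
Proof.
move=> mf f0.
rewrite [LHS](ge0_integral_pushforward (@measurable_cons_rV R n))//.
rewrite preimage_setT fubini_tonelli1//; last by move=> x; exact: f0.
exact: measurableT_comp mf (@measurable_cons_rV R n).
Qed.

Lemma integral_lebesgue_rV0 (f : 'rV[R]_0 -> \bar R) :
  (\int[lebesgue_rV 0]_x f x = f 0%R)%E.
Proof.
rewrite /= integral_dirac//; first by rewrite diracT mul1e.
have -> : f = cst (f 0) by apply/funext => x; congr f; apply/rowP => -[].
exact: measurable_cst.
Qed.

(** Reflections preserve lengths of intervals. Composing two of them gives the
    translations below. *)
Lemma integral_lebesgueB (b : R) (f : R -> \bar R) :
  measurable_fun setT f -> (forall x, 0 <= f x)%E ->
  (\int[lebesgue_measure]_x f (b - x)%R = \int[lebesgue_measure]_x f x)%E.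
Proof.
move=> mf f0; pose phi (x : measurableTypeR R) : measurableTypeR R := b - x.
have mphi : measurable_fun setT phi by exact: measurable_funB.
transitivity (\int[pushforward lebesgue_measure phi]_x f x)%E.
  by rewrite (ge0_integral_pushforward mphi).
apply: eq_measure_integral => A mA _; apply/esym.
pose mphi_mixin := isMeasurableFun.Build _ _ _ _ _ mphi.
pose phi' : {mfun _ >-> _} := HB.pack phi mphi_mixin.
apply: (@lebesgue_measure_unique _ (pushforward lebesgue_measure phi')) => //.
move=> _ [[x y] _ <-]; rewrite /= /pushforward.
have -> : phi @^-1` `]x, y]%classic = `[b - y, b - x[%classic.
  by apply/seteqP; split => z /=; rewrite /phi !in_itv/= => /andP[? ?];
    apply/andP; split; lra.
rewrite !lebesgue_measure_itv/= !lte_fin.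
have -> : (b - y < b - x) = (x < y) by apply/idP/idP => ?; lra.
by case: ifP => // _; rewrite -!EFinB; congr EFin; lra.
Qed.

Lemma integral_lebesgueB_signed (b : R) (f : R -> \bar R) :
  measurable_fun setT f ->
  (\int[lebesgue_measure]_x f (b - x)%R = \int[lebesgue_measure]_x f x)%E.
Proof.
move=> mf; rewrite [LHS]integralE [RHS]integralE; congr (_ - _)%E.
  rewrite -(integral_lebesgueB b (measurable_funepos mf) (funepos_ge0 f)).
  by apply: eq_integral => x _; rewrite !funeposE.
rewrite -(integral_lebesgueB b (measurable_funeneg mf) (funeneg_ge0 f)).
by apply: eq_integral => x _; rewrite !funenegE.
Qed.

Lemma integral_lebesgueD (b : R) (f : R -> \bar R) :
  measurable_fun setT f ->
  (\int[lebesgue_measure]_x f (x + b)%R = \int[lebesgue_measure]_x f x)%E.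
Proof.
move=> mf; rewrite -(integral_lebesgueB_signed b mf).
rewrite -(integral_lebesgueB_signed 0 (f := fun x => f (x + b)%R)).
  by apply: eq_integral => x _; rewrite sub0r addrC.
by apply: measurableT_comp => //; exact: measurable_funD.
Qed.

Lemma integral_lebesgue_rVB n (b : 'rV[R]_n) (f : 'rV[R]_n -> \bar R) :
  measurable_fun setT f -> (forall x, 0 <= f x)%E ->
  (\int[lebesgue_rV n]_x f (b - x)%R = \int[lebesgue_rV n]_x f x)%E.
Proof.
elim: n b f => [b f mf f0|n IH b f mf f0].
  by rewrite !integral_lebesgue_rV0; congr f; apply/rowP => -[].
have mB : measurable_fun setT (fun x : 'rV[R]_n.+1 => b - x) by exact: measurable_fun_rVB.
rewrite integral_lebesgue_cons//; last exact: measurableT_comp mf mB.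
rewrite [RHS](integral_lebesgue_cons mf f0).
pose b' : 'rV[R]_n := \row_j b ord0 (lift ord0 j).
have E (t : R) (u : 'rV[R]_n) :
    b - cons_rV (t, u) = cons_rV (b ord0 ord0 - t, b' - u).
  apply/rowP => j; rewrite !mxE.
  by case: (unliftP ord0 j) => [l ->|->] //=; rewrite !mxE.
under eq_integral => t _ do under eq_integral => u _ do rewrite E.
have mcons : measurable_fun setT (f \o @cons_rV R n).
  exact: measurableT_comp mf (@measurable_cons_rV R n).
under eq_integral => t _.
  rewrite (IH b' (fun u => f (cons_rV (b ord0 ord0 - t, u))))//; last first.
    exact: measurableT_comp mcons (pair1_measurable _).
  over.
rewrite (integral_lebesgueB (b ord0 ord0)
  (f := fun t => \int[lebesgue_rV n]_u f (cons_rV (t, u)))%E)//; last first.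
  by move=> t; exact: integral_ge0.
apply: (measurable_fun_fubini_tonelli_F (m2 := lebesgue_rV n) (f \o @cons_rV R n) mcons).
by move=> x; exact: f0.
Qed.

Lemma integral_lebesgue_rVD n (b : 'rV[R]_n) (f : 'rV[R]_n -> \bar R) :
  measurable_fun setT f -> (forall x, 0 <= f x)%E ->
  (\int[lebesgue_rV n]_x f (x + b)%R = \int[lebesgue_rV n]_x f x)%E.
Proof.
move=> mf f0; rewrite -(integral_lebesgue_rVB b mf f0).
rewrite -(integral_lebesgue_rVB 0 (f := fun x => f (x + b)))//.
- by apply: eq_integral => x _; rewrite sub0r addrC.
- apply: measurableT_comp => //.
  have -> : (fun x : 'rV[R]_n => x + b) = (fun x => x - - b).
    by apply/funext => x; rewrite opprK.
  exact: measurable_fun_rVB.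
Qed.

Definition box n (a b : R) : set 'rV[R]_n :=
  [set x | forall j, a <= x ord0 j <= b].

Lemma measurable_box n a b : measurable (@box n a b).
Proof.
have -> : @box n a b = \bigcap_(j in [set: 'I_n]) [set x | a <= x ord0 j <= b].
  by apply/seteqP; split => x /= H j; [move=> _|]; exact: H.
apply: fin_bigcap_measurable => // j _.
have := @measurable_coord n j measurableT `[a, b]%classic (measurable_itv _).
by rewrite setTI; congr measurable; apply/seteqP; split => x /=; rewrite in_itv.
Qed.

Lemma lebesgue_box n a b : a <= b ->
  (lebesgue_rV n (box a b) = ((b - a) ^+ n)%:E)%E.
Proof.
move=> ab; elim: n => [|n IH].
  rewrite /= diracE mem_set ?expr0//; by case.
rewrite -(setIT (box a b)) -integral_indic//; last exact: measurable_box.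
rewrite integral_lebesgue_cons//; last first.
  by apply/measurable_EFinP; apply: measurable_indic; exact: measurable_box.
have E (t : R) (u : 'rV[R]_n) : \1_(box a b) (cons_rV (t, u)) =
    \1_(`[a, b]%classic) t * \1_(box a b) u :> R.
  rewrite !indicE -natrM mulnb; congr ((nat_of_bool _)%:R).
  apply/idP/andP => [|[]]; rewrite !inE.
    move=> H; split; rewrite /= ?in_itv/=; first by have := H ord0; rewrite cons_rV0.
    by move=> j; have := H (lift ord0 j); rewrite cons_rVS.
  rewrite /= in_itv/= => H1 H2 j.
  by case: (unliftP ord0 j) => [l ->|->]; rewrite ?cons_rVS ?cons_rV0//.
under eq_integral => t _.
  under eq_integral do rewrite E EFinM.
  rewrite ge0_integralZl//; last first.
    by apply/measurable_EFinP; apply: measurable_indic; exact: measurable_box.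
  rewrite integral_indic//; last exact: measurable_box.
  rewrite setIT [X in (_ * X)%E]IH; over.
rewrite ge0_integralZr//; last 2 first.
  by apply/measurable_EFinP; apply: measurable_indic; exact: measurable_itv.
  by rewrite lee_fin exprn_ge0// subr_ge0.
rewrite integral_indic//= setIT lebesgue_measure_itv/= lte_fin.
rewrite exprS EFinM; move: ab; rewrite le_eqVlt => /predU1P[->|->] //.
by rewrite ltxx subrr mul0e.
Qed.
End borel_rV.

(** * Characteristic functions of normal densities *)

Lemma dominated_integrable {d} {T : measurableType d} {R : realType}
    (mu : {measure set T -> \bar R}) (f g : T -> R) :
  measurable_fun setT f -> mu.-integrable setT (EFin \o g) ->
  (forall x, `|f x| <= g x) -> mu.-integrable setT (EFin \o f).
Proof.
move=> mf ig fg; apply: le_integrable ig => //; first exact/measurable_EFinP.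
by move=> x _ /=; rewrite lee_fin (le_trans (fg x))// ler_norm.
Qed.

Lemma integrable_EFinZl {d} {T : measurableType d} {R : realType}
    (mu : {measure set T -> \bar R}) (f : T -> R) k :
  mu.-integrable setT (EFin \o f) ->
  mu.-integrable setT (EFin \o (fun x => k * f x)).
Proof. by move=> fi; exact: (integrableZl measurableT k fi). Qed.

Lemma measurable_cosT {R : realType} {d} {T : measurableType d} (f : T -> R) :
  measurable_fun setT f -> measurable_fun setT (fun x => cos (f x)).
Proof.
by apply: measurableT_comp; apply: continuous_measurable_fun; exact: continuous_cos.
Qed.

Lemma measurable_sinT {R : realType} {d} {T : measurableType d} (f : T -> R) :
  measurable_fun setT f -> measurable_fun setT (fun x => sin (f x)).
Proof.
by apply: measurableT_comp; apply: continuous_measurable_fun; exact: continuous_sin.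
Qed.

Lemma cos_le_norm1 {R : realType} (x : R) : `|cos x| <= 1.
Proof. by rewrite ler_norml cos_geN1 cos_le1. Qed.

Lemma sin_le_norm1 {R : realType} (x : R) : `|sin x| <= 1.
Proof. by rewrite ler_norml sin_geN1 sin_le1. Qed.

Section normal_charfun.
Context {R : realType} (s : R).
Hypothesis s0 : 0 < s.
Local Notation leb := (@lebesgue_measure R).
Local Notation g := (normal_pdf 0 s).
Let sn0 : s != 0. Proof. by rewrite gt_eqF. Qed.

Let gE x : g x = normal_peak s * expR (- x ^+ 2 / (s ^+ 2 *+ 2)).
Proof. by rewrite normal_pdfE// /normal_fun subr0. Qed.

Let F (u : R) : R := \int[leb]_x (cos (u * x) * g x).

Let int_cos u : leb.-integrable setT (fun x => (cos (u * x) * g x)%:E).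
Proof.
apply: (dominated_integrable _ (integrable_normal_pdf 0 s)).
  apply: measurable_funM; last exact: measurable_normal_pdf.
  by apply: measurable_cosT; exact: measurable_funM.
move=> x; rewrite normrM [X in _ * X]ger0_norm ?normal_pdf_ge0//.
by rewrite ler_piMl ?normal_pdf_ge0 ?cos_le_norm1.
Qed.

Let int_sin m u : leb.-integrable setT (fun x => (sin (u * x) * normal_pdf m s x)%:E).
Proof.
apply: (dominated_integrable _ (integrable_normal_pdf m s)).
  apply: measurable_funM; last exact: measurable_normal_pdf.
  by apply: measurable_sinT; exact: measurable_funM.
move=> x; rewrite normrM [X in _ * X]ger0_norm ?normal_pdf_ge0//.
by rewrite ler_piMl ?normal_pdf_ge0 ?sin_le_norm1.
Qed.

Let sin0 u : \int[leb]_x (sin (u * x) * g x) = 0.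
Proof.
have : \int[leb]_x (sin (u * x) * g x) = - \int[leb]_x (sin (u * x) * g x).
  rewrite -[RHS]mulN1r -RintegralZl//; last exact: int_sin.
  rewrite {1}/Rintegral -(@integral_lebesgueB_signed _ 0); last first.
    apply/measurable_EFinP/measurable_funM; last exact: measurable_normal_pdf.
    by apply: measurable_sinT; exact: measurable_funM.
  apply: eq_Rintegral => x _.
  by rewrite sub0r mulrN sinN !gE sqrrN mulN1r mulNr.
by move: (\int[leb]_x _) => z H; lra.
Qed.

Let sin_shift u m :
  \int[leb]_x (sin (u * x) * normal_pdf m s x) = sin (u * m) * F u.
Proof.
rewrite {1}/Rintegral -(@integral_lebesgueD _ m); last first.
  apply/measurable_EFinP/measurable_funM; last exact: measurable_normal_pdf.
  by apply: measurable_sinT; exact: measurable_funM.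
transitivity (\int[leb]_x (sin (u * m) * (cos (u * x) * g x) +
                           cos (u * m) * (sin (u * x) * g x))).
  apply: eq_Rintegral => x _.
  have -> : normal_pdf m s (x + m) = g x.
    by rewrite !normal_pdfE// /normal_fun addrK subr0.
  by rewrite mulrDr sinD mulrDl; ring.
rewrite RintegralD//; last 2 first.
  by apply: integrable_EFinZl; exact: int_cos.
  by apply: integrable_EFinZl; exact: int_sin.
rewrite RintegralZl//; last exact: int_cos.
rewrite RintegralZl//; last exact: int_sin.
by rewrite sin0 mulr0 addr0.
Qed.

(** A Gaussian of twice the width dominates both parameter derivatives below. *)
Let dom (x : R) : R := s * expR ((4 * s ^+ 2)^-1) * normal_peak s /
  normal_peak (2 * s) * normal_pdf 0 (2 * s) x.

Let dom_ge0 x : 0 <= dom x.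
Proof.
by rewrite mulr_ge0 ?normal_pdf_ge0// !mulr_ge0 ?invr_ge0 ?expR_ge0
  ?normal_peak_ge0// ltW.
Qed.

Let int_dom : leb.-integrable setT (fun x => (dom x)%:E).
Proof. by apply: integrable_EFinZl; exact: integrable_normal_pdf. Qed.

Let domE m x : `|m| <= 1 -> `|x - m| * normal_pdf m s x <= dom x.
Proof.
move=> m1; have s20 : (2 * s) != 0 by rewrite mulf_neq0.
rewrite /dom !normal_pdfE// /normal_fun subr0.
set y := x - m.
rewrite [leRHS](_ : _ = normal_peak s * (s * expR ((4 * s ^+ 2)^-1) *
    expR (- x ^+ 2 / ((2 * s) ^+ 2 *+ 2)))); last first.
  by field; rewrite gt_eqF// normal_peak_gt0.
rewrite mulrCA ler_wpM2l ?normal_peak_ge0//.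
have ys : `|y| <= s * expR (y ^+ 2 / (4 * s ^+ 2)).
  rewrite -ler_pdivrMl//; apply: le_trans (expR_ge1Dx _).
  rewrite -[y ^+ 2]real_normK ?num_real//.
  have : 0 <= (s^-1 * `|y| / 2 - 1) ^+ 2 by exact: sqr_ge0.
  have -> : `|y| ^+ 2 / (4 * s ^+ 2) = (s^-1 * `|y| / 2) ^+ 2.
    by field.
  by move: (s^-1 * `|y|) => z; nra.
apply: (@le_trans _ _ (s * expR (y ^+ 2 / (4 * s ^+ 2)) *
    expR (- y ^+ 2 / (s ^+ 2 *+ 2)))); first by rewrite ler_wpM2r// expR_ge0.
rewrite -2!mulrA ler_pM2l// -!expRD ler_expR.
have -> : (4 * s ^+ 2)^-1 + - x ^+ 2 / ((2 * s) ^+ 2 *+ 2) =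
   (2 - x ^+ 2) / (8 * s ^+ 2) by field.
have -> : y ^+ 2 / (4 * s ^+ 2) + - y ^+ 2 / (s ^+ 2 *+ 2) =
   (- (2 * y ^+ 2)) / (8 * s ^+ 2) by field.
rewrite ler_pM2r ?invr_gt0 ?mulr_gt0 ?exprn_gt0//.
have -> : x = y + m by rewrite /y subrK.
have : m ^+ 2 <= 1 by rewrite -[m ^+ 2]real_normK ?num_real// expr_le1.
have : 0 <= (y - m) ^+ 2 by exact: sqr_ge0.
by nra.
Qed.

Let int_xsin u : leb.-integrable setT (EFin \o (fun x => sin (u * x) * (x * g x))).
Proof.
apply: (dominated_integrable _ int_dom).
  apply: measurable_funM; last by apply: measurable_funM => //; exact: measurable_normal_pdf.
  by apply: measurable_sinT; exact: measurable_funM.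
move=> x; apply: le_trans (@domE 0 x _); last by rewrite normr0.
rewrite subr0 2!normrM mulrA [X in _ * X]ger0_norm ?normal_pdf_ge0//.
by rewrite ler_wpM2r ?normal_pdf_ge0// ler_piMl// sin_le_norm1.
Qed.

Let dF u : is_derive u (1:R) F (- \int[leb]_x (sin (u * x) * (x * g x))).
Proof.
pose f (u x : R) := cos (u * x) * g x.
have df (v x : R) : is_derive v (1:R) (f ^~ x) (- x * sin (v * x) * g x).
  have h : is_derive v (1:R) ( *%R ^~ x) x.
    rewrite (_ : *%R ^~ x = x \*: (@id R)); last by apply/funext => z; rewrite mulrC.
    apply: (is_derive_eq (is_deriveZ x (is_derive_id v (1:R)))).
    exact: mulr1.
  have h2 : is_derive v (1:R) (cos \o ( *%R ^~ x)) (- sin (v * x) * x).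
    exact: (is_derive1_comp (is_derive_cos _) h).
  rewrite (_ : f ^~ x = g x \*: (cos \o ( *%R ^~ x))); last first.
    by apply/funext => z; rewrite /f mulrC.
  apply: (is_derive_eq (is_deriveZ (g x) h2)).
  by transitivity (g x * (- sin (v * x) * x)) => //; ring.
have u1 : `]u - 1, u + 1[%classic u by rewrite /= in_itv/=; apply/andP; split; lra.
have df' (v x : R) : derivable (f ^~ x) v 1 by have [] := df v x.
have d1 (v x : R) : partial1of2 f v x = - x * sin (v * x) * g x.
  by rewrite partial1of2E; have [] := df v x.
have G v x : `]u - 1, u + 1[%classic v -> setT x -> `|partial1of2 f v x| <= dom x.
  move=> _ _; rewrite d1; apply: le_trans (@domE 0 x _); last by rewrite normr0.
  rewrite subr0 !normrM normrN [X in _ * X]ger0_norm ?normal_pdf_ge0//.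
  by rewrite ler_wpM2r ?normal_pdf_ge0// ler_piMr// sin_le_norm1.
have := derivable_under_integral (@measurableT _ _) u1 (fun v _ => int_cos v)
   (fun v x _ _ => df' v x) dom_ge0 int_dom G.
have := differentiation_under_integral (@measurableT _ _) u1 (fun v _ => int_cos v)
   (fun v x _ _ => df' v x) dom_ge0 int_dom G.
rewrite derive1E => E dd; apply: DeriveDef; first exact: dd.
rewrite E -mulN1r -RintegralZl//.
by apply: eq_Rintegral => x _; rewrite d1; ring.
Qed.

(** The derivative in the mean, at [m = 0], of the two sides of [sin_shift]:
    on the left it brings out the factor [x / s ^ 2]. *)
Let xsinE u : \int[leb]_x (sin (u * x) * (x * g x)) = s ^+ 2 * u * F u.
Proof.
pose f (m x : R) := sin (u * x) * normal_pdf m s x.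
have df (m x : R) : is_derive m (1:R) (f ^~ x)
    (sin (u * x) * ((x - m) / s ^+ 2 * normal_pdf m s x)).
  have h : is_derive m (1:R) (fun m => - (s ^+ 2 *+ 2)^-1 * (m - x) ^+ 2)
     ((x - m) / s ^+ 2).
    have h1 : is_derive m (1:R) (id - cst x) 1.
      by apply: (is_derive_eq (is_deriveB _ _)); rewrite subr0.
    apply: (is_derive_eq (is_deriveZ (- (s ^+ 2 *+ 2)^-1) (is_deriveX 2 h1))).
    transitivity (- (s ^+ 2 *+ 2)^-1 * (2 * (m - x) ^+ 1 * 1)) => //.
    by field.
  have h2 := is_derive1_comp (is_derive_expR _) h.
  have h3 := is_deriveZ (sin (u * x) * normal_peak s) h2.
  rewrite (_ : f ^~ x = (sin (u * x) * normal_peak s) \*: (expR \o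
     (fun m => - (s ^+ 2 *+ 2)^-1 * (m - x) ^+ 2))); last first.
    apply/funext => z; rewrite /f normal_pdfE// /normal_fun /= mulrA.
    rewrite -[RHS]/(_ * _); congr (_ * expR _).
    by rewrite -(opprB x) sqrrN; ring.
  apply: (is_derive_eq h3).
  rewrite -[LHS]/(_ * (_ * _)) normal_pdfE// /normal_fun.
  rewrite (_ : - (x - m) ^+ 2 / (s ^+ 2 *+ 2) = - (s ^+ 2 *+ 2)^-1 * (m - x) ^+ 2); last first.
    by rewrite -(opprB x) sqrrN; ring.
  by ring.
have I0 : `]-1, 1[%classic (0:R) by rewrite /= in_itv/= ltrN10 ltr01.
have df' (v x : R) : derivable (f ^~ x) v 1 by have [] := df v x.
have d1 (v x : R) : partial1of2 f v x = (sin (u * x) * ((x - v) / s ^+ 2 * normal_pdf v s x)).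
  by rewrite partial1of2E; have [] := df v x.
have dom0 x : 0 <= s ^- 2 * dom x by rewrite mulr_ge0// invr_ge0 sqr_ge0.
have G v x : `]-1, 1[%classic v -> setT x -> `|partial1of2 f v x| <= s ^- 2 * dom x.
  rewrite /= in_itv/= => /andP[v1 v2] _; rewrite d1.
  apply: (@le_trans _ _ (s ^- 2 * (`|x - v| * normal_pdf v s x))); last first.
    by rewrite ler_wpM2l ?invr_ge0 ?sqr_ge0// domE// ler_norml ltW//= ltW.
  rewrite !normrM [X in _ * (_ * X)]ger0_norm ?normal_pdf_ge0//.
  rewrite [X in _ * (_ * X * _)]ger0_norm ?invr_ge0 ?sqr_ge0//.
  rewrite -mulrA [X in _ * X <= _](_ : _ = s ^- 2 * (`|x - v| * normal_pdf v s x)); last by ring.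
  by rewrite ler_piMl ?sin_le_norm1// mulr_ge0 ?invr_ge0 ?sqr_ge0// mulr_ge0// normal_pdf_ge0.
have := differentiation_under_integral (@measurableT _ _) I0 (fun v _ => int_sin v u)
   (fun v x _ _ => df' v x) dom0 (integrable_EFinZl (s ^- 2) int_dom) G.
rewrite derive1E.
under eq_fun do rewrite sin_shift.
under [in X in _ = X -> _]eq_Rintegral do rewrite d1 subr0.
have hs : is_derive (0:R) (1:R) (fun m => sin (u * m) * F u) (u * F u).
  have h : is_derive (0:R) (1:R) (fun m => u * m) u.
    by apply: (is_derive_eq (is_deriveZ u (is_derive_id (0:R) (1:R)))); exact: mulr1.
  have h2 := is_derive1_comp (is_derive_sin _) h.
  rewrite (_ : (fun m => _) = F u \*: (sin \o (fun m => u * m))); last first.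
    by apply/funext => m; rewrite mulrC.
  apply: (is_derive_eq (is_deriveZ (F u) h2)).
  by rewrite -[LHS]/(_ * (_ * _)) mulr0 cos0 mul1r mulrC.
have [_ ->] := hs.
rewrite (_ : \int[leb]_x (sin (u * x) * (x / s ^+ 2 * g x)) =
    s ^- 2 * \int[leb]_x (sin (u * x) * (x * g x))).
  by move: (\int[leb]_x _) => z H; rewrite -mulrA H mulrA divff ?mul1r// expf_neq0.
by rewrite -RintegralZl//; apply: eq_Rintegral => x _; ring.
Qed.

(** [F' = - s ^ 2 u F], by [dF] and [xsinE], so [F(u) exp (s ^ 2 u ^ 2 / 2)] is
    constant. *)
Lemma normal_charfun u :
  \int[leb]_x (cos (u * x) * g x) = expR (- (s ^+ 2 * u ^+ 2) / 2).
Proof.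
pose E (v : R) := 2^-1 * s ^+ 2 * v ^+ 2.
have dE v : is_derive v (1:R) E (s ^+ 2 * v).
  have h := is_deriveZ (2^-1 * s ^+ 2) (is_deriveX 2 (is_derive_id v (1:R))).
  apply: (is_derive_eq h).
  transitivity (2^-1 * s ^+ 2 * ((2%:R * v ^+ 1) * 1)) => //; by field.
have dH v : is_derive v (1:R) (F * (expR \o E)) 0.
  apply: (is_derive_eq (is_deriveM (dF v) (is_derive1_comp (is_derive_expR _) (dE v)))).
  rewrite xsinE -[LHS]/(_ * _ + _ * _) /=; ring.
have F0 : F 0 = 1.
  rewrite /F (_ : (fun x => _) = g).
    by rewrite /Rintegral integral_normal_pdf.
  by apply/funext => x; rewrite mul0r cos0 mul1r.
have := is_derive_0_is_cst u 0 dH.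
rewrite -[X in X = _ -> _]/(F u * expR (E u)) -[X in _ = X -> _]/(F 0 * expR (E 0)).
rewrite F0 /E expr0n/= mulr0 expR0 mulr1 => FE.
have -> : - (s ^+ 2 * u ^+ 2) / 2 = - (2^-1 * s ^+ 2 * u ^+ 2) by ring.
rewrite -[LHS]/(F u) expRN; set e := expR _ in FE *.
have e0 : e != 0 by rewrite gt_eqF// expR_gt0.
by apply: (mulIf e0); rewrite FE mulVf.
Qed.

Lemma integral_normal_cos k u c :
  (\int[leb]_x ((1 + k * cos (u * x + c)) * g x)%:E =
  (1 + k * cos c * expR (- (s ^+ 2 * u ^+ 2) / 2))%:E)%E.
Proof.
have ig := integrable_normal_pdf 0 s.
have E x : (1 + k * cos (u * x + c)) * g x = g x + (k * cos c * (cos (u * x) * g x) -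
     k * sin c * (sin (u * x) * g x)) by rewrite cosD; ring.
have i1 := integrable_EFinZl (k * cos c) (int_cos u).
have i2 := integrable_EFinZl (k * sin c) (int_sin 0 u).
have i3 : leb.-integrable setT (EFin \o (fun x => k * cos c * (cos (u * x) * g x) -
     k * sin c * (sin (u * x) * g x))).
  exact: (integrableB measurableT i1 i2).
have i4 : leb.-integrable setT (EFin \o (fun x => (1 + k * cos (u * x + c)) * g x)).
  by rewrite (funext E); exact: (integrableD measurableT ig i3).
rewrite -[LHS]fineK; last exact: (integrable_fin_num _ i4).
congr EFin; rewrite -[LHS]/(Rintegral _ _ _).
under eq_Rintegral do rewrite E.
rewrite (RintegralD measurableT ig i3) (RintegralB measurableT i1 i2).
rewrite (RintegralZl _ measurableT (int_cos u)) (RintegralZl _ measurableT (int_sin 0 u)).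
by rewrite sin0 mulr0 subr0 normal_charfun {1}/Rintegral integral_normal_pdf.
Qed.
End normal_charfun.

(** * Gaussian densities on [R^n] *)

Section dot_theory.
Context {R : realType} {n : nat}.
Implicit Types x y u : 'rV[R]_n.

Lemma dotxx_ge0 x : 0 <= dot x x.
Proof. by apply: sumr_ge0 => i _; rewrite -expr2 sqr_ge0. Qed.

Lemma dotC x y : dot x y = dot y x.
Proof. by apply: eq_bigr => i _; rewrite mulrC. Qed.

Lemma dotBl x y u : dot (x - y) u = dot x u - dot y u.
Proof. by rewrite /dot -sumrB; apply: eq_bigr => i _; rewrite !mxE mulrBl. Qed.

Lemma sqr_euclidean_norm x : euclidean_norm x ^+ 2 = dot x x.
Proof. by rewrite sqr_sqrtr// dotxx_ge0. Qed.

Lemma sqr_coord_le_dot x i : x ord0 i ^+ 2 <= dot x x.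
Proof.
rewrite /dot (bigD1 i)//= -expr2 lerDl; apply: sumr_ge0 => j _.
by rewrite -expr2 sqr_ge0.
Qed.

Lemma dot_le_box x r : (forall i, `|x ord0 i| <= r) -> dot x x <= n%:R * r ^+ 2.
Proof.
move=> xr; apply: (@le_trans _ _ (\sum_(i < n) r ^+ 2)).
  apply: ler_sum => i _; rewrite -expr2 -real_normK ?num_real//.
  by rewrite lerXn2r// nnegrE (le_trans _ (xr i)).
by rewrite sumr_const card_ord mulr_natl.
Qed.

Lemma dot_parallelogram x y : dot (x - y) (x - y) <= 2 * dot x x + 2 * dot y y.
Proof.
rewrite /dot !mulr_sumr -big_split/=; apply: ler_sum => i _.
have -> : (x - y) ord0 i = x ord0 i - y ord0 i by rewrite !mxE.
have := sqr_ge0 (x ord0 i + y ord0 i); move: (x ord0 i) (y ord0 i) => a b; nra.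
Qed.
End dot_theory.

Section gauss.
Context {R : realType}.
Local Notation leb := lebesgue_measure.

Definition gauss n (s : R) (x : 'rV[R]_n) : R :=
  \prod_(i < n) normal_pdf 0 s (x ord0 i).

Lemma gauss_ge0 n s (x : 'rV[R]_n) : 0 <= gauss s x.
Proof. by apply: prodr_ge0 => i _; exact: normal_pdf_ge0. Qed.

Lemma measurable_gauss n s : measurable_fun setT (@gauss n s).
Proof.
rewrite /gauss; apply: measurable_prod => i _.
exact: (measurableT_comp (measurable_normal_pdf 0 s) (measurable_coord i)).
Qed.

Lemma gaussE n s (x : 'rV[R]_n) : s != 0 ->
  gauss s x = normal_peak s ^+ n * expR (- dot x x / (s ^+ 2 *+ 2)).
Proof.
move=> s0; rewrite /gauss normal_pdfE//.
under eq_bigr do rewrite /normal_fun subr0.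
rewrite big_split/= prodr_const card_ord -expR_sum; congr (_ * expR _).
by rewrite mulNr /dot mulr_suml -sumrN; apply: eq_bigr => i _; rewrite expr2 mulNr.
Qed.

(** The condition [0 <= k <= 1] keeps the integrand nonnegative, so that Tonelli's
    theorem applies; it is preserved by the induction, which replaces [k] by [k]
    times the transform of the remaining coordinates. *)
Lemma integral_gauss_cos n s (u : 'rV[R]_n) k c : 0 < s -> 0 <= k <= 1 ->
  (\int[lebesgue_rV n]_x ((1 + k * cos (dot u x + c)) * gauss s x)%:E =
   (1 + k * cos c * expR (- (s ^+ 2 * dot u u) / 2))%:E)%E.
Proof.
move=> s0; elim: n u k c => [|n IH] u k c /andP[k0 k1].
  rewrite integral_lebesgue_rV0 /dot /gauss !big_ord0 add0r mulr1.
  by rewrite mulr0 oppr0 mul0r expR0 mulr1.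
have pos m (v x : 'rV[R]_m) k' c' : 0 <= k' <= 1 ->
    (0 <= ((1 + k' * cos (dot v x + c')) * gauss s x)%:E)%E.
  move=> /andP[k0' k1']; rewrite lee_fin mulr_ge0 ?gauss_ge0//.
  by have := cos_geN1 (dot v x + c'); nra.
rewrite integral_lebesgue_cons; last 2 first.
- apply/measurable_EFinP/measurable_funM; last exact: measurable_gauss.
  apply: measurable_funD => //; apply: measurable_funM => //.
  by apply: measurable_cosT; apply: measurable_funD => //; exact: measurable_dot.
- by move=> x; apply: pos; rewrite k0.
pose u' : 'rV[R]_n := \row_j u ord0 (lift ord0 j).
have dE t v : dot u (cons_rV (t, v)) = u ord0 ord0 * t + dot u' v.
  rewrite /dot big_ord_recl cons_rV0; congr (_ + _).
  by apply: eq_bigr => i _; rewrite cons_rVS mxE.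
have gE t v : gauss s (cons_rV (t, v)) = normal_pdf 0 s t * gauss s v.
  rewrite /gauss big_ord_recl cons_rV0; congr (_ * _).
  by apply: eq_bigr => i _; rewrite cons_rVS.
set e' := expR (- (s ^+ 2 * dot u' u') / 2).
under eq_integral => t _.
  under eq_integral => v _.
    rewrite dE gE (addrC (_ * t)) -addrA mulrCA EFinM; over.
  rewrite ge0_integralZl//; last 3 first.
  - apply/measurable_EFinP/measurable_funM; last exact: measurable_gauss.
    apply: measurable_funD => //; apply: measurable_funM => //.
    by apply: measurable_cosT; apply: measurable_funD => //; exact: measurable_dot.
  - by move=> v _; apply: pos; rewrite k0.
  - by rewrite lee_fin normal_pdf_ge0.
  rewrite IH ?k0//.
  rewrite -EFinM mulrC (_ : k * cos _ * _ = k * e' * cos (u ord0 ord0 * t + c)); last by rewrite /e'; ring.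
  over.
rewrite integral_normal_cos//; congr EFin; congr (1 + _).
have -> : dot u u = u ord0 ord0 ^+ 2 + dot u' u'.
  rewrite /dot big_ord_recl expr2; congr (_ + _).
  by apply: eq_bigr => i _; rewrite !mxE.
rewrite mulrDr opprD mulrDl expRD -/e'; ring.
Qed.

Lemma integral_gauss n s : 0 < s ->
  (\int[lebesgue_rV n]_x (gauss s x)%:E = 1)%E.
Proof.
move=> s0; have := @integral_gauss_cos n s 0 0 0 s0.
rewrite lexx ler01 => /(_ isT); rewrite !mul0r addr0 => <-.
by apply: eq_integral => x _; rewrite mul0r addr0 mul1r.
Qed.

Lemma integrable_gauss n s : 0 < s ->
  (lebesgue_rV n).-integrable setT (EFin \o @gauss n s).
Proof.
move=> s0; apply/integrableP; split.
  by apply/measurable_EFinP; exact: measurable_gauss.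
under eq_integral do rewrite /= ger0_norm ?gauss_ge0//.
by rewrite integral_gauss// ltry.
Qed.
End gauss.

(** * Approximation of [exp (- c r ^ gam)] by nonnegative combinations of exponentials *)

Section nneg_poly.
Context {R : realType}.
Implicit Types p q : {poly R}.

Definition nneg_poly p := forall i, 0 <= p`_i.

Lemma nneg_polyM p q : nneg_poly p -> nneg_poly q -> nneg_poly (p * q).
Proof. by move=> p0 q0 i; rewrite coefM sumr_ge0// => j _; rewrite mulr_ge0. Qed.

Lemma nneg_polyX p n : nneg_poly p -> nneg_poly (p ^+ n).
Proof.
move=> p0; elim: n => [|n IH]; last by rewrite exprS; exact: nneg_polyM.
by move=> i; rewrite expr0 coef1.
Qed.

Lemma nneg_polyZ a p : 0 <= a -> nneg_poly p -> nneg_poly (a *: p).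
Proof. by move=> a0 p0 i; rewrite coefZ mulr_ge0. Qed.

Lemma nneg_poly_sum n (p : 'I_n -> {poly R}) :
  (forall i, nneg_poly (p i)) -> nneg_poly (\sum_(i < n) p i).
Proof. by move=> p0 j; rewrite coef_sum sumr_ge0// => i _; exact: p0. Qed.
End nneg_poly.

Section binomial_series.
Context {R : realType} (gam : R).
Hypothesis gam01 : 0 < gam < 1.

(** [binom_coeff k] is the coefficient of [z ^ (k + 1)] in [1 - (1 - z) `^ gam]. *)
Fixpoint binom_coeff (k : nat) : R :=
  if k is k'.+1 then binom_coeff k' * (k'.+1%:R - gam) / k'.+2%:R else gam.

Definition binom_psum (n : nat) : {poly R} :=
  \sum_(k < n) binom_coeff k *: 'X^(k.+1).

Lemma binom_coeff_ge0 k : 0 <= binom_coeff k.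
Proof.
have /andP[g0 g1] := gam01.
elim: k => [|k IH] /=; first exact: ltW.
rewrite divr_ge0// mulr_ge0// subr_ge0 (le_trans (ltW g1))//.
by rewrite ler1n.
Qed.

Lemma binom_coeffS k :
  k.+2%:R * binom_coeff k.+1 = binom_coeff k * (k.+1%:R - gam).
Proof. by rewrite mulrC divfK ?pnatr_eq0. Qed.

Lemma binom_coeff_le k : k.+1%:R * binom_coeff k <= 1.
Proof.
have /andP[g0 g1] := gam01.
elim: k => [|k IH]; first by rewrite mul1r ltW.
rewrite binom_coeffS; apply: le_trans IH; rewrite mulrC.
by rewrite ler_wpM2r ?binom_coeff_ge0// gerBl ltW.
Qed.

(** The full series [B = 1 - (1 - z) `^ gam] solves [(1 - z) B' = gam (1 - B)];
    truncation leaves one boundary term. *)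
Lemma binom_psum_ode n (z : R) :
  (1 - z) * (binom_psum n)^`().[z] =
  gam * (1 - (binom_psum n).[z]) - n.+1%:R * binom_coeff n * z ^+ n.
Proof.
elim: n => [|n IH].
  by rewrite /binom_psum big_ord0 deriv0 !horner0 /=; ring.
have -> : binom_psum n.+1 = binom_psum n + binom_coeff n *: 'X^(n.+1).
  by rewrite /binom_psum big_ord_recr.
rewrite binom_coeffS derivD derivZ derivXn !hornerD !hornerZ hornerMn !hornerXn.
rewrite mulrDr IH exprS -[z ^+ n *+ _]mulr_natl.
move: (n.+1%:R) (binom_coeff n) (z ^+ n) => a b c; ring.
Qed.

(** By [binom_psum_ode] the derivative of [(1 - S_n) (1 - z) `^ (- gam)], with
    [S_n] the partial sum, is nonnegative and reduces to the boundary term, so the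
    mean value theorem bounds the remainder on both sides. *)
Lemma binom_psum_remainder n (z : R) : 0 <= z -> z < 1 ->
  0 <= 1 - (binom_psum n).[z] - (1 - z) `^ gam <= z ^+ n / (1 - z) ^+ 2.
Proof.
move=> z0 z1; have /andP[g0 g1] := gam01.
pose E (x : R) : R := (1 - (binom_psum n).[x]) * (1 - x) `^ (- gam).
pose dE (x : R) : R := n.+1%:R * binom_coeff n * x ^+ n * (1 - x) `^ (- gam - 1).
have dEP (x : R) : x < 1 -> is_derive x (1:R) E (dE x).
  move=> x1; have x1' : 0 < 1 - x by rewrite subr_gt0.
  have h0 : is_derive x (1:R) (cst 1 - id) (- 1).
    by apply: (is_derive_eq (is_deriveB _ _)); rewrite sub0r.
  have h1 := @is_derive1_comp _ (fun a => a `^ (- gam)) (cst 1 - id) _ _ _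
    (is_derive1_powR (- gam) x1') h0.
  have h2 := is_deriveB (is_derive_cst (1:R) x (1:R)) (is_derive_poly (binom_psum n) x).
  apply: (is_derive_eq (is_deriveM h2 h1)).
  rewrite -[LHS]/((1 - (binom_psum n).[x]) * _ + (1 - x) `^ (- gam) * _).
  have -> : (1 - x) `^ (- gam) = (1 - x) * (1 - x) `^ (- gam - 1).
    rewrite -[- gam in LHS](subrK 1) powRD; last by rewrite (gt_eqF x1')/= implybT.
    by rewrite powRr1 ?(ltW x1')// mulrC.
  rewrite /dE; have := binom_psum_ode n x.
  move: (binom_psum n)^`().[x] (binom_psum n).[x] (_ `^ _) (n.+1%:R * _ * _).
  move=> a b c e H.
  have -> : e = gam * (1 - b) - (1 - x) * a by rewrite H; ring.
  by ring.
move: z0; rewrite le_eqVlt => /predU1P[<-|z0].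
  rewrite (_ : (binom_psum n).[0] = 0); last first.
    rewrite /binom_psum horner_sum big1// => i _.
    by rewrite !hornerE expr0n/= mulr0.
  by rewrite !subr0 powR1 subrr lexx /= expr1n divr1 exprn_ge0.
have z1' : 0 < 1 - z by rewrite subr_gt0.
have dE' x : x \in `]0, z[ -> is_derive x (1:R) E (dE x).
  by rewrite in_itv/= => /andP[_ xz]; apply: dEP; exact: lt_trans z1.
have cE : {within `[0, z], continuous E}.
  apply: derivable_within_continuous => x; rewrite in_itv/= => /andP[_ xz].
  by have [] := dEP x (le_lt_trans xz z1).
have [c] := MVT z0 dE' cE.
rewrite in_itv/= => /andP[c0 cz].
have -> : E 0 = 1.
  rewrite /E (_ : (binom_psum n).[0] = 0); last first.
    rewrite /binom_psum horner_sum big1// => i _.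
    by rewrite !hornerE expr0n/= mulr0.
  by rewrite !subr0 powR1 mulr1.
rewrite subr0 => H.
have P0 : 0 < (1 - z) `^ gam by exact: powR_gt0.
have P1 : (1 - z) `^ gam <= 1 `^ gam.
  by rewrite ge0_ler_powR ?nnegrE ?(ltW g0) ?(ltW z1')// gerBl ltW.
rewrite powR1 in P1.
have EP : 1 - (binom_psum n).[z] - (1 - z) `^ gam = (1 - z) `^ gam * (E z - 1).
  by rewrite /E powRN mulrBr mulr1 mulrCA divff ?mulr1// gt_eqF.
rewrite EP H.
have c1 : c < 1 by exact: lt_trans cz z1.
have c1' : 0 < 1 - c by rewrite subr_gt0.
have dE0 : 0 <= dE c.
  by rewrite !mulr_ge0 ?powR_ge0 ?exprn_ge0 ?binom_coeff_ge0// ltW.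
apply/andP; split; first exact: (mulr_ge0 (ltW P0) (mulr_ge0 dE0 (ltW z0))).
apply: (@le_trans _ _ (dE c)).
  by rewrite mulrCA ler_piMr// mulr_ile1// ltW.
rewrite /dE ler_pM ?powR_ge0 ?mulr_ge0 ?binom_coeff_ge0 ?exprn_ge0 ?(ltW c0)//.
  rewrite -[leRHS]mul1r ler_pM ?mulr_ge0 ?binom_coeff_ge0 ?exprn_ge0 ?(ltW c0)//.
    exact: binom_coeff_le.
  by rewrite lerXn2r ?nnegrE ?(ltW c0) ?(ltW z0) ?(ltW cz).
rewrite -opprD powRN lef_pV2 ?posrE ?exprn_gt0 ?powR_gt0//.
apply: (@le_trans _ _ ((1 - c) ^+ 2)).
  by rewrite lerXn2r ?nnegrE ?(ltW z1') ?(ltW c1')// lerB// ltW.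
rewrite -powR_mulrn ?(ltW c1')//.
apply: ger_powR; first by rewrite c1' gerBl ltW.
lra.
Qed.

Lemma binom_psum_ge0 n (z : R) : 0 <= z -> 0 <= (binom_psum n).[z].
Proof.
move=> z0; rewrite /binom_psum horner_sum sumr_ge0// => i _.
by rewrite !hornerE mulr_ge0 ?binom_coeff_ge0 ?exprn_ge0.
Qed.

Lemma binom_psum_nneg n : nneg_poly (binom_psum n).
Proof.
apply: nneg_poly_sum => i; apply: nneg_polyZ; first exact: binom_coeff_ge0.
by move=> j; rewrite coefXn.
Qed.

Lemma cvg_binom_psum (z : R) : 0 <= z -> z < 1 ->
  1 - (binom_psum n).[z] @[n --> \oo] --> (1 - z) `^ gam.
Proof.
move=> z0 z1; apply/subr_cvg0.
apply: (@squeeze_cvgr _ _ _ _ (cst 0) (fun n => geometric ((1 - z) ^- 2) z n)).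
- apply: nearW => n; have /andP[-> h2] := binom_psum_remainder n z0 z1.
  by rewrite /= mulrC.
- exact: cvg_cst.
- by apply: cvg_geometric; rewrite ger0_norm.
Qed.
End binomial_series.

Section stable_exponential.
Context {R : realType}.

Lemma cvg_powR_ge0 (gam l : R) (u : nat -> R) : 0 < gam -> 0 <= l ->
  (forall n, 0 <= u n) -> u n @[n --> \oo] --> l ->
  u n `^ gam @[n --> \oo] --> l `^ gam.
Proof.
move=> g0; rewrite le_eqVlt => /predU1P[<-|l0] u0 ul; last first.
  have [d _] := is_derive1_powR gam l0.
  have c : {for l, continuous (fun x : R => x `^ gam)}.
    by apply: differentiable_continuous; exact/derivable1_diffP.
  exact: (cvg_comp _ _ ul c).
rewrite powR0 ?gt_eqF//; apply/cvgrPdist_lt => e e0.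
have e0' : 0 < e `^ gam^-1 by exact: powR_gt0.
move/cvgrPdist_lt : ul => /(_ _ e0'); apply: filterS => n.
rewrite !sub0r !normrN ger0_norm// ger0_norm ?powR_ge0// => une.
have -> : e = (e `^ gam^-1) `^ gam.
  by rewrite -powRrM mulVf ?gt_eqF// powRr1// ltW.
by rewrite gt0_ltr_powR ?nnegrE ?powR_ge0.
Qed.

(** Put [z = exp (- eta (r + eta))], so that powers of [z] are multiples of
    exponentials [exp (- j eta r)]. Three successive limits lead from polynomials
    in [z] to the target: the exponential series of [exp (c S_n(z))], the binomial
    series [S_n(z) --> 1 - (1 - z) `^ gam], and [(1 - z) / eta --> r] as [eta]
    tends to [0]. The shift by [eta] keeps [z < 1] at [r = 0]. *)
Lemma stable_exponential_approx (K : (R -> R) -> Prop) (gam kap : R) :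
  0 < gam < 1 -> 0 < kap ->
  (forall (q : {poly R}) (eta : R), 0 < eta -> nneg_poly q ->
     (forall r : R, 0 <= r -> 0 <= q.[expR (- (eta * (r + eta)))] <= 1) ->
     K (fun r => q.[expR (- (eta * (r + eta)))])) ->
  (forall (f : R -> R) (g : nat -> R -> R), (forall n, K (g n)) ->
     (forall n (r : R), 0 <= r -> 0 <= g n r <= 1) ->
     (forall r : R, 0 <= r -> g n r @[n --> \oo] --> f r) -> K f) ->
  K (fun r => expR (- (kap * r `^ gam))).
Proof.
move=> gam01 kap0 Kpoly Klim; have /andP[g0 g1] := gam01.
pose z (eta r : R) : R := expR (- (eta * (r + eta))).
have z0 eta r : 0 <= z eta r by exact: expR_ge0.
have z1 eta r : 0 < eta -> 0 <= r -> z eta r < 1.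
  by move=> e0 r0; rewrite expR_lt1 oppr_lt0 mulr_gt0// ltr_wpDl.
pose S := binom_psum gam.
have S1 n x : 0 <= x -> x < 1 -> 0 <= 1 - (S n).[x].
  move=> x0 x1; have /andP[h _] := binom_psum_remainder gam01 n x0 x1.
  by move: h; rewrite subr_ge0; apply: le_trans; exact: powR_ge0.
(* the first limit: coefficients are nonnegative because those of [S n] are *)
have K1 (c eta : R) n : 0 < c -> 0 < eta ->
    K (fun r => expR (- (c * (1 - (S n).[z eta r])))).
  move=> c0 e0.
  pose q m := expR (- c) *: (\sum_(j < m) (j`!%:R)^-1 *: (c *: S n) ^+ j).
  have qE m r : (q m).[z eta r] =
      expR (- c) * series (exp_coeff (c * (S n).[z eta r])) m.
    rewrite /q hornerZ horner_sum seriesEord; congr (_ * _).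
    by apply: eq_bigr => i _; rewrite hornerZ horner_exp hornerZ /exp_coeff mulrC.
  have q0 m : nneg_poly (q m).
    apply: nneg_polyZ; first exact: expR_ge0.
    apply: nneg_poly_sum => i; apply: nneg_polyZ; first by rewrite invr_ge0.
    by apply/nneg_polyX/nneg_polyZ; [exact: ltW|exact: binom_psum_nneg].
  have cS0 r : 0 <= c * (S n).[z eta r].
    by rewrite mulr_ge0 ?(ltW c0)// binom_psum_ge0.
  have lim r : (q m).[z eta r] @[m --> \oo] -->
      expR (- (c * (1 - (S n).[z eta r]))).
    under eq_cvg do rewrite qE.
    rewrite mulrBr mulr1 opprB addrC expRD; apply: cvgMl_tmp.
    exact: is_cvg_series_exp_coeff.
  have qnd r : {homo (fun m => (q m).[z eta r]) : m1 m2 / (m1 <= m2)%N >-> m1 <= m2}.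
    apply/nondecreasing_seqP => m; rewrite !qE ler_wpM2l ?expR_ge0//.
    by rewrite seriesSr lerDl exp_coeff_ge0.
  have q01 m r : 0 <= r -> 0 <= (q m).[z eta r] <= 1.
    move=> r0; apply/andP; split.
      rewrite qE mulr_ge0 ?expR_ge0// /series/= sumr_ge0// => i _.
      exact: exp_coeff_ge0.
    apply: (@le_trans _ _ (expR (- (c * (1 - (S n).[z eta r]))))).
      rewrite -(cvg_lim _ (lim r))//.
      by apply: nondecreasing_cvgn_le => //; apply: cvgP (lim r).
    rewrite expR_le1 oppr_le0 mulr_ge0 ?(ltW c0)//.
    by apply: S1 => //; exact: z1.
  apply: (Klim _ (fun m r => (q m).[z eta r])) => // m.
  by apply: Kpoly => //; exact: q01.
have K2 (c eta : R) : 0 < c -> 0 < eta ->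
    K (fun r => expR (- (c * (1 - z eta r) `^ gam))).
  move=> c0 e0.
  apply: (Klim _ (fun n r => expR (- (c * (1 - (S n).[z eta r]))))) => [n|n r r0|r r0].
  - exact: K1.
  - rewrite expR_ge0/= expR_le1 oppr_le0 mulr_ge0 ?(ltW c0)//.
    by apply: S1 => //; exact: z1.
  - apply: (cvg_comp _ expR); last exact: continuous_expR.
    apply: cvgN; apply: cvgMl_tmp; apply: cvg_binom_psum => //; exact: z1.
pose eta n : R := n.+1%:R^-1.
have eta0 n : 0 < eta n by rewrite invr_gt0.
apply: (Klim _ (fun n r => expR (- (kap / eta n `^ gam * (1 - z (eta n) r) `^ gam))))
   => [n|n r r0|r r0].
- by apply: K2; rewrite // divr_gt0// powR_gt0.
- rewrite expR_ge0/= expR_le1 oppr_le0 mulr_ge0 ?powR_ge0//.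
  by rewrite divr_ge0 ?powR_ge0// ltW.
- apply: (cvg_comp _ expR); last exact: continuous_expR.
  apply: cvgN.
  (* [kap] was divided by [eta `^ gam] to turn [1 - z] into [(1 - z) / eta] *)
have zE n : kap / eta n `^ gam * (1 - z (eta n) r) `^ gam =
      kap * ((1 - z (eta n) r) / eta n) `^ gam.
    rewrite powRM ?subr_ge0 ?invr_ge0 ?(ltW (eta0 n)) ?(ltW (z1 _ _ (eta0 n) r0))//.
    by rewrite -[(eta n)^-1]powR_inv1 ?(ltW (eta0 n))// powRAC powR_inv1 ?powR_ge0//; ring.
  under eq_cvg do rewrite zE.
  apply: cvgMl_tmp; apply: cvg_powR_ge0 => // [n|].
    by rewrite divr_ge0 ?(ltW (eta0 n))// subr_ge0 ltW// z1.
  have etac : eta n @[n --> \oo] --> (0:R) by exact: cvg_harmonic.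
  have up : r + eta n @[n --> \oo] --> r.
    by rewrite -[X in _ --> X]addr0; apply: cvgD => //; exact: cvg_cst.
  have lo : (r + eta n) * (1 - eta n * (r + eta n)) @[n --> \oo] --> r.
    rewrite -[X in _ --> X]mulr1; apply: cvgM => //.
    rewrite -[X in _ --> X]subr0; apply: cvgB; first exact: cvg_cst.
    by rewrite -[X in _ --> X](mul0r r); exact: cvgM.
  apply: (@squeeze_cvgr _ _ _ _ _ _ _ _ _ lo up).
  apply: nearW => n; rewrite /z.
  move: (eta n) (eta0 n) => e e0.
  have x0 : 0 <= e * (r + e) by rewrite mulr_ge0 ?(ltW e0)// addr_ge0 ?(ltW e0).
  have h1 := expR_ge1Dx (- (e * (r + e))).
  have h2 := expR_ge1Dx (e * (r + e)).
  have h3 : expR (- (e * (r + e))) * expR (e * (r + e)) = 1.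
    by rewrite -expRD addNr expR0.
  have h4 := expR_gt0 (- (e * (r + e))).
  rewrite (ler_pdivlMr _ _ e0) (ler_pdivrMr _ _ e0).
  rewrite (_ : _ * e = e * (r + e) * (1 - e * (r + e))); last by ring.
  rewrite (mulrC _ e).
  set x := e * (r + e) in h1 h2 h3 h4 x0 *.
  set a := expR (- x) in h1 h3 h4 *; set b := expR x in h2 h3.
  apply/andP; split; last by lra.
  have h5 : a * (1 + x) <= a * b by rewrite ler_wpM2l// ltW.
  by rewrite h3 in h5; nra.
Qed.
End stable_exponential.

(** * Parseval's identity against a Gaussian *)

Section density_integral.
Context {d} {T : measurableType d} {R : realType}.
Variables (mu : {measure set T -> \bar R}) (g : T -> R).
Hypotheses (g0 : forall x, 0 <= g x) (mg : measurable_fun setT g).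
Hypothesis g1 : (\int[mu]_x (g x)%:E = 1)%E.

Lemma integrable_density : mu.-integrable setT (EFin \o g).
Proof.
apply/integrableP; split; first exact/measurable_EFinP.
by under eq_integral do rewrite /= ger0_norm//; rewrite g1 ltry.
Qed.

Lemma integrable_bounded_density (h : T -> R) (M : R) :
  measurable_fun setT h -> (forall x, `|h x| <= M) ->
  mu.-integrable setT (EFin \o (fun x => h x * g x)).
Proof.
move=> mh hM; apply: (dominated_integrable _ (integrable_EFinZl M integrable_density)).
  exact: measurable_funM.
by move=> x; rewrite normrM [X in _ * X]ger0_norm// ler_wpM2r.
Qed.

Lemma integral_1D_density (h : T -> R) :
  measurable_fun setT h -> (forall x, `|h x| <= 1) ->
  (\int[mu]_x ((1 + h x) * g x)%:E = (1 + \int[mu]_x (h x * g x)%R)%:E)%E.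
Proof.
move=> mh h1; have ih := integrable_bounded_density mh h1.
have ig := integrable_density.
have E x : (1 + h x) * g x = g x + h x * g x by rewrite mulrDl mul1r.
have i2 : mu.-integrable setT (EFin \o (fun x => (1 + h x) * g x)).
  by rewrite (funext E); exact: (integrableD measurableT ig ih).
rewrite -[LHS]fineK; last exact: (integrable_fin_num _ i2).
congr EFin; rewrite -[LHS]/(Rintegral _ _ _).
under eq_Rintegral do rewrite E.
by rewrite (RintegralD measurableT ig ih) {1}/Rintegral g1.
Qed.
End density_integral.

Section smoothing.
Context {R : realType} {n : nat}.
Variables (p phi : 'rV[R]_n -> R).
Hypotheses (p0 : forall x, 0 <= p x) (mp : measurable_fun setT p).
Hypothesis p1 : (\int[lebesgue_rV n]_x (p x)%:E = 1)%E.
Hypothesis p_re : forall u, \int[lebesgue_rV n]_x (cos (dot u x) * p x) = phi u.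
Hypothesis p_im : forall u, \int[lebesgue_rV n]_x (sin (dot u x) * p x) = 0.
Hypothesis mphi : measurable_fun setT phi.
Local Notation leb := (lebesgue_rV n).

Let mdot (u : 'rV[R]_n) : measurable_fun setT (fun x : 'rV[R]_n => dot u x).
Proof. exact: measurable_dot. Qed.

Lemma charfun_le1 u : `|phi u| <= 1.
Proof.
rewrite -p_re; have mc := measurable_cosT (mdot u).
have ic := integrable_bounded_density p0 mp p1 mc (fun x => cos_le_norm1 (dot u x)).
apply: le_trans (le_normr_Rintegral measurableT ic) _.
have -> : 1 = \int[leb]_x p x by rewrite /Rintegral p1.
apply: le_Rintegral => //; last first.
- by move=> x _; rewrite normrM [X in _ * X]ger0_norm// ler_piMl// cos_le_norm1.
- exact: integrable_density.
- exact: integrable_norm.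
Qed.

Lemma integral_density_cos u c :
  (\int[leb]_x ((1 + cos (dot u x + c)) * p x)%:E = (1 + cos c * phi u)%:E)%E.
Proof.
rewrite (integral_1D_density p0 mp p1); last 2 first.
- by apply: measurable_cosT; exact: measurable_funD.
- by move=> x; exact: cos_le_norm1.
congr (_%:E); congr (1 + _).
have E x : cos (dot u x + c) * p x = cos c * (cos (dot u x) * p x) -
    sin c * (sin (dot u x) * p x) by rewrite cosD; ring.
under eq_Rintegral do rewrite E.
have ic := integrable_bounded_density p0 mp p1 (measurable_cosT (mdot u))
  (fun x => cos_le_norm1 (dot u x)).
have is_ := integrable_bounded_density p0 mp p1 (measurable_sinT (mdot u))
  (fun x => sin_le_norm1 (dot u x)).
rewrite (RintegralB measurableT (integrable_EFinZl _ ic) (integrable_EFinZl _ is_)).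
rewrite (RintegralZl _ measurableT ic) (RintegralZl _ measurableT is_).
by rewrite p_re p_im mulr0 subr0.
Qed.

(** After adding [1], the two sides are the two iterated integrals of the
    nonnegative function [(1 + cos (u . (x - y))) p(x) gauss(u)]. *)
Lemma gauss_smoothing (s : R) (y : 'rV[R]_n) : 0 < s ->
  \int[leb]_x (expR (- (s ^+ 2 * dot (x - y) (x - y)) / 2) * p x) =
  \int[leb]_u (cos (dot u y) * phi u * gauss s u).
Proof.
move=> s0.
have mB : measurable_fun setT (fun x : 'rV[R]_n => x - y) by exact: measurable_fun_rVB.
have me : measurable_fun setT
    (fun x : 'rV[R]_n => expR (- (s ^+ 2 * dot (x - y) (x - y)) / 2)).
  apply: measurableT_comp => //; apply: measurable_funM => //.
  by apply: measurableT_comp => //; apply: measurable_funM => //; exact: measurable_dot.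
have e1 (x : 'rV[R]_n) : `|expR (- (s ^+ 2 * dot (x - y) (x - y)) / 2)| <= 1.
  rewrite ger0_norm ?expR_ge0// expR_le1 mulNr oppr_le0 divr_ge0//.
  by rewrite mulr_ge0 ?sqr_ge0// dotxx_ge0.
have mcp : measurable_fun setT (fun u : 'rV[R]_n => cos (dot u y) * phi u).
  by apply: measurable_funM => //; apply: measurable_cosT; exact: measurable_dot.
have cp1 (u : 'rV[R]_n) : `|cos (dot u y) * phi u| <= 1.
  by rewrite normrM mulr_ile1// ?cos_le_norm1// charfun_le1.
suff : (1 + \int[leb]_x (expR (- (s ^+ 2 * dot (x - y) (x - y)) / 2) * p x))%:E =
  (1 + \int[leb]_u (cos (dot u y) * phi u * gauss s u))%:E.
  by move=> [] /addrI.
rewrite -(integral_1D_density p0 mp p1 me e1).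
rewrite -(integral_1D_density (gauss_ge0 s) (measurable_gauss s) (integral_gauss n s0) mcp cp1).
pose f (z : 'rV[R]_n * 'rV[R]_n) : \bar R :=
  ((1 + cos (dot (z.1 - y) z.2)) * gauss s z.2 * p z.1)%:E.
have f0 (z : 'rV[R]_n * 'rV[R]_n) : (0 <= f z)%E.
  rewrite lee_fin mulr_ge0// mulr_ge0 ?gauss_ge0//.
have mf : measurable_fun setT f.
  apply/measurable_EFinP; apply: measurable_funM; last exact: measurableT_comp mp measurable_fst.
  apply: measurable_funM; last exact: measurableT_comp (measurable_gauss s) measurable_snd.
  apply: measurable_funD => //; apply: measurable_cosT; apply: measurable_dot => //.
  exact: measurableT_comp mB measurable_fst.
transitivity (\int[leb]_x \int[leb]_u f (x, u))%E.
  apply: eq_integral => x _; rewrite /f /=.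
  under eq_integral do rewrite EFinM.
  rewrite ge0_integralZr//; last 3 first.
  - apply/measurable_EFinP/measurable_funM; last exact: measurable_gauss.
    by apply: measurable_funD => //; apply: measurable_cosT.
  - by move=> u _; rewrite lee_fin mulr_ge0 ?gauss_ge0.
  - by rewrite lee_fin.
  rewrite EFinM; congr (_ * _)%E.
  have := @integral_gauss_cos R n s (x - y) 1 0 s0.
  rewrite ler01 lexx cos0 !mul1r => /(_ isT) <-.
  by apply: eq_integral => u _; rewrite mul1r addr0.
rewrite (fubini_tonelli f mf f0); apply: eq_integral => u _; rewrite /f /=.
under eq_integral => x _.
  rewrite mulrAC mulrC EFinM dotBl (dotC x) (dotC y); over.
rewrite ge0_integralZl//; last 3 first.
- apply/measurable_EFinP/measurable_funM => //.
  by apply: measurable_funD => //; apply: measurable_cosT; exact: measurable_funD.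
- by move=> x _; rewrite lee_fin mulr_ge0.
- by rewrite lee_fin gauss_ge0.
by rewrite integral_density_cos cosN -EFinM mulrC.
Qed.
End smoothing.

(** * Unimodality of the stable density *)

Section unimodal.
Context {R : realType} {n : nat}.
Local Notation leb := (lebesgue_rV n).
Implicit Types (f : R -> R) (y : 'rV[R]_n).

Let mdotxx : measurable_fun setT (fun u : 'rV[R]_n => dot u u).
Proof. exact: measurable_dot. Qed.

(** Inverse variances add up: [1 / s' ^ 2 = 1 / s ^ 2 + 2 lam]. *)
Lemma gauss_narrow (s lam : R) : 0 < s -> 0 <= lam ->
  exists2 C, 0 <= C & exists2 s', 0 < s' & forall u : 'rV[R]_n,
    expR (- (lam * dot u u)) * gauss s u = C * gauss s' u.
Proof.
move=> s0 lam0; have sn0 : s != 0 by rewrite gt_eqF.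
pose v := s ^+ 2 / (1 + 2 * lam * s ^+ 2).
have D0 : 0 < 1 + 2 * lam * s ^+ 2 by have := mulr_ge0 lam0 (sqr_ge0 s); lra.
have v0 : 0 < v by rewrite divr_gt0// exprn_gt0.
pose s' := Num.sqrt v; have s'0 : 0 < s' by rewrite sqrtr_gt0.
have s'n0 : s' != 0 by rewrite gt_eqF.
have s'2 : s' ^+ 2 = v by rewrite sqr_sqrtr// ltW.
exists (normal_peak s ^+ n / normal_peak s' ^+ n).
  by rewrite divr_ge0// exprn_ge0// normal_peak_ge0.
exists s' => // u; rewrite !gaussE// mulrCA [RHS]mulrA divfK; last first.
  by rewrite expf_neq0// gt_eqF// normal_peak_gt0.
congr (_ * _); rewrite -expRD s'2; congr expR; rewrite /v; field.
by rewrite sn0/= gt_eqF.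
Qed.

Lemma measurable_cos_dot y : measurable_fun setT (fun u : 'rV[R]_n => cos (dot u y)).
Proof. by apply: measurable_cosT; exact: measurable_dot. Qed.

Lemma gauss_charfun (s : R) y : 0 < s ->
  \int[leb]_u (cos (dot u y) * gauss s u) = expR (- (s ^+ 2 * dot y y) / 2).
Proof.
move=> s0; have := @integral_gauss_cos R n s y 1 0 s0.
rewrite lexx ler01 => /(_ isT); rewrite cos0 !mul1r => H.
have := integral_1D_density (gauss_ge0 s) (measurable_gauss s)
  (integral_gauss n s0) (measurable_cos_dot y) (fun u => cos_le_norm1 _).
under eq_integral => u _ do rewrite -(addr0 (dot u y)) dotC -[cos _]mul1r.
by rewrite H => -[] /addrI.
Qed.

Section fixed_points.
Variables (s : R) (y y' : 'rV[R]_n).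
Hypotheses (s0 : 0 < s) (yy' : dot y y <= dot y' y').

Let I f z := \int[leb]_u (cos (dot u z) * f (dot u u) * gauss s u).

Let K f := measurable_fun setT (fun u : 'rV[R]_n => f (dot u u)) /\ I f y' <= I f y.

Let int_I f z (M : R) : measurable_fun setT (fun u : 'rV[R]_n => f (dot u u)) ->
  (forall r, 0 <= r -> `|f r| <= M) ->
  leb.-integrable setT (EFin \o (fun u => cos (dot u z) * f (dot u u) * gauss s u)).
Proof.
move=> mf fM; apply: (integrable_bounded_density (M := M) (gauss_ge0 s)
    (measurable_gauss s) (integral_gauss n s0)).
  by apply: measurable_funM => //; exact: measurable_cos_dot.
move=> u; rewrite normrM -[leRHS]mul1r ler_pM ?cos_le_norm1// fM//.
exact: dotxx_ge0.
Qed.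

Let K_exp (lam : R) : 0 <= lam -> K (fun r => expR (- (lam * r))).
Proof.
move=> lam0; split.
  by apply: measurableT_comp => //; apply: measurableT_comp => //; exact: measurable_funM.
have [C C0 [s' s'0 CE]] := gauss_narrow s0 lam0.
have E z : I (fun r => expR (- (lam * r))) z = C * expR (- (s' ^+ 2 * dot z z) / 2).
  rewrite -gauss_charfun// -RintegralZl//; last first.
    by apply: (integrable_bounded_density (gauss_ge0 s') (measurable_gauss s')
      (integral_gauss n s'0) (measurable_cos_dot z) (fun u => cos_le_norm1 _)).
  by apply: eq_Rintegral => u _; rewrite -mulrA CE mulrCA.
rewrite !E ler_wpM2l// ler_expR !mulNr lerN2 ler_wpM2r//.
by rewrite ler_wpM2l// sqr_ge0.
Qed.

Let K_sum (m : nat) (c : nat -> R) (f : nat -> R -> R) :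
  (forall i, 0 <= c i) -> (forall i, K (f i)) ->
  (forall i r, 0 <= r -> 0 <= f i r <= 1) ->
  K (fun r => \sum_(i < m) c i * f i r).
Proof.
move=> c0 Kf f01.
have mf k : measurable_fun setT (fun u : 'rV[R]_n => \sum_(i < k) c i * f i (dot u u)).
  by apply: measurable_sum => i; apply: measurable_funM => //; have [] := Kf i.
have f1 i r : 0 <= r -> `|f i r| <= 1.
  by move=> /(f01 i) /andP[h1 h2]; rewrite ger0_norm.
have bf k r : 0 <= r -> `|\sum_(i < k) c i * f i r| <= \sum_(i < k) c i.
  move=> r0; apply: le_trans (ler_norm_sum _ _ _) _; apply: ler_sum => i _.
  by rewrite normrM ger0_norm// ler_piMr// f1.
split; first exact: mf.
elim: m => [|m IH].
  rewrite le_eqVlt; apply/orP; left; apply/eqP.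
  by apply: eq_Rintegral => u _; rewrite !big_ord0 !mulr0 !mul0r.
have E z : I (fun r => \sum_(i < m.+1) c i * f i r) z =
    I (fun r => \sum_(i < m) c i * f i r) z + c m * I (f m) z.
  have i1 := int_I z (proj1 (Kf m)) (f1 m).
  rewrite /I -(RintegralZl _ measurableT i1).
  rewrite -(RintegralD measurableT (int_I z (mf m) (bf m)) (integrable_EFinZl _ i1)).
  by apply: eq_Rintegral => u _; rewrite big_ord_recr/=; ring.
by rewrite !E lerD// ler_wpM2l//; have [] := Kf m.
Qed.

Let K_lim f (g : nat -> R -> R) : (forall m, K (g m)) ->
  (forall m (r : R), 0 <= r -> 0 <= g m r <= 1) ->
  (forall r : R, 0 <= r -> g m r @[m --> \oo] --> f r) -> K f.
Proof.
move=> Kg g01 gf.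
have mg m : measurable_fun setT (fun u : 'rV[R]_n => g m (dot u u)) by have [] := Kg m.
have mf : measurable_fun setT (fun u : 'rV[R]_n => f (dot u u)).
  apply: (measurable_fun_cvg (fun m => mg m)) => u _; apply: gf; exact: dotxx_ge0.
have g1 m r : 0 <= r -> `|g m r| <= 1.
  by move=> /(g01 m) /andP[h1 h2]; rewrite ger0_norm.
have lim z : I (g m) z @[m --> \oo] --> I f z.
  have f1 r : 0 <= r -> `|f r| <= 1.
    move=> r0; rewrite ger0_norm.
      by apply: (cvgr_to_le (gf r r0)); apply: nearW => m; have /andP[] := g01 m r r0.
    by apply: (cvgr_to_ge (gf r r0)); apply: nearW => m; have /andP[] := g01 m r r0.
  apply: fine_cvg; rewrite fineK; last first.
    exact: (integrable_fin_num _ (int_I z mf f1)).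
  apply: (@dominated_cvg _ _ _ leb _ _ (fun m u =>
     (cos (dot u z) * g m (dot u u) * gauss s u)%:E) _ (EFin \o gauss s)) => //.
  - move=> m; exact: (measurable_int _ (int_I z (mg m) (g1 m))).
  - move=> u _; apply: cvg_EFin; first exact: nearW.
    apply: cvgMr_tmp; apply: cvgMl_tmp; apply: gf; exact: dotxx_ge0.
  - exact: integrable_gauss.
  - move=> m u _; rewrite lee_fin normrM [X in _ * X]ger0_norm ?gauss_ge0//.
    rewrite ler_piMl ?gauss_ge0// normrM mulr_ile1 ?cos_le_norm1// g1//.
    exact: dotxx_ge0.
split => //; apply: ler_cvg_to (lim y') (lim y) _; apply: nearW => m.
by have [] := Kg m.
Qed.

(** The class [K] of the profiles [f] whose Gaussian-weighted transform [I f] does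
    not increase from [y] to [y'] contains the exponentials, whose transform is
    Gaussian, and is stable under nonnegative combinations and bounded pointwise
    limits; these are the hypotheses of [stable_exponential_approx]. *)
Lemma stable_smoothing_unimodal (gam kap : R) : 0 < gam < 1 -> 0 < kap ->
  \int[leb]_u (cos (dot u y') * expR (- (kap * dot u u `^ gam)) * gauss s u) <=
  \int[leb]_u (cos (dot u y) * expR (- (kap * dot u u `^ gam)) * gauss s u).
Proof.
move=> gam01 kap0; suff [] : K (fun r => expR (- (kap * r `^ gam))) by [].
apply: (stable_exponential_approx gam01 kap0) => [q eta eta0 q0 _|]; last first.
  exact: K_lim.
pose c i := q`_i * expR (- (eta * (i%:R * eta))).
have -> : (fun r => q.[expR (- (eta * (r + eta)))]) =
    (fun r => \sum_(i < size q) c i * expR (- (i%:R * eta * r))).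
  apply/funext => r; rewrite horner_coef; apply: eq_bigr => i _.
  rewrite /c -mulrA -expRD -expRM_natl; congr (_ * expR _); ring.
apply: (@K_sum _ c (fun i r => expR (- (i%:R * eta * r)))) => [i|i|i r r0].
- by rewrite mulr_ge0// expR_ge0.
- by apply: K_exp; rewrite mulr_ge0// ltW.
- by rewrite expR_ge0 expR_le1 oppr_le0 !mulr_ge0// ltW.
Qed.
End fixed_points.

End unimodal.
Lemma expR_ge_pow {R : realType} (x : R) k : 0 <= x -> x ^+ k / k`!%:R <= expR x.
Proof.
case: k => [x0|k x0]; first by rewrite expr0 fact0 divr1 -[leLHS]expR0 ler_expR.
by apply: le_trans (expR_ge1Dxn k x0); rewrite lerDr.
Qed.

Section pointwise_unimodal.
Context {R : realType} {n : nat}.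
Local Notation leb := (lebesgue_rV n).

Lemma dot_nbhs (f : 'rV[R]_n -> R) (y : 'rV[R]_n) (P : set R) :
  {for y, continuous f} -> nbhs (f y) P ->
  exists2 e : R, 0 < e & forall x, dot (x - y) (x - y) < e ^+ 2 -> P (f x).
Proof.
move=> cf /cf /nbhs_ballP[e /= e0 He]; exists e => // x xe.
apply: He; split => // i j; rewrite ord1 /ball /=.
have := sqr_coord_le_dot (x - y) j; rewrite !mxE => h.
rewrite distrC -(@ltr_pXn2r _ 2) ?nnegrE ?(ltW e0)//.
by rewrite real_normK ?num_real//; exact: le_lt_trans xe.
Qed.

Lemma integral_gauss_shift (s : R) (y : 'rV[R]_n) : 0 < s ->
  (\int[leb]_x (gauss s (x - y))%:E = 1)%E.
Proof.
move=> s0; rewrite (integral_lebesgue_rVD (- y) (f := fun x => (gauss s x)%:E)).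
- exact: integral_gauss.
- by apply/measurable_EFinP; exact: measurable_gauss.
- by move=> x; rewrite lee_fin gauss_ge0.
Qed.

Lemma measurable_gauss_shift (s : R) (y : 'rV[R]_n) :
  measurable_fun setT (fun x : 'rV[R]_n => gauss s (x - y)).
Proof.
by apply: (measurableT_comp (measurable_gauss s)); exact: measurable_fun_rVB.
Qed.

Lemma integrable_gauss_shift (s : R) (y : 'rV[R]_n) : 0 < s ->
  leb.-integrable setT (EFin \o (fun x : 'rV[R]_n => gauss s (x - y))).
Proof.
move=> s0; apply: integrable_density; last exact: integral_gauss_shift.
- by move=> x; exact: gauss_ge0.
- exact: measurable_gauss_shift.
Qed.

Lemma normal_peakV (s : R) : 0 < s -> normal_peak s^-1 <= s.
Proof.
move=> s0; rewrite /normal_peak -[leRHS]invrK lef_pV2 ?posrE ?invr_gt0//; last first.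
  by rewrite sqrtr_gt0 pmulrn_lgt0// mulr_gt0 ?pi_gt0// exprn_gt0 ?invr_gt0.
have si0 : 0 <= s^-1 by rewrite invr_ge0 ltW.
rewrite -[leLHS](ger0_norm si0) -sqrtr_sqr ler_wsqrtr// -mulr_natr -mulrA.
rewrite ler_peMr ?sqr_ge0//; have := @pi_ge2 R; lra.
Qed.

Lemma normal_peak_double (s : R) : 0 < s ->
  normal_peak s = 2 * normal_peak (2 * s).
Proof.
move=> s0; rewrite /normal_peak.
have -> : (2 * s) ^+ 2 * pi *+ 2 = 2 ^+ 2 * (s ^+ 2 * pi *+ 2).
  by ring.
by rewrite sqrtrM ?sqr_ge0// sqrtr_sqr ger0_norm// invfM mulrA divff ?mul1r.
Qed.

(** The exponents of the two densities differ by [3 |z| ^ 2 / (8 s ^ 2)], as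
    [1 / 2 - 1 / 8 = 3 / 8], and their peaks by the factor [2 ^ n]. *)
Lemma gauss_tail (s del : R) (z : 'rV[R]_n) : 0 < s -> del ^+ 2 <= dot z z ->
  gauss s z <= 2 ^+ n * expR (- (3 * del ^+ 2 / (8 * s ^+ 2))) * gauss (2 * s) z.
Proof.
move=> s0 dz; have s20 : 0 < 2 * s by rewrite mulr_gt0.
rewrite !gaussE ?gt_eqF// (normal_peak_double s0) exprMn.
rewrite [leRHS](_ : _ = 2 ^+ n * normal_peak (2 * s) ^+ n *
  (expR (- (3 * del ^+ 2 / (8 * s ^+ 2))) * expR (- dot z z / ((2 * s) ^+ 2 *+ 2)))); last by ring.
rewrite ler_wpM2l ?mulr_ge0 ?exprn_ge0 ?normal_peak_ge0// -expRD ler_expR.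
have -> : - (3 * del ^+ 2 / (8 * s ^+ 2)) + - dot z z / ((2 * s) ^+ 2 *+ 2) =
  - (3 * del ^+ 2 + dot z z) / (8 * s ^+ 2) by field; rewrite gt_eqF.
have -> : - dot z z / (s ^+ 2 *+ 2) = - (4 * dot z z) / (8 * s ^+ 2).
  by field; rewrite gt_eqF.
by rewrite ler_pM2r ?invr_gt0 ?mulr_gt0 ?exprn_gt0//; lra.
Qed.

(** Narrow Gaussian averages recover the values of a continuous density. The
    average at [y'] is at least [A (1 - eps)] and the one at [y] at most
    [A' + eps'], for levels [A' < A] strictly between [p y] and [p y'] if these
    were in the wrong order; [gauss_tail] makes both errors small. *)
Lemma smoothing_le_density (p : 'rV[R]_n -> R) (y y' : 'rV[R]_n) :
  (forall x, 0 <= p x) -> measurable_fun setT p ->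
  (\int[leb]_x (p x)%:E = 1)%E ->
  {for y, continuous p} -> {for y', continuous p} ->
  (forall s, 0 < s ->
    \int[leb]_x (expR (- (s ^+ 2 * dot (x - y') (x - y')) / 2) * p x) <=
    \int[leb]_x (expR (- (s ^+ 2 * dot (x - y) (x - y)) / 2) * p x)) ->
  p y' <= p y.
Proof.
move=> p0 mp p1 cy cy' H; rewrite leNgt; apply/negP => pyy'.
(* two levels in the gap between [p y] and [p y'] *)
pose A' := (2 * p y + p y') / 3; pose A := (p y + 2 * p y') / 3.
have py0 := p0 y.
have A'A : A' < A by rewrite /A' /A; lra.
have pA' : p y < A' by rewrite /A'; lra.
have Ap : A < p y' by rewrite /A; lra.
have A'0 : 0 < A' by exact: le_lt_trans pA'.
have A0 : 0 < A by exact: lt_trans A'A.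
have [e1 e10 E1] := dot_nbhs cy (lt_nbhsl pA').
have [e2 e20 E2] := dot_nbhs cy' (lt_nbhsr Ap).
pose del := Num.min e1 e2.
have del0 : 0 < del by rewrite lt_min e10.
(* [exp (- a s ^ 2)] is the tail factor at distance [del], for width [1 / s] *)
pose a := 3 * del ^+ 2 / 8.
have a0 : 0 < a by rewrite divr_gt0// mulr_gt0// exprn_gt0.
(* [K] bounds [s ^ (n + 1) exp (- a s ^ 2)], as [exp x >= x ^ (n + 1) / (n + 1)!] *)
pose K := n.+1`!%:R / a ^+ n.+1.
have K0 : 0 < K by rewrite divr_gt0 ?exprn_gt0// ltr0n fact_gt0.
(* so large that the total error [(A 2 ^ n + 1) K / s] is below the gap *)
pose s := 1 + (A * 2 ^+ n + 1) * K / (A - A').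
have AA0 : 0 < A - A' by rewrite subr_gt0.
have C0 : 0 < A * 2 ^+ n + 1 by rewrite addr_gt0// mulr_gt0// exprn_gt0.
have s1 : 1 <= s by rewrite lerDl; apply: ltW; rewrite divr_gt0// mulr_gt0.
have s0 : 0 < s by exact: lt_le_trans s1.
have t0 : 0 < s^-1 by rewrite invr_gt0.
have ea : s ^+ n * expR (- (a * s ^+ 2)) <= K / s.
  rewrite expRN -/(_ / _) ler_pdivrMr ?expR_gt0//.
  apply: (@le_trans _ _ (K / s * ((a * s ^+ 2) ^+ n.+1 / n.+1`!%:R))); last first.
    apply: ler_wpM2l; first by rewrite divr_ge0 ?(ltW K0) ?(ltW s0).
    by apply: expR_ge_pow; rewrite mulr_ge0 ?sqr_ge0// ltW.
  have -> : K / s * ((a * s ^+ 2) ^+ n.+1 / n.+1`!%:R) = s ^+ n * s ^+ n.+1.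
    have -> : (a * s ^+ 2) ^+ n.+1 = a ^+ n.+1 * (s * s ^+ n * s ^+ n.+1).
      by rewrite -exprS -exprD addnn -mul2n exprM [LHS]exprMn.
    have an0 : a ^+ n.+1 != 0 by rewrite expf_neq0// gt_eqF.
    have fn0 : n.+1`!%:R != 0 :> R by rewrite pnatr_eq0 -lt0n fact_gt0.
    rewrite /K; move: (a ^+ n.+1) (n.+1`!%:R) an0 fn0 => b c b0 c0.
    by field; rewrite b0 c0 gt_eqF.
  by rewrite ler_peMr ?exprn_ge0 ?(ltW s0)// exprn_ege1.
set t := s^-1 in t0 *.
have tn0 : t != 0 by rewrite gt_eqF.
pose G := @gauss R n t; pose G2 := @gauss R n (2 * t).
have t20 : 0 < 2 * t by rewrite mulr_gt0.
pose eps := 2 ^+ n * expR (- (a * s ^+ 2)).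
pose eps' := normal_peak t ^+ n * expR (- (a * s ^+ 2)).
have GE (z : 'rV[R]_n) : G z = normal_peak t ^+ n * expR (- (s ^+ 2 * dot z z) / 2).
  rewrite /G gaussE//; congr (_ * expR _); rewrite /t; field; by rewrite gt_eqF.
have aE : 3 * del ^+ 2 / (8 * t ^+ 2) = a * s ^+ 2.
  by rewrite /a /t; field; rewrite gt_eqF.
have Gtail (z : 'rV[R]_n) : del ^+ 2 <= dot z z -> G z <= eps * G2 z.
  by move=> /(gauss_tail t0); rewrite aE.
have Gtail' (z : 'rV[R]_n) : del ^+ 2 <= dot z z -> G z <= eps'.
  move=> dz; rewrite GE ler_wpM2l ?exprn_ge0 ?normal_peak_ge0// ler_expR mulNr lerN2.
  have := ler_wpM2r (sqr_ge0 s) dz; rewrite /a => h.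
  have : 0 <= del ^+ 2 * s ^+ 2 by rewrite mulr_ge0// sqr_ge0.
  by move: h; rewrite (mulrC (s ^+ 2)); lra.
have iG z := integrable_gauss_shift z t0.
have iG2 z := integrable_gauss_shift z t20.
have ip := integrable_density p0 mp p1.
have iGp z : leb.-integrable setT (EFin \o (fun x => G (x - z) * p x)).
  apply: (integrable_bounded_density (M := normal_peak t ^+ n) p0 mp p1).
    exact: measurable_gauss_shift.
  move=> x; rewrite ger0_norm ?gauss_ge0// GE ler_piMr ?exprn_ge0 ?normal_peak_ge0//.
  by rewrite expR_le1 mulNr oppr_le0 divr_ge0// mulr_ge0 ?sqr_ge0// dotxx_ge0.
have low : A * (1 - eps) <= \int[leb]_x (G (x - y') * p x).
  have -> : A * (1 - eps) = \int[leb]_x (A * (G (x - y') - eps * G2 (x - y'))).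
    have i1 : leb.-integrable setT (EFin \o (fun x => G (x - y') - eps * G2 (x - y'))).
      exact: (integrableB measurableT (iG y') (integrable_EFinZl eps (iG2 y'))).
    rewrite (RintegralZl _ measurableT i1).
    rewrite (RintegralB measurableT (iG y') (integrable_EFinZl eps (iG2 y'))).
    rewrite (RintegralZl _ measurableT (iG2 y')).
    by rewrite /Rintegral !integral_gauss_shift//= mulr1.
  apply: le_Rintegral => //.
    apply: integrable_EFinZl.
    exact: (integrableB measurableT (iG y') (integrable_EFinZl eps (iG2 y'))).
  move=> x _; have [xd|xd] := ltP (dot (x - y') (x - y')) (del ^+ 2).
    have px : A < p x.
      apply: E2; apply: lt_le_trans xd _.
      by rewrite lerXn2r ?nnegrE ?(ltW del0) ?(ltW e20)// ge_min lexx orbT.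
    apply: (@le_trans _ _ (A * G (x - y'))).
      rewrite ler_wpM2l ?(ltW A0)// gerBl mulr_ge0 ?gauss_ge0//.
      by rewrite mulr_ge0 ?exprn_ge0 ?expR_ge0.
    by rewrite mulrC ler_wpM2l ?gauss_ge0// ltW.
  apply: (@le_trans _ _ 0); last by rewrite mulr_ge0// gauss_ge0.
  by rewrite mulr_ge0_le0 ?(ltW A0)// subr_le0 Gtail.
have upp : \int[leb]_x (G (x - y) * p x) <= A' + eps'.
  have -> : A' + eps' = \int[leb]_x (A' * G (x - y) + eps' * p x).
    rewrite (RintegralD measurableT (integrable_EFinZl A' (iG y)) (integrable_EFinZl eps' ip)).
    rewrite (RintegralZl _ measurableT (iG y)) (RintegralZl _ measurableT ip).
    by rewrite /Rintegral integral_gauss_shift// p1 /= !mulr1.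
  have e'0 : 0 <= eps' by rewrite mulr_ge0 ?exprn_ge0 ?expR_ge0 ?normal_peak_ge0.
  apply: le_Rintegral => //.
    exact: (integrableD measurableT (integrable_EFinZl A' (iG y)) (integrable_EFinZl eps' ip)).
  move=> x _; have [xd|xd] := ltP (dot (x - y) (x - y)) (del ^+ 2).
    have px : p x < A'.
      apply: E1; apply: lt_le_trans xd _.
      by rewrite lerXn2r ?nnegrE ?(ltW del0) ?(ltW e10)// ge_min lexx.
    rewrite -[leLHS]addr0; apply: lerD; last exact: mulr_ge0.
    by rewrite mulrC; apply: ler_wpM2r; [exact: gauss_ge0|exact: ltW].
  rewrite -[leLHS]add0r; apply: lerD.
    by apply: mulr_ge0; [exact: ltW|exact: gauss_ge0].
  by apply: ler_wpM2r => //; exact: Gtail'.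
have HG : \int[leb]_x (G (x - y') * p x) <= \int[leb]_x (G (x - y) * p x).
  have E z : \int[leb]_x (G (x - z) * p x) = normal_peak t ^+ n *
      \int[leb]_x (expR (- (s ^+ 2 * dot (x - z) (x - z)) / 2) * p x).
    rewrite -RintegralZl//; last first.
      apply: (integrable_bounded_density (M := 1) p0 mp p1).
        apply: measurableT_comp => //; apply: measurable_funM => //.
        apply: measurableT_comp => //; apply: measurable_funM => //.
        by apply: measurable_dot; exact: measurable_fun_rVB.
      move=> x; rewrite ger0_norm ?expR_ge0// expR_le1 mulNr oppr_le0 divr_ge0//.
      by rewrite mulr_ge0 ?sqr_ge0// dotxx_ge0.
    by apply: eq_Rintegral => x _; rewrite GE mulrA.
  rewrite (E y') (E y); apply: ler_wpM2l; last exact: H.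
  by rewrite exprn_ge0// normal_peak_ge0.
have main := le_trans low (le_trans HG upp).
have eps'K : eps' <= K / s.
  apply: le_trans ea; rewrite ler_wpM2r ?expR_ge0// lerXn2r ?nnegrE ?normal_peak_ge0 ?(ltW s0)//.
  exact: normal_peakV.
have epsK : eps <= 2 ^+ n * (K / s).
  rewrite ler_wpM2l ?exprn_ge0//; apply: le_trans ea.
  by rewrite ler_peMl ?expR_ge0// exprn_ege1.
have AK : (A * 2 ^+ n + 1) * (K / s) < A - A'.
  rewrite mulrA ltr_pdivrMr// /s; move: ((A * 2 ^+ n + 1) * K) => Q.
  by rewrite mulrDr mulr1 mulrCA divff ?mulr1 ?ltrDr// gt_eqF.
have Aeps := ler_wpM2l (ltW A0) epsK.
have fin (x x' q k e e' : R) : x * (1 - e) <= x' + e' -> e' <= k ->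
    x * e <= x * (q * k) -> x - x' <= (x * q + 1) * k.
  by clear; move=> *; lra.
by have := fin _ _ _ _ _ _ main eps'K Aeps; rewrite leNgt AK.
Qed.
End pointwise_unimodal.

Section stable_unimodal.
Context {R : realType} {n : nat} (alpha : R) (p : R -> 'rV[R]_n -> R).
Hypotheses (alpha0 : 0 < alpha) (pst : stable_transition_density alpha p).
Variable t : R.
Hypothesis t0 : 0 < t.
Local Notation leb := (lebesgue_rV n).

Lemma stable_continuousx : continuous (p t).
Proof.
move=> x; apply: (@continuous2_cvg _ _ _ _ (nbhs x) _ (cst t) id p t x).
- exact: (stable_continuous pst).
- exact: cvg_cst.
- exact: cvg_id.
Qed.

Lemma measurable_stable : measurable_fun setT (p t).
Proof. exact: continuous_measurable_rV stable_continuousx. Qed.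

Definition stable_charfun (u : 'rV[R]_n) : R :=
  expR (- (t / 2 * dot u u `^ (alpha / 2))).

Lemma stable_charfunE u :
  \int[leb]_x (cos (dot u x) * p t x) = stable_charfun u.
Proof.
rewrite (stable_charfun_re pst)// /stable_charfun; congr expR.
rewrite /euclidean_norm -powR12_sqrt ?dotxx_ge0// -powRrM.
by rewrite (mulrC 2^-1) mulrAC.
Qed.

Lemma measurable_stable_charfun : measurable_fun setT stable_charfun.
Proof.
apply: measurableT_comp => //; apply: measurableT_comp => //.
apply: measurable_funM => //.
have md : measurable_fun setT (fun u : 'rV[R]_n => dot u u) by exact: measurable_dot.
exact: (measurableT_comp (measurable_powR (alpha / 2)) md).
Qed.

(** With [gam = alpha / 2 < 1], the smoothings of [p t] are ordered by
    [gauss_smoothing] and [stable_smoothing_unimodal]. *)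
Lemma stable_unimodal (y y' : 'rV[R]_n) : alpha < 2 ->
  dot y y <= dot y' y' -> p t y' <= p t y.
Proof.
move=> alpha2 yy'.
have H s z (s0 : 0 < s) := gauss_smoothing (fun x => stable_ge0 pst x t0)
  measurable_stable (stable_mass pst t0) stable_charfunE
  (fun u => stable_charfun_im pst u t0) measurable_stable_charfun z s0.
apply: (smoothing_le_density (fun x => stable_ge0 pst x t0) measurable_stable
  (stable_mass pst t0)) => [||s s0]; [exact: stable_continuousx..|].
rewrite !H//; apply: stable_smoothing_unimodal => //; last by rewrite divr_gt0.
by rewrite divr_gt0//= ltr_pdivrMr// mul1r.
Qed.

(** This is [gauss_smoothing] at the origin, subtracted from [1]. The left-hand
    side measures the mass of [p t] at distance of order [1 / s] and more, the
    right-hand side the behaviour of the characteristic function near [0]. *)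
Lemma stable_gauss_deficit (s : R) : 0 < s ->
  (\int[leb]_x ((1 - expR (- (s ^+ 2 * dot x x) / 2)) * p t x)%:E =
   \int[leb]_u ((1 - stable_charfun u) * gauss s u)%:E)%E.
Proof.
move=> s0.
have p0 x : 0 <= p t x by exact: (stable_ge0 pst).
have me : measurable_fun setT (fun x : 'rV[R]_n => - expR (- (s ^+ 2 * dot x x) / 2)).
  apply: measurableT_comp => //; apply: measurableT_comp => //.
  apply: measurable_funM => //; apply: measurableT_comp => //.
  by apply: measurable_funM => //; exact: measurable_dot.
have e1 (x : 'rV[R]_n) : `|- expR (- (s ^+ 2 * dot x x) / 2)| <= 1.
  rewrite normrN ger0_norm ?expR_ge0// expR_le1 mulNr oppr_le0 divr_ge0//.
  by rewrite mulr_ge0 ?sqr_ge0// dotxx_ge0.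
have mc : measurable_fun setT (fun u => - stable_charfun u).
  by apply: measurableT_comp => //; exact: measurable_stable_charfun.
have c1 u : `|- stable_charfun u| <= 1.
  rewrite normrN ger0_norm ?expR_ge0// expR_le1 oppr_le0 mulr_ge0 ?powR_ge0//.
  by rewrite divr_ge0// ltW.
rewrite (integral_1D_density p0 measurable_stable (stable_mass pst t0) me e1).
rewrite (integral_1D_density (gauss_ge0 s) (measurable_gauss s) (integral_gauss n s0) mc c1).
congr (_%:E); congr (1 + _).
have := gauss_smoothing p0 measurable_stable (stable_mass pst t0) stable_charfunE
  (fun u => stable_charfun_im pst u t0) measurable_stable_charfun 0 s0.
have E1 : \int[leb]_x (- expR (- (s ^+ 2 * dot x x) / 2) * p t x) =
    - \int[leb]_x (expR (- (s ^+ 2 * dot (x - 0) (x - 0)) / 2) * p t x).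
  rewrite -mulN1r -RintegralZl//; last first.
    rewrite (_ : (fun x => _) = (fun x => expR (- (s ^+ 2 * dot x x) / 2) * p t x)).
      apply: (integrable_bounded_density (M := 1) p0 measurable_stable (stable_mass pst t0)).
        by rewrite -[X in measurable_fun _ X]opprK; apply: measurableT_comp.
      by move=> x; rewrite -normrN.
    by apply/funext => x; rewrite subr0.
  by apply: eq_Rintegral => x _; rewrite subr0 mulN1r mulNr.
have E2 : \int[leb]_u (- stable_charfun u * gauss s u) =
    - \int[leb]_u (cos (dot u 0) * stable_charfun u * gauss s u).
  rewrite -mulN1r -RintegralZl//; last first.
    rewrite (_ : (fun u => _) = (fun u => stable_charfun u * gauss s u)).
      apply: (integrable_bounded_density (M := 1) (gauss_ge0 s) (measurable_gauss s)
        (integral_gauss n s0) measurable_stable_charfun).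
      by move=> u; rewrite -normrN.
    apply/funext => u; rewrite (_ : dot u 0 = 0) ?cos0 ?mul1r//.
    by rewrite /dot big1// => i _; rewrite mxE mulr0.
  apply: eq_Rintegral => u _; rewrite (_ : dot u 0 = 0) ?cos0 ?mul1r ?mulN1r ?mulNr//.
  by rewrite /dot big1// => i _; rewrite mxE mulr0.
by rewrite E1 E2 => ->.
Qed.
End stable_unimodal.

(** * Two-sided bounds on the stable density *)

Lemma gauss_widen {R : realType} n (s : R) (u : 'rV[R]_n) : 0 < s ->
  expR (3 * dot u u / (8 * s ^+ 2)) * gauss s u = 2 ^+ n * gauss (2 * s) u.
Proof.
move=> s0; have s20 : 0 < 2 * s by rewrite mulr_gt0.
rewrite !gaussE ?gt_eqF// (normal_peak_double s0) exprMn (mulrCA (expR _)) -expRD [RHS]mulrA.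
by congr (_ * expR _); field; rewrite gt_eqF.
Qed.

Lemma one_sub_expRN_ge {R : realType} (x : R) : 0 <= x ->
  x / (1 + x) <= 1 - expR (- x).
Proof.
move=> x0; have x1 : 0 < 1 + x by rewrite ltr_pwDl.
rewrite ler_pdivrMr// mulrBl mul1r.
have : expR (- x) * (1 + x) <= expR (- x) * expR x.
  by rewrite ler_wpM2l ?expR_ge0// expR_ge1Dx.
by rewrite -expRD addNr expR0; lra.
Qed.

(** The arithmetic that ends [stable_density_lower]: two of the three terms of the
    upper bound are each at most a quarter of the lower bound. *)
Lemma tail_balance {R : realFieldType} (D E F G H c1 c2 c3 c4 : R) :
  4 * (2 * c2 * F) * c3 <= c1 * D * c3 -> 4 * (3 * c2 * E) * c3 <= c1 * D * c3 ->
  c1 * (D * c3) <= 2 * F * (c2 * c3) + (c4 * (G * H) + 3 * c2 * (E * c3)) ->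
  c1 * D / 2 * c3 <= c4 * H * G.
Proof. by move=> h1 h2 h3; lra. Qed.

Section stable_tail.
Context {R : realType} {n : nat} (alpha : R) (p : R -> 'rV[R]_n -> R).
Hypotheses (alpha0 : 0 < alpha) (alpha2 : alpha < 2) (n0 : (0 < n)%N).
Hypothesis pst : stable_transition_density alpha p.
Variable t : R.
Hypothesis t0 : 0 < t.
Local Notation leb := (lebesgue_rV n).

Let p0 x : 0 <= p t x. Proof. exact: (stable_ge0 pst). Qed.

Let L (s : R) := (\int[leb]_x ((1 - expR (- (s ^+ 2 * dot x x) / 2)) * p t x)%:E)%E.

Let powR_le1D (a : R) : 0 <= a -> a `^ (alpha / 2) <= 1 + a.
Proof.
move=> a0; have [a1|a1] := leP a 1.
  apply: (@le_trans _ _ (1 `^ (alpha / 2))); last by rewrite powR1 lerDl.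
  by rewrite ge0_ler_powR ?nnegrE ?divr_ge0// ltW.
apply: le_trans (ler1_powR (ltW a1) _) _; last by rewrite lerDr.
by rewrite ler_pdivrMr// mul1r ltW.
Qed.

Let sqr_powR (s : R) : 0 < s -> (s ^+ 2) `^ (alpha / 2) = s `^ alpha.
Proof.
move=> s0; rewrite -powR_mulrn ?(ltW s0)// -powRrM; congr (_ `^ _).
by rewrite mulrC divfK.
Qed.

Let Cu := t / 2 * (4 * 2 ^+ n).

Let Cu0 : 0 < Cu.
Proof. by rewrite !mulr_gt0// exprn_gt0. Qed.

(** [1 - phi u <= t |u| ^ alpha / 2] for the characteristic function [phi], and
    the Gaussian average of this bound scales like [s ^ alpha]; the growth of
    [|u| ^ alpha] is absorbed by doubling the width of the Gaussian. *)
Let L_upper (s : R) : 0 < s -> (L s <= (Cu * s `^ alpha)%:E)%E.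
Proof.
move=> s0; rewrite /L (stable_gauss_deficit pst t0 s0).
have s20 : 0 < 2 * s by rewrite mulr_gt0.
apply: (@le_trans _ _ (\int[leb]_u ((Cu * s `^ alpha)%:E * (gauss (2 * s) u)%:E))%E).
  apply: ge0_integral_mono => u _.
    rewrite lee_fin mulr_ge0 ?gauss_ge0// subr_ge0 expR_le1 oppr_le0.
    by rewrite mulr_ge0 ?powR_ge0// divr_ge0// ltW.
  rewrite -EFinM lee_fin.
  have d0 := dotxx_ge0 u.
  have h1 : 1 - stable_charfun alpha t u <= t / 2 * dot u u `^ (alpha / 2).
    have := expR_ge1Dx (- (t / 2 * dot u u `^ (alpha / 2))).
    by rewrite /stable_charfun; lra.
  have h2 : dot u u `^ (alpha / 2) <= s `^ alpha * (4 * expR (3 * dot u u / (8 * s ^+ 2))).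
    have -> : dot u u = s ^+ 2 * (dot u u / s ^+ 2).
      by rewrite mulrCA divff ?mulr1// expf_neq0// gt_eqF.
    have a0 : 0 <= dot u u / s ^+ 2 by rewrite divr_ge0// sqr_ge0.
    rewrite powRM ?sqr_ge0// sqr_powR// ler_wpM2l ?powR_ge0//.
    apply: le_trans (powR_le1D a0) _.
    have -> : 3 * (s ^+ 2 * (dot u u / s ^+ 2)) / (8 * s ^+ 2) = 3 / 8 * (dot u u / s ^+ 2).
      by field; rewrite gt_eqF.
    by have := expR_ge1Dx (3 / 8 * (dot u u / s ^+ 2)); lra.
  have -> : Cu * s `^ alpha * gauss (2 * s) u =
     t / 2 * (s `^ alpha * (4 * expR (3 * dot u u / (8 * s ^+ 2)))) * gauss s u.
    transitivity (t / 2 * 4 * s `^ alpha * (2 ^+ n * gauss (2 * s) u)).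
      by rewrite /Cu; ring.
    by rewrite -gauss_widen//; ring.
  rewrite ler_wpM2r ?gauss_ge0//; apply: le_trans h1 _.
  by rewrite ler_wpM2l// divr_ge0// ltW.
rewrite ge0_integralZl//; last 3 first.
- by apply/measurable_EFinP; exact: measurable_gauss.
- by move=> u _; rewrite lee_fin gauss_ge0.
- by rewrite lee_fin mulr_ge0 ?powR_ge0// ltW.
by rewrite integral_gauss// mule1.
Qed.

Let cl := t / 2 / (1 + t / 2) * (normal_peak 1 ^+ n * expR (- (2 * n%:R))).

Let cl0 : 0 < cl.
Proof.
by rewrite mulr_gt0// ?mulr_gt0 ?exprn_gt0 ?normal_peak_gt0 ?expR_gt0// invr_gt0 addr_gt0// divr_gt0.
Qed.

Let dot_box (u : 'rV[R]_n) (a b : R) : 0 <= a -> box a b u ->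
  a ^+ 2 <= dot u u <= n%:R * b ^+ 2.
Proof.
move=> a0 ub; apply/andP; split; last first.
  apply: dot_le_box => i; have /andP[h1 h2] := ub i.
  by rewrite ger0_norm// (le_trans a0).
apply: le_trans (sqr_coord_le_dot u (Ordinal n0)).
have /andP[h1 h2] := ub (Ordinal n0).
by rewrite lerXn2r// nnegrE// (le_trans a0).
Qed.

(** The box with sides [s, 2 s] alone contributes a multiple of [s ^ alpha]: on it
    [|u|] is of order [s] and the Gaussian density of order [s ^ (- n)]. *)
Let L_lower (s : R) : 0 < s -> s <= 1 -> ((cl * s `^ alpha)%:E <= L s)%E.
Proof.
move=> s0 s1; rewrite /L (stable_gauss_deficit pst t0 s0).
have sa1 : s `^ alpha <= 1.
  have := @ge0_ler_powR R alpha (ltW alpha0) s 1; rewrite powR1.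
  by apply; rewrite ?nnegrE// ltW.
pose k := t / 2 * s `^ alpha / (1 + t / 2) * (normal_peak s ^+ n * expR (- (2 * n%:R))).
have t20 : 0 < t / 2 by rewrite divr_gt0.
have pk : normal_peak s * s = normal_peak 1.
  rewrite /normal_peak expr1n mul1r -mulr_natr -mulrA sqrtrM ?sqr_ge0//.
  rewrite sqrtr_sqr ger0_norm ?(ltW s0)// invfM mulrAC mulVf ?mul1r ?gt_eqF//.
  by rewrite mulr_natr.
have kE : cl * s `^ alpha = k * s ^+ n.
  by rewrite /cl -pk exprMn /k; ring.
have k0 : 0 <= k.
  apply: mulr_ge0; last by rewrite mulr_ge0 ?exprn_ge0 ?normal_peak_ge0 ?expR_ge0.
  by apply: divr_ge0; [exact: mulr_ge0 (ltW t20) (powR_ge0 _ _)|exact: addr_ge0 (ltW t20)].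
apply: (@le_trans _ _ (\int[leb]_u (k%:E * (\1_(box s (2 * s)) u)%:E))%E).
  rewrite ge0_integralZl//; last first.
    by apply/measurable_EFinP; apply: measurable_indic; exact: measurable_box.
  rewrite integral_indic//; last exact: measurable_box.
  rewrite setIT [X in (_ * X)%E]lebesgue_box; last by rewrite mulr_natl mulr2n lerDl ltW.
  by rewrite -EFinM lee_fin kE (_ : 2 * s - s = s)//; ring.
apply: ge0_integral_mono => u _; first by rewrite -EFinM lee_fin mulr_ge0.
rewrite -EFinM lee_fin indicE; have [ub|ub] := boolP (u \in box s (2 * s)); last first.
  rewrite mulr0 mulr_ge0 ?gauss_ge0// subr_ge0 expR_le1 oppr_le0.
  by rewrite mulr_ge0 ?powR_ge0// ltW.
rewrite inE in ub; have /andP[d1 d2] := dot_box (ltW s0) ub.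
rewrite mulr1 /k ler_pM//.
- by apply: divr_ge0; [exact: mulr_ge0 (ltW t20) (powR_ge0 _ _)|exact: addr_ge0 (ltW t20)].
- by rewrite mulr_ge0 ?exprn_ge0 ?normal_peak_ge0 ?expR_ge0.
- have X0 : 0 <= t / 2 * s `^ alpha by rewrite mulr_ge0 ?powR_ge0// ltW.
  apply: (@le_trans _ _ (1 - expR (- (t / 2 * s `^ alpha)))).
    apply: le_trans (one_sub_expRN_ge X0).
    rewrite ler_wpM2l// lef_pV2 ?posrE ?ltr_pwDl// ?(ltW t20)// lerD2l.
    by rewrite ler_piMr// ltW.
  rewrite lerD2l lerN2 ler_expR lerN2 ler_wpM2l ?(ltW t20)//.
  rewrite -sqr_powR// ge0_ler_powR ?nnegrE ?sqr_ge0 ?dotxx_ge0//.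
  by rewrite divr_ge0// ltW.
- rewrite gaussE ?gt_eqF// ler_wpM2l ?exprn_ge0 ?normal_peak_ge0// ler_expR.
  rewrite mulNr lerN2 ler_pdivrMr ?pmulrn_lgt0 ?exprn_gt0//.
  by apply: le_trans d2 _; rewrite exprMn -mulr_natr; lra.
Qed.

Let w (s : R) (x : 'rV[R]_n) := 1 - expR (- (s ^+ 2 * dot x x) / 2).

Let w_ge0 s x : 0 <= w s x.
Proof.
rewrite subr_ge0 expR_le1 mulNr oppr_le0 divr_ge0//.
by rewrite mulr_ge0 ?sqr_ge0// dotxx_ge0.
Qed.

Let measurable_wp s : measurable_fun setT (fun x => (w s x * p t x)%:E).
Proof.
apply/measurable_EFinP/measurable_funM; last exact: (measurable_stable pst t0).
apply: measurable_funB => //; apply: measurableT_comp => //.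
apply: measurable_funM => //; apply: measurableT_comp => //.
by apply: measurable_funM => //; exact: measurable_dot.
Qed.

Let integral_wp s k : 0 <= k -> (\int[leb]_x (k%:E * (w s x * p t x)%:E) = k%:E * L s)%E.
Proof.
move=> k0; rewrite (ge0_integralZl _ measurableT (measurable_wp s))//.
by move=> x _; rewrite lee_fin mulr_ge0.
Qed.

Let tail (r : R) := (\int[leb]_x ((r ^+ 2 <= dot x x)%R%:R * p t x)%:E)%E.

Let measurable_tail (r : R) :
  measurable_fun setT (fun x => ((r ^+ 2 <= dot x x)%R%:R * p t x)%:E).
Proof.
apply/measurable_EFinP/measurable_funM; last exact: (measurable_stable pst t0).
have md : measurable_fun setT (fun x : 'rV[R]_n => dot x x) by exact: measurable_dot.
have mA : measurable ((fun x : 'rV[R]_n => dot x x) @^-1` `[r ^+ 2, +oo[%classic).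
  by rewrite -[X in measurable X]setTI; exact: md.
rewrite (_ : (fun x => _) = \1_((fun x : 'rV[R]_n => dot x x) @^-1` `[r ^+ 2, +oo[%classic)).
  exact: measurable_indic.
apply/funext => x; rewrite indicE; congr ((nat_of_bool _)%:R); apply/idP/idP.
  by move=> h; rewrite inE /= in_itv/= h.
by rewrite inE /= in_itv/= andbT.
Qed.

(** Where [|x| >= r], [w r^-1 x] is at least [1 / 3]. *)
Let tail_le (r : R) : 0 < r -> (tail r <= (3 * Cu * r^-1 `^ alpha)%:E)%E.
Proof.
move=> r0; rewrite /tail.
apply: (@le_trans _ _ (\int[leb]_x (3%:E * (w r^-1 x * p t x)%:E))%E).
  apply: ge0_integral_mono => x _; first by rewrite lee_fin mulr_ge0.
  rewrite -EFinM lee_fin mulrA ler_wpM2r//.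
  case: (leP (r ^+ 2)) => [h|_]; last by rewrite mulr0n mulr_ge0.
  have a0 : 2^-1 <= r^-1 ^+ 2 * dot x x / 2.
    by rewrite -[leLHS]mul1r ler_pM2r// exprVn ler_pdivlMl ?exprn_gt0// mulr1.
  have := @one_sub_expRN_ge _ (r^-1 ^+ 2 * dot x x / 2); rewrite -mulNr -/(w _ _).
  move: a0; set a := r^-1 ^+ 2 * dot x x / 2 => a0 /(_ (le_trans _ a0)) h2.
  apply: (@le_trans _ _ (3 * (a / (1 + a)))); last by rewrite ler_wpM2l// h2.
  by rewrite mulrA mulr1n ler_pdivlMr; lra.
rewrite integral_wp// -mulrA EFinM; apply: lee_wpmul2l => //.
by apply: L_upper; rewrite invr_gt0.
Qed.

(** By unimodality [p t z] is a lower bound of [p t] on the box with sides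
    [r, 2 r], whose mass is at most that of [|x| >= r]. *)
Lemma stable_density_upper : exists2 C, 0 < C &
  forall (r : R) z, 0 < r -> 4 * n%:R * r ^+ 2 <= dot z z ->
    p t z * r ^+ n <= C * r^-1 `^ alpha.
Proof.
exists (3 * Cu) => [|r z r0 rz]; first exact: mulr_gt0.
rewrite -lee_fin; apply: le_trans (tail_le r0).
apply: (@le_trans _ _ (\int[leb]_x ((p t z)%:E * (\1_(box r (2 * r)) x)%:E))%E).
  rewrite ge0_integralZl//; last 2 first.
  - by apply/measurable_EFinP; apply: measurable_indic; exact: measurable_box.
  - by rewrite lee_fin.
  rewrite integral_indic//; last exact: measurable_box.
  rewrite setIT [X in (_ * X)%E]lebesgue_box; last by rewrite mulr_natl mulr2n lerDl ltW.
  by rewrite -EFinM lee_fin (_ : 2 * r - r = r)//; ring.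
apply: ge0_integral_mono => x _; first by rewrite -EFinM lee_fin mulr_ge0.
rewrite -EFinM lee_fin indicE; have [xb|xb] := boolP (x \in box r (2 * r)); last first.
  by rewrite mulr0 mulr_ge0.
rewrite inE in xb; have /andP[d1 d2] := dot_box (ltW r0) xb.
rewrite d1 mulr1 mul1r; apply: (stable_unimodal alpha0 pst t0 alpha2).
by apply: le_trans d2 _; apply: le_trans rz; rewrite exprMn; lra.
Qed.

(** [L (del / r)] is at least a multiple of [del ^ alpha r ^ (- alpha)]. The ball
    [|x| <= r] contributes to it at most [2 del ^ 2 L (1 / r)], of order
    [del ^ 2 r ^ (- alpha)], and the region [|x| >= K r] a term of order
    [(K r) ^ (- alpha)]. As [alpha < 2], small [del] and large [K] leave a fixed
    share of the mass to the shell in between, where [p t <= p t z]. *)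
Lemma stable_density_lower : exists2 c, 0 < c &
  forall (r : R) z, 1 <= r -> dot z z <= r ^+ 2 -> c * r^-1 `^ alpha <= p t z * r ^+ n.
Proof.
(* [del] makes the mass near the origin negligible, [K] the mass far away *)
have [del [del0 del1 delC]] : exists del, [/\ 0 < del, del <= 1 &
    4 * (2 * Cu * del ^+ 2) <= cl * del `^ alpha].
  pose e := Num.min 1 (cl / (8 * Cu)).
  have e0 : 0 < e by rewrite lt_min ltr01 divr_gt0// mulr_gt0.
  pose del := e `^ (2 - alpha)^-1.
  have a2 : 0 < 2 - alpha by rewrite subr_gt0.
  have del0 : 0 < del by exact: powR_gt0.
  exists del; split=> //.
    have := @ge0_ler_powR R (2 - alpha)^-1 _ e 1; rewrite powR1; apply.
    - by rewrite invr_ge0 ltW.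
    - by rewrite nnegrE ltW.
    - by rewrite nnegrE.
    - by rewrite ge_min lexx.
  have -> : del ^+ 2 = del `^ alpha * e.
    rewrite -powR_mulrn ?(ltW del0)// -[2%:R](subrK alpha) addrC powRD; last first.
      by rewrite (gt_eqF del0) implybT.
    by rewrite /del -!powRrM mulVf ?gt_eqF// powRr1// ltW.
  have ecl : e <= cl / (8 * Cu) by rewrite ge_min lexx orbT.
  rewrite ler_pdivlMr ?mulr_gt0// in ecl.
  have := ler_wpM2l (powR_ge0 del alpha) ecl; lra.
have D0 : 0 < del `^ alpha by exact: powR_gt0.
have C12 : 0 < 12 * Cu by exact: mulr_gt0.
have [K [K1 KC]] : exists K, 1 <= K /\ 4 * (3 * Cu * K^-1 `^ alpha) <= cl * del `^ alpha.
  pose e := Num.min 1 (cl * del `^ alpha / (12 * Cu)).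
  have e0 : 0 < e by rewrite lt_min ltr01 (divr_gt0 (mulr_gt0 cl0 D0) C12).
  pose k := e `^ alpha^-1.
  have k0 : 0 < k by exact: powR_gt0.
  exists k^-1; split.
    rewrite invf_ge1//; have := @ge0_ler_powR R alpha^-1 _ e 1; rewrite powR1; apply.
    - by rewrite invr_ge0 ltW.
    - by rewrite nnegrE ltW.
    - by rewrite nnegrE.
    - by rewrite ge_min lexx.
  rewrite invrK /k -powRrM mulVf ?gt_eqF// powRr1 ?(ltW e0)//.
  have ecl : e <= cl * del `^ alpha / (12 * Cu) by rewrite ge_min lexx orbT.
  rewrite ler_pdivlMr ?mulr_gt0// in ecl; lra.
have K0 : 0 < K by exact: lt_le_trans K1.
exists (cl * del `^ alpha / 2 / (2 * K) ^+ n).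
  have K20 : 0 < 2 * K by exact: mulr_gt0.
  by rewrite divr_gt0 ?exprn_gt0// divr_gt0// (mulr_gt0 cl0 D0).
move=> r z r1 zr; have r0 : 0 < r by exact: lt_le_trans r1.
have ri0 : 0 < r^-1 by rewrite invr_gt0.
set ra := r^-1 `^ alpha.
have ra0 : 0 < ra by exact: powR_gt0.
have lower : ((cl * (del `^ alpha * ra))%:E <= L (del / r))%E.
  rewrite -powRM ?(ltW del0) ?(ltW ri0)//; apply: L_lower; first exact: divr_gt0.
  by rewrite ler_pdivrMr// mul1r (le_trans del1).
have upper : (L (del / r) <= (2 * del ^+ 2)%:E * L r^-1 +
    ((p t z)%:E * \int[leb]_x (\1_(box (- (K * r)) (K * r)) x)%:E + tail (K * r)))%E.
  have mb : measurable_fun setT (fun x : 'rV[R]_n => (\1_(box (- (K * r)) (K * r)) x : R)%:E).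
    by apply/measurable_EFinP; apply: measurable_indic; exact: measurable_box.
  have k00 : 0 <= 2 * del ^+ 2 by rewrite mulr_ge0// sqr_ge0.
  rewrite -(integral_wp r^-1 k00).
  pose f1 (x : 'rV[R]_n) := ((2 * del ^+ 2)%:E * (w r^-1 x * p t x)%:E)%E.
  pose f2 (x : 'rV[R]_n) := ((p t z)%:E * (\1_(box (- (K * r)) (K * r)) x : R)%:E)%E.
  pose f3 (x : 'rV[R]_n) := ((((K * r) ^+ 2 <= dot x x)%R%:R * p t x)%:E : \bar R).
  have mf1 : measurable_fun setT f1 by apply: measurable_funeM; exact: measurable_wp.
  have mf2 : measurable_fun setT f2 by exact: measurable_funeM.
  have mf3 : measurable_fun setT f3 by exact: measurable_tail.
  have f10 x : (0 <= f1 x)%E by rewrite mule_ge0// lee_fin mulr_ge0.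
  have f20 x : (0 <= f2 x)%E by rewrite mule_ge0// lee_fin.
  have f30 x : (0 <= f3 x)%E by rewrite lee_fin mulr_ge0.
  have -> : ((p t z)%:E * \int[leb]_x (\1_(box (- (K * r)) (K * r)) x)%:E =
      \int[leb]_x f2 x)%E.
    by rewrite ge0_integralZl// lee_fin.
  have -> : tail (K * r) = (\int[leb]_x f3 x)%E by [].
  rewrite -/(f1 _).
  have f23 x : setT x -> (0 <= (f2 \+ f3) x)%E by move=> _; rewrite adde_ge0.
  rewrite -(ge0_integralD leb measurableT (fun x _ => f20 x) mf2 (fun x _ => f30 x) mf3).
  rewrite -(ge0_integralD leb measurableT (fun x _ => f10 x) mf1 f23
    (emeasurable_funD mf2 mf3)).
  apply: ge0_integral_mono => x _; first by rewrite lee_fin mulr_ge0// w_ge0.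
  rewrite /f1 /f2 /f3 /= -!EFinM -!EFinD lee_fin.
  have w1 s : w s x <= 1 by rewrite gerBl expR_ge0.
  have k0 : 0 <= 2 * del ^+ 2 * (w r^-1 x * p t x).
    exact: mulr_ge0 k00 (mulr_ge0 (w_ge0 _ _) (p0 x)).
  have [xr|xr] := leP (dot x x) (r ^+ 2).
    rewrite -[leLHS]addr0 lerD//; last by rewrite addr_ge0// mulr_ge0.
    rewrite mulrA ler_wpM2r//.
    pose a := r^-1 ^+ 2 * dot x x / 2.
    have a0 : 0 <= a by rewrite divr_ge0// mulr_ge0 ?sqr_ge0// dotxx_ge0.
    have a1 : a <= 2^-1.
      by rewrite -[leRHS]mul1r ler_pM2r// exprVn ler_pdivrMl ?exprn_gt0// mulr1.
    have h1 : a <= 2 * w r^-1 x.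
      have := one_sub_expRN_ge a0; rewrite /w mulNr -/a => h.
      apply: (@le_trans _ _ (2 * (a / (1 + a)))); last by rewrite ler_wpM2l.
      rewrite mulrA ler_pdivlMr; last by rewrite ltr_pwDl.
      by rewrite mulrC ler_wpM2r//; lra.
    have h2 : w (del / r) x <= del ^+ 2 * a.
      have := expR_ge1Dx (- (del ^+ 2 * a)).
      rewrite /w (_ : - ((del / r) ^+ 2 * dot x x) / 2 = - (del ^+ 2 * a)); first by lra.
      by rewrite /a exprMn; ring.
    apply: le_trans h2 _; rewrite [leRHS](_ : _ = del ^+ 2 * (2 * w r^-1 x)).
      by apply: ler_wpM2l => //; exact: sqr_ge0.
    by rewrite [in LHS](mulrC 2) mulrA.
  rewrite -[leLHS]add0r lerD//.
  have wp : w (del / r) x * p t x <= p t x by rewrite ler_piMl.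
  have [xK|xK] := leP ((K * r) ^+ 2) (dot x x).
    by rewrite mul1r -[leLHS]add0r lerD// mulr_ge0.
  rewrite mul0r addr0; apply: le_trans wp _.
  have xb : x \in box (- (K * r)) (K * r).
    rewrite inE => i; rewrite -ler_norml -(@ler_pXn2r _ 2) ?nnegrE ?mulr_ge0 ?(ltW K0) ?(ltW r0)//.
    rewrite real_normK ?num_real//; apply: le_trans (ltW xK).
    exact: sqr_coord_le_dot.
  rewrite indicE xb mulr1; apply: (stable_unimodal alpha0 pst t0 alpha2).
  exact: le_trans zr (ltW xr).
have Kr0 : 0 < K * r by exact: mulr_gt0.
have mid : (\int[leb]_x (\1_(box (- (K * r)) (K * r)) x)%:E = ((2 * K * r) ^+ n)%:E)%E.
  rewrite integral_indic//; last exact: measurable_box.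
  rewrite setIT [LHS]lebesgue_box; first by congr ((_ ^+ _)%:E); ring.
  by rewrite (le_trans _ (ltW Kr0))// oppr_le0 ltW.
have L1 := L_upper ri0; have T1 := tail_le Kr0.
have := le_trans lower upper; rewrite mid => main.
have {}main : ((cl * (del `^ alpha * ra))%:E <= (2 * del ^+ 2)%:E * (Cu * ra)%:E +
    ((p t z)%:E * ((2 * K * r) ^+ n)%:E + (3 * Cu * (K * r)^-1 `^ alpha)%:E))%E.
  apply: le_trans main _; apply: leeD; last by apply: leeD.
  by apply: lee_wpmul2l; rewrite // lee_fin mulr_ge0 ?sqr_ge0.
move: main; rewrite -!EFinM -!EFinD lee_fin.
have -> : (K * r)^-1 `^ alpha = K^-1 `^ alpha * ra.
  by rewrite invfM powRM ?invr_ge0 ?(ltW K0) ?(ltW r0).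
have Kn0 : 0 < (2 * K) ^+ n by rewrite exprn_gt0// mulr_gt0.
rewrite [(2 * K * r) ^+ n]exprMn.
have -> : cl * del `^ alpha / 2 / (2 * K) ^+ n * ra =
    cl * del `^ alpha / 2 * ra / (2 * K) ^+ n by rewrite mulrAC.
rewrite (ler_pdivrMr _ _ Kn0).
have h1 := ler_wpM2r (ltW ra0) delC.
have h2 := ler_wpM2r (ltW ra0) KC.
by move=> main; exact: tail_balance h1 h2 main.
Qed.
End stable_tail.

(** * Comparison of translates of the density *)

Section stable_comparison.
Context {R : realType} {n : nat} (alpha : R) (p : R -> 'rV[R]_n -> R).
Hypotheses (alpha0 : 0 < alpha) (n0 : (0 < n)%N).
Hypothesis pst : stable_transition_density alpha p.

(** If [z = x - y] is far away, [stable_density_upper] for [p t z] and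
    [stable_density_lower] for [p s x] apply at the same scale [q], proportional
    to [|z|]; otherwise [x] stays in a ball, where [p s] is bounded below, and
    [p t z <= p t 0]. *)
Lemma stable_comparison_lt2 (t s r : R) : alpha < 2 -> 0 < t -> 0 < s ->
  exists2 C, 0 <= C & forall x y, dot y y <= r ^+ 2 -> p t (x - y) <= C * p s x.
Proof.
move=> alpha2 t0 s0.
have [Ct Ct0 upper] := stable_density_upper alpha0 alpha2 n0 pst t0.
have [c c0 lower] := stable_density_lower alpha0 alpha2 n0 pst s0.
have pt0 x : 0 <= p t x by exact: (stable_ge0 pst).
have ps0 x : 0 <= p s x by exact: (stable_ge0 pst).
have n1 : 1 <= n%:R :> R by rewrite ler1n.
(* [|x| ^ 2 <= 2 |z| ^ 2 + 2 r ^ 2 <= (M q) ^ 2] if [|z| ^ 2 = 4 n q ^ 2], [q >= 1] *)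
pose M := Num.sqrt (8 * n%:R + 2 * r ^+ 2).
have M2 : M ^+ 2 = 8 * n%:R + 2 * r ^+ 2.
  by rewrite sqr_sqrtr// addr_ge0// mulr_ge0// sqr_ge0.
have M1 : 1 <= M.
  rewrite -(@ler_pXn2r _ 2) ?nnegrE ?sqrtr_ge0// expr1n M2.
  by have := sqr_ge0 r; lra.
have M0 : 0 < M by exact: lt_le_trans M1.
pose m := M^-1 `^ alpha.
have m0 : 0 < m by apply: powR_gt0; rewrite invr_gt0.
have cm0 : 0 < c * m by exact: mulr_gt0.
exists ((Ct + p t 0) * M ^+ n / (c * m)).
  by rewrite divr_ge0 ?(ltW cm0)// mulr_ge0 ?exprn_ge0 ?(ltW M0)// addr_ge0// ltW.
move=> x y yr; set z := x - y.
have xz : dot x x <= 2 * dot z z + 2 * r ^+ 2.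
  have := dot_parallelogram z (- y); rewrite opprK subrK.
  have -> : dot (- y) (- y) = dot y y.
    by apply: eq_bigr => i _; rewrite !mxE mulrNN.
  by lra.
rewrite mulrAC (ler_pdivlMr _ _ cm0).
have [z4|z4] := leP (4 * n%:R) (dot z z).
- pose q := Num.sqrt (dot z z / (4 * n%:R)).
  have n40 : 0 < 4 * n%:R :> R by rewrite mulr_gt0// ltr0n.
  have q2 : 4 * n%:R * q ^+ 2 = dot z z.
    rewrite sqr_sqrtr; first by rewrite mulrC divfK// gt_eqF.
    by rewrite divr_ge0 ?dotxx_ge0// ltW.
  have q1 : 1 <= q.
    rewrite -(@ler_pXn2r _ 2) ?nnegrE ?sqrtr_ge0// expr1n.
    by rewrite -(ler_pM2l n40) q2 mulr1.
  have q0 : 0 < q by exact: lt_le_trans q1.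
  have /(upper _ _ q0) h1 : 4 * n%:R * q ^+ 2 <= dot z z by rewrite q2.
  have Mq1 : 1 <= M * q by rewrite mulr_ege1.
  have /(lower _ _ Mq1) h2 : dot x x <= (M * q) ^+ 2.
    rewrite exprMn M2; apply: le_trans xz _; rewrite -q2 mulrDl.
    have : 1 <= q ^+ 2 by exact: exprn_ege1.
    by have := sqr_ge0 r; nra.
  have qn0 : 0 < q ^+ n by exact: exprn_gt0.
  rewrite -(ler_pM2r qn0).
  rewrite invfM powRM ?invr_ge0 ?(ltW M0) ?(ltW q0)// exprMn -/m in h2.
  set a := q^-1 `^ alpha in h1 h2.
  apply: (@le_trans _ _ (Ct * (c * (m * a)))).
    have := ler_wpM2r (ltW cm0) h1; rewrite -subr_ge0 => h; rewrite -subr_ge0.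
    by apply: le_trans h _; rewrite le_eqVlt; apply/orP; left; apply/eqP; ring.
  apply: (@le_trans _ _ (Ct * (p s x * (M ^+ n * q ^+ n)))).
    by rewrite ler_wpM2l// ltW.
  have -> : (Ct + p t 0) * M ^+ n * p s x * q ^+ n =
      Ct * (p s x * (M ^+ n * q ^+ n)) + p t 0 * (p s x * (M ^+ n * q ^+ n)) by ring.
  by rewrite lerDl !mulr_ge0 ?exprn_ge0// ltW.
- have /(lower _ _ M1) h2 : dot x x <= M ^+ 2 by rewrite M2; apply: le_trans xz _; lra.
  have h1 : p t z <= p t 0.
    apply: (stable_unimodal alpha0 pst t0 alpha2); apply: le_trans (dotxx_ge0 z).
    by rewrite /dot big1// => i _; rewrite mxE mul0r.
  apply: (@le_trans _ _ (p t 0 * (p s x * M ^+ n))).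
    by apply: ler_pM => //; exact: ltW.
  have -> : (Ct + p t 0) * M ^+ n * p s x =
      Ct * (p s x * M ^+ n) + p t 0 * (p s x * M ^+ n) by ring.
  by rewrite lerDr !mulr_ge0 ?exprn_ge0// ltW.
Qed.

(** Doubling the time halves the exponent, and
    [|x| ^ 2 / 2 <= |x - y| ^ 2 + |y| ^ 2]. *)
Lemma gauss_comparison (t r : R) : alpha = 2 -> 0 < t ->
  exists2 C, 0 <= C & forall x y, dot y y <= r ^+ 2 -> p t (x - y) <= C * p (2 * t) x.
Proof.
move=> alpha2 t0; have t20 : 0 < 2 * t by exact: mulr_gt0.
pose a := (2 * pi * t) `^ (- (n%:R / 2)).
pose b := (2 * pi * (2 * t)) `^ (- (n%:R / 2)).
have b0 : 0 < b by rewrite powR_gt0// !mulr_gt0// pi_gt0.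
exists (a / b * expR (r ^+ 2 / (2 * t))).
  by rewrite mulr_ge0 ?expR_ge0// divr_ge0 ?powR_ge0.
move=> x y yr; rewrite !(stable_gaussian pst alpha2)// -/a -/b !sqr_euclidean_norm.
have -> : a / b * expR (r ^+ 2 / (2 * t)) * (b * expR (- (dot x x / (2 * (2 * t))))) =
    a * expR (r ^+ 2 / (2 * t) - dot x x / (2 * (2 * t))).
  by rewrite expRD; field; rewrite gt_eqF.
rewrite ler_wpM2l ?powR_ge0// ler_expR.
have h := dot_parallelogram (x - y) (- y).
have yy : dot (- y) (- y) = dot y y by apply: eq_bigr => i _; rewrite !mxE mulrNN.
rewrite opprK subrK yy in h.
rewrite -subr_ge0 opprK.
have -> : r ^+ 2 / (2 * t) - dot x x / (2 * (2 * t)) + dot (x - y) (x - y) / (2 * t) =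
    (2 * r ^+ 2 + 2 * dot (x - y) (x - y) - dot x x) / (4 * t).
  by field; rewrite gt_eqF.
by rewrite divr_ge0 ?mulr_ge0 ?(ltW t0)//; lra.
Qed.

Lemma stable_comparison (t r : R) : alpha <= 2 -> 0 < t ->
  exists2 s, 0 < s & exists2 C, 0 <= C &
    forall x y, dot y y <= r ^+ 2 -> p t (x - y) <= C * p s x.
Proof.
rewrite le_eqVlt => /predU1P[alpha2|alpha2] t0.
- by exists (2 * t); [exact: mulr_gt0|exact: gauss_comparison].
- by exists t; [|exact: stable_comparison_lt2].
Qed.
End stable_comparison.

(** * Linear bounds on solutions of the mild equation *)

Section semigroup.
Context {R : realType} {n : nat} (alpha : R) (p : R -> 'rV[R]_n -> R).
Hypothesis pst : stable_transition_density alpha p.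
Local Notation leb := (lebesgue_rV n).
Local Notation T := (stable_semigroup p).

Let p0 t x : 0 < t -> 0 <= p t x. Proof. by move=> t0; exact: (stable_ge0 pst). Qed.

Let mp t : 0 < t -> measurable_fun setT (p t).
Proof. by move=> t0; exact: (measurable_stable pst). Qed.

Let mpB t (x : 'rV[R]_n) : 0 < t -> measurable_fun setT (fun y : 'rV[R]_n => p t (x - y)).
Proof.
by move=> t0; apply: (measurableT_comp (mp t0)); exact: measurable_fun_rVB.
Qed.

Lemma stable_semigroup_ge0 (t : R) (f : 'rV[R]_n -> R) x : 0 < t -> (forall y, 0 <= f y) -> (0 <= T t f x)%E.
Proof. by move=> t0 f0; apply: integral_ge0 => y _; rewrite lee_fin mulr_ge0// p0. Qed.

Lemma stable_semigroup_le (t : R) (f : 'rV[R]_n -> R) (l : R) x : 0 < t -> (forall y, 0 <= f y <= l) ->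
  (T t f x <= l%:E)%E.
Proof.
move=> t0 f01; have l0 : 0 <= l by have /andP[] := f01 0; exact: le_trans.
apply: (@le_trans _ _ (\int[leb]_y (l%:E * (p t (x - y))%:E))%E).
  apply: ge0_integral_mono => y _; have /andP[f0 f1] := f01 y.
    by rewrite lee_fin mulr_ge0// p0.
  by rewrite -EFinM lee_fin mulrC ler_wpM2r// p0.
rewrite ge0_integralZl//; last 2 first.
- by apply/measurable_EFinP; exact: mpB.
- by move=> y _; rewrite lee_fin p0.
rewrite (integral_lebesgue_rVB x (f := fun y => (p t y)%:E)).
- by rewrite (stable_mass pst t0) mule1.
- by apply/measurable_EFinP; exact: mp.
- by move=> y; rewrite lee_fin p0.
Qed.

Lemma measurable_stable_semigroup (t : R) (f : 'rV[R]_n -> R) : 0 < t -> measurable_fun setT f ->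
  (forall y, 0 <= f y) -> measurable_fun setT (T t f).
Proof.
move=> t0 mf f0.
pose F (z : 'rV[R]_n * 'rV[R]_n) : \bar R := (p t (z.1 - z.2) * f z.2)%:E.
have F0 z : (0 <= F z)%E by rewrite lee_fin mulr_ge0// p0.
have mF : measurable_fun setT F.
  apply/measurable_EFinP; apply: measurable_funM.
    apply: (measurableT_comp (mp t0)).
    by apply: measurable_fun_rVB; [exact: measurable_fst|exact: measurable_snd].
  exact: measurableT_comp mf measurable_snd.
exact: (measurable_fun_fubini_tonelli_F (m2 := leb) F mF F0).
Qed.

Lemma stable_semigroupD (s t : R) (f : 'rV[R]_n -> R) x : 0 < s -> 0 < t -> measurable_fun setT f ->
  (forall y, 0 <= f y) ->
  (\int[leb]_y ((p s (x - y))%:E * T t f y) = T (s + t)%R f x)%E.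
Proof.
move=> s0 t0 mf f0.
pose F (z : 'rV[R]_n * 'rV[R]_n) : \bar R :=
  (p s (x - z.1) * (p t (z.1 - z.2) * f z.2))%:E.
have F0 z : (0 <= F z)%E by rewrite lee_fin !mulr_ge0// p0.
have mF : measurable_fun setT F.
  apply/measurable_EFinP; apply: measurable_funM.
    exact: measurableT_comp (mpB x s0) measurable_fst.
  apply: measurable_funM; last exact: measurableT_comp mf measurable_snd.
  apply: (measurableT_comp (mp t0)).
  by apply: measurable_fun_rVB; [exact: measurable_fst|exact: measurable_snd].
transitivity (\int[leb]_y \int[leb]_z F (y, z))%E.
  apply: eq_integral => y _; rewrite /F /=.
  under [RHS]eq_integral do rewrite EFinM.
  rewrite ge0_integralZl//.
  - apply/measurable_EFinP; apply: measurable_funM => //; exact: mpB.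
  - by move=> z _; rewrite lee_fin mulr_ge0// p0.
  - by rewrite lee_fin p0.
rewrite (fubini_tonelli F mF F0); apply: eq_integral => z _; rewrite /F /=.
under eq_integral => y _ do rewrite mulrA mulrC EFinM.
have mg : measurable_fun setT (fun y : 'rV[R]_n => (p s (x - y) * p t (y - z))%:E).
  apply/measurable_EFinP; apply: measurable_funM; first exact: mpB.
  by apply: (measurableT_comp (mp t0)); exact: measurable_fun_rVB.
have g0 y : (0 <= (p s (x - y) * p t (y - z))%:E)%E.
  by rewrite lee_fin mulr_ge0// p0.
rewrite (ge0_integralZl _ measurableT mg)//; last by rewrite lee_fin.
rewrite -(integral_lebesgue_rVD z mg g0) mulrC EFinM; congr (_ * _)%E.
rewrite (stable_chapman_kolmogorov pst (x - z) s0 t0).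
by apply: eq_integral => y _; rewrite addrK opprD addrA addrAC.
Qed.

(** Since [0 <= v_s <= l], the nonlinear term is at most [l ^ beta v_s <=
    l ^ beta T_s f]; applying [T_(t - s)] and integrating over [s < t] gives
    [t l ^ beta T_t f]. *)
Lemma mild_solution_bounds (beta l t : R) (f : 'rV[R]_n -> R) v x : 0 < beta ->
  measurable_fun setT f -> (forall y, 0 <= f y <= l) ->
  mild_solution p beta f v -> 0 < t -> t * l `^ beta <= 2^-1 ->
  ((v t x)%:E <= T t f x)%E /\ (T t f x <= 2%:E * (v t x)%:E)%E.
Proof.
move=> beta0 mf f01 vf t0 tl.
have f0 y : 0 <= f y by have /andP[] := f01 y.
have l0 : 0 <= l by have /andP[] := f01 0; exact: le_trans.
have vT s y : 0 < s -> ((v s y)%:E <= T s f y)%E.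
  move=> s0; rewrite -(mild_eq vf y s0) leeDl//.
  apply: integral_ge0 => u; rewrite /= in_itv/= => /andP[u0 us].
  by apply: stable_semigroup_ge0 => [|z]; rewrite ?subr_gt0// powR_ge0.
have vl s y : 0 <= s -> v s y <= l.
  rewrite le_eqVlt => /predU1P[<-|s0].
    by rewrite (mild_initial vf); have /andP[] := f01 y.
  by rewrite -lee_fin; apply: le_trans (vT _ _ s0) (stable_semigroup_le _ s0 f01).
have vpow s y : 0 <= s -> v s y `^ (1 + beta) <= l `^ beta * v s y.
  move=> s0; have v0 := mild_ge0 vf y s0.
  rewrite powRD; last by rewrite gt_eqF ?addr_gt0.
  rewrite powRr1// mulrC ler_wpM2r//.
  by rewrite ge0_ler_powR ?nnegrE ?(ltW beta0)// vl.
split; first exact: vT.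
have fin : T t f x \is a fin_num.
  rewrite ge0_fin_numE; last exact: stable_semigroup_ge0.
  by apply: le_lt_trans (stable_semigroup_le _ t0 f01) _; exact: ltry.
have X : (\int[lebesgue_measure]_(s in `[0%R, t[)
     T (t - s)%R (fun y => v s y `^ (1 + beta))%R x <=
     (t * l `^ beta)%:E * T t f x)%E.
  apply: (@le_trans _ _ (\int[lebesgue_measure]_(s in `[0%R, t[)
     ((l `^ beta)%:E * T t f x))%E).
    apply: ge0_integral_mono => s; rewrite /= in_itv/= => /andP[s0 st].
      by apply: stable_semigroup_ge0 => [|z]; rewrite ?subr_gt0// powR_ge0.
    have ts0 : 0 < t - s by rewrite subr_gt0.
    (* the semigroup property requires [0 < s]; at [s = 0], [v] is [f] *)
    move: s0; rewrite le_eqVlt => /predU1P[s0|s0].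
      rewrite -s0 subr0 /stable_semigroup -ge0_integralZl//.
      - apply: ge0_integral_mono => y _; first by rewrite lee_fin mulr_ge0 ?powR_ge0 ?p0.
        rewrite -EFinM lee_fin mulrCA ler_wpM2l ?p0//.
        by rewrite -[in leRHS](mild_initial vf); exact: vpow.
      - apply/measurable_EFinP; apply: measurable_funM => //; exact: mpB.
      - by move=> y _; rewrite lee_fin mulr_ge0// p0.
      - by rewrite lee_fin powR_ge0.
    have -> : ((l `^ beta)%:E * T t f x = \int[leb]_y
        ((l `^ beta)%:E * ((p (t - s) (x - y))%:E * T s f y)))%E.
      rewrite ge0_integralZl//; first by rewrite stable_semigroupD// subrK.
      - apply: emeasurable_funM; first by apply/measurable_EFinP; exact: mpB.
        exact: measurable_stable_semigroup.
      - by move=> y _; rewrite mule_ge0 ?stable_semigroup_ge0// lee_fin p0.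
      - by rewrite lee_fin powR_ge0.
    apply: ge0_integral_mono => y _; first by rewrite lee_fin mulr_ge0 ?powR_ge0 ?p0.
    rewrite EFinM muleCA; apply: lee_wpmul2l; first by rewrite lee_fin p0.
    apply: (@le_trans _ _ ((l `^ beta)%:E * (v s y)%:E)%E).
      by rewrite -EFinM lee_fin vpow// ltW.
    by apply: lee_wpmul2l; [rewrite lee_fin powR_ge0|exact: vT].
  rewrite integral_cst//= lebesgue_measure_itv/= lte_fin t0 sube0.
  by rewrite EFinM muleC muleA.
have := mild_eq vf x t0; move: X.
set I := (\int[_]_(_ in _) _)%E => X E.
have T0 := stable_semigroup_ge0 x t0 f0.
move: fin X E T0; case: (T t f x) => // r _ X E T0.
have I0 : (0 <= I)%E.
  apply: integral_ge0 => u; rewrite /= in_itv/= => /andP[u0 us].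
  by apply: stable_semigroup_ge0 => [|z]; rewrite ?subr_gt0// powR_ge0.
move: X E; case: I I0 => // i i0; rewrite -EFinM -EFinD lee_fin => X [] E.
rewrite -EFinM lee_fin; rewrite !lee_fin in i0 T0.
by have := ler_wpM2r T0 tl; lra.
Qed.
End semigroup.

(** * Products of independent variables *)

Section independent_product.
Context {dW : measure_display} {W : measurableType dW} {R : realType}.
Variable Q : probability W R.

(** Layer cake: [T] is the integral over [u] in [0, 1] of the indicators of its
    superlevel sets, so by Tonelli's theorem the integrals of [Z] over these sets
    determine that of [Z * T]. *)
Lemma integral_mul_layer_cake (Z T : W -> R) (c : \bar R) :
  measurable_fun setT Z -> measurable_fun setT T ->
  (forall w, 0 <= Z w) -> (forall w, 0 <= T w <= 1) -> (0 <= c)%E ->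
  (forall u : R, \int[Q]_w (Z w * \1_(T @^-1` `]u, +oo[) w)%:E =
     c * Q (T @^-1` `]u, +oo[))%E ->
  (\int[Q]_w (Z w * T w)%:E = c * \int[Q]_w (T w)%:E)%E.
Proof.
move=> mZ mT Z0 T01 c0 H.
pose D : set R := `[0, 1]%classic.
pose F (z : W * measurableTypeR R) : \bar R :=
  (\1_D z.2 * \1_[set y : W * R | y.2 < T y.1] z)%:E.
have layer w : (\int[lebesgue_measure]_u F (w, u) = (T w)%:E)%E.
  have /andP[t0 t1] := T01 w.
  rewrite (_ : (fun u => F (w, u)) = (fun u => (\1_(`[0, T w[%classic) u)%:E)).
    by rewrite integral_indic//= setIT lebesgue_measure_itv/= lte_fin;
      move: t0; rewrite le_eqVlt => /predU1P[<-|->]; rewrite ?ltxx ?sube0.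
  apply/funext => u; rewrite /F !indicE -natrM mulnb; congr ((nat_of_bool _)%:R%:E).
  apply/andP/idP => [[/set_mem h1 /set_mem /= h2]|/set_mem /= h].
    by apply/mem_set; move: h1; rewrite /D /= !in_itv/= => /andP[-> _].
  move: h; rewrite in_itv/= => /andP[u0 ut].
  by split; apply/mem_set; rewrite /D /= ?in_itv/= ?u0 ?(le_trans (ltW ut)).
have F0 z : (0 <= F z)%E by rewrite lee_fin mulr_ge0.
have mlt : measurable [set y : W * measurableTypeR R | (y.2 < T y.1)%R].
  pose h (y : W * measurableTypeR R) := T y.1 - y.2.
  have mh : measurable_fun setT h.
    by apply: measurable_funB => //; exact: measurableT_comp mT measurable_fst.
  rewrite (_ : [set y | _] = setT `&` h @^-1` `]0, +oo[%classic).
    exact: mh.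
  by rewrite setTI; apply/seteqP; split => y /=; rewrite in_itv/= andbT subr_gt0.
have mF : measurable_fun setT F.
  apply/measurable_EFinP/measurable_funM; last exact: measurable_indic.
  have mD : measurable_fun setT (\1_D : R -> R) by apply: measurable_indic; exact: measurable_itv.
  exact: measurableT_comp mD measurable_snd.
have mTu u : measurable (T @^-1` `]u, +oo[%classic).
  by rewrite -[X in measurable X]setTI; exact: mT.
have swap (Y : W -> R) : measurable_fun setT Y -> (forall w, 0 <= Y w) ->
    (\int[Q]_w (Y w * T w)%:E =
     \int[lebesgue_measure]_u ((\1_D u)%:E * \int[Q]_w (Y w * \1_(T @^-1` `]u, +oo[) w)%:E))%E.
  move=> mY Y0.
  pose G (z : W * measurableTypeR R) : \bar R := ((Y z.1)%:E * F z)%E.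
  have G0 z : (0 <= G z)%E by rewrite mule_ge0// lee_fin.
  have mG : measurable_fun setT G.
    apply: emeasurable_funM => //; apply/measurable_EFinP.
    exact: measurableT_comp mY measurable_fst.
  transitivity (\int[Q]_w \int[lebesgue_measure]_u G (w, u))%E.
    apply: eq_integral => w _; rewrite /G /= ge0_integralZl//; last 2 first.
    - by apply: (measurableT_comp mF); exact: pair1_measurable.
    - by rewrite lee_fin.
    by rewrite layer EFinM.
  rewrite (fubini_tonelli G mG G0); apply: eq_integral => u _.
  have mYu : measurable_fun setT (fun w => (Y w * \1_(T @^-1` `]u, +oo[) w)%:E).
    by apply/measurable_EFinP/measurable_funM => //; exact: measurable_indic.
  have Yu0 w : setT w -> (0 <= (Y w * \1_(T @^-1` `]u, +oo[) w)%:E)%E.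
    by rewrite lee_fin mulr_ge0.
  have D0 : (0 <= (\1_D u : R)%:E)%E by rewrite lee_fin.
  rewrite -(ge0_integralZl _ measurableT mYu Yu0 D0).
  apply: eq_integral => w _; rewrite /G /F /= -!EFinM; congr EFin.
  rewrite mulrCA; congr (_ * (_ * _)); rewrite !indicE; congr ((nat_of_bool _)%:R).
  by apply/idP/idP; rewrite !inE /= in_itv/= andbT.
have mQ : measurable_fun setT (fun u : R => Q (T @^-1` `]u, +oo[%classic)).
  rewrite (_ : (fun u => _) =
      (fun u => \int[Q]_w (\1_[set y : W * R | y.2 < T y.1] (w, u))%:E)%E).
    apply: (measurable_fun_fubini_tonelli_G (m1 := Q)
      (fun z : W * measurableTypeR R => (\1_[set y : W * R | y.2 < T y.1] z)%:E)).
      by apply/measurable_EFinP; exact: measurable_indic.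
    by move=> z; rewrite lee_fin.
  apply/funext => u; rewrite -[in LHS](setIT (T @^-1` _)) -integral_indic//.
  apply: eq_integral => w _; rewrite !indicE; congr ((nat_of_bool _)%:R%:E).
  by apply/idP/idP; rewrite !inE /= in_itv/= andbT.
rewrite swap//; under eq_integral do rewrite H muleCA.
rewrite ge0_integralZl//; last 2 first.
- apply: emeasurable_funM.
    by apply/measurable_EFinP; apply: measurable_indic; exact: measurable_itv.
  exact: mQ.
- by move=> u _; rewrite mule_ge0// lee_fin.
congr (_ * _)%E.
transitivity (\int[Q]_w (1 * T w)%:E)%E; last by apply: eq_integral => w _; rewrite mul1r.
rewrite swap//; apply: eq_integral => u _; congr (_ * _)%E.
under [RHS]eq_integral do rewrite mul1r.
by rewrite integral_indic// setIT.
Qed.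

(** The factors are integrated one at a time. The induction hypothesis carries an
    event [A D] on the variables that have not yet been treated; applied to
    superlevel sets of the next one, it feeds [integral_mul_layer_cake]. *)
Lemma integral_prod_independent n (T : nat -> W -> R) :
  (forall i, measurable_fun setT (T i)) -> (forall i w, 0 <= T i w <= 1) ->
  (forall D : nat -> set R, (forall i, measurable (D i)) ->
     Q (\bigcap_(i in `I_n) T i @^-1` D i) = \prod_(i < n) Q (T i @^-1` D i))%E ->
  (\int[Q]_w (\prod_(i < n) T i w)%:E = \prod_(i < n) \int[Q]_w (T i w)%:E)%E.
Proof.
move=> mT T01 ind.
pose A (D : nat -> set R) : set W := \bigcap_(i in `I_n) T i @^-1` D i.
have mpre i (D : set R) : measurable D -> measurable (T i @^-1` D).
  by move=> mD; rewrite -[X in measurable X]setTI; exact: mT.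
have mA D : (forall i, measurable (D i)) -> measurable (A D).
  by move=> mD; apply: bigcap_measurableType => i _; exact: mpre.
have T0 i w : 0 <= T i w by have /andP[] := T01 i w.
have claim m : (m <= n)%N -> forall D : nat -> set R, (forall i, measurable (D i)) ->
    (forall i, (i < m)%N -> D i = setT) ->
    (\int[Q]_w (\prod_(i < m) T i w * \1_(A D) w)%:E =
     \prod_(i < m) \int[Q]_w (T i w)%:E * Q (A D))%E.
  elim: m => [_ D mD _|m IH mn D mD DT].
    under eq_integral do rewrite big_ord0 mul1r.
    by rewrite integral_indic ?setIT ?big_ord0 ?mul1e//; exact: mA.
  pose Du u i : set R := if i == m then `]u, +oo[%classic else D i.
  have mDu u i : measurable (Du u i) by rewrite /Du; case: ifP.
  have DuT u i : (i < m)%N -> Du u i = setT.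
    by move=> im; rewrite /Du ltn_eqF// DT// ltnS ltnW.
  have DmT : D m = setT by exact: DT.
  have DuM u : Du u m = `]u, +oo[%classic by rewrite /Du eqxx.
  have QDu u : Q (A (Du u)) = (Q (A D) * Q (T m @^-1` `]u, +oo[))%E.
    rewrite /A !ind// (bigD1 (Ordinal mn))//= [in RHS](bigD1 (Ordinal mn))//= DmT.
    rewrite preimage_setT [X in ((X * _) * _)%E]probability_setT mul1e muleC DuM.
    congr (_ * _)%E; apply: eq_bigr => i im; rewrite /Du ifN//.
  transitivity (\int[Q]_w (\prod_(i < m) T i w * \1_(A D) w * T m w)%:E)%E.
    by apply: eq_integral => w _; rewrite big_ord_recr/= mulrAC.
  rewrite (integral_mul_layer_cake
      (c := (\prod_(i < m) \int[Q]_w (T i w)%:E * Q (A D))%E)) //.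
  - by rewrite big_ord_recr/= muleAC.
  - apply: measurable_funM; first by apply: measurable_prod => i _; exact: mT.
    by apply: measurable_indic; exact: mA.
  - by move=> w; rewrite mulr_ge0// prodr_ge0.
  - rewrite mule_ge0// prode_ge0// => i _.
    by apply: integral_ge0 => w _; rewrite lee_fin.
  - move=> u; rewrite -muleA -QDu -(IH (ltnW mn) _ (mDu u) (DuT u)).
    apply: eq_integral => w _; rewrite -mulrA; congr (_ * _)%:E.
    rewrite !indicE -natrM mulnb; congr ((nat_of_bool _)%:R).
    apply/andP/idP => [[/set_mem AD /set_mem Tm]|/set_mem ADu].
      apply/mem_set => i ni; rewrite /Du /=; case: eqP => [->//|_]; exact: AD.
    have := ADu m mn; rewrite /Du /= eqxx => Tm; split; apply/mem_set => // i ni.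
    by have := ADu i ni; rewrite /Du /=; case: eqP => // ->; rewrite DmT.
have := claim n (leqnn n) (fun=> setT) (fun=> measurableT) (fun _ _ => erefl).
rewrite (_ : A _ = setT) ?probability_setT ?mule1 => [<-|].
  by apply: eq_integral => w _; rewrite indicT mulr1.
by rewrite /A; apply/seteqP; split.
Qed.
End independent_product.

(** * Laplace functional and mean of the mass of a set *)

Lemma ge0_integral_eq_law {d1 d2} {S1 : measurableType d1} {S2 : measurableType d2}
    {R : realType} (Q1 : {measure set S1 -> \bar R}) (Q2 : {measure set S2 -> \bar R})
    (U1 : S1 -> \bar R) (U2 : S2 -> \bar R) (h : \bar R -> \bar R) :
  measurable_fun setT U1 -> measurable_fun setT U2 ->
  (forall D, measurable D -> Q1 (U1 @^-1` D) = Q2 (U2 @^-1` D)) ->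
  measurable_fun setT h -> (forall y, 0 <= h y)%E ->
  (\int[Q1]_w h (U1 w) = \int[Q2]_w h (U2 w))%E.
Proof.
move=> mU1 mU2 law mh h0.
have := @ge0_integral_pushforward _ _ _ _ R _ mU1 Q1 setT h measurableT mh (fun y _ => h0 y).
have := @ge0_integral_pushforward _ _ _ _ R _ mU2 Q2 setT h measurableT mh (fun y _ => h0 y).
rewrite !preimage_setT => <- <-; apply: eq_measure_integral => D mD _; exact: law.
Qed.

Section mass.
Context {R : realType} {d : nat}.
Local Notation M := (finite_measure_rV R d).

Lemma measures_measurable_mass (B : set 'rV[R]_d) (D : set (\bar R)) :
  measurable B -> measurable D -> measures_measurable [set m : M | D (m B)].
Proof. by move=> mB mD; apply: sub_sigma_algebra; exists B => //; exists D. Qed.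

Lemma paths_measurable_mass (t : R) (B : set 'rV[R]_d) (D : set (\bar R)) :
  0 <= t -> measurable B -> measurable D ->
  paths_measurable [set x : R -> M | D (x t B)].
Proof.
move=> t0 mB mD; apply: sub_sigma_algebra; exists t => //.
by exists [set m : M | D (m B)] => //; exact: measures_measurable_mass.
Qed.

Lemma measurable_mass {dS} {S : measurableType dS} (Z : S -> M) (B : set 'rV[R]_d) :
  (forall C, measures_measurable C -> measurable (Z @^-1` C)) ->
  measurable B -> measurable_fun setT (fun s => Z s B).
Proof.
move=> mZ mB _ D mD; rewrite setTI.
exact: (mZ _ (measures_measurable_mass mB mD)).
Qed.
End mass.

Section superprocess_moments.
Context {R : realType} {d : nat} (alpha beta : R) (p : R -> 'rV[R]_d -> R).
Context {dO : measure_display} {Omega : measurableType dO}.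
Local Notation M := (finite_measure_rV R d).
Variables (P : M -> probability Omega R) (xi : R -> Omega -> M).
Hypotheses (pst : stable_transition_density alpha p) (beta0 : 0 < beta).
Hypothesis super : superprocess p beta P xi.
Variables (t : R) (B : set 'rV[R]_d).
Hypotheses (t0 : 0 < t) (mB : measurable B).

(** The expected mass in [B] at time [t] for the underlying motion without
    branching, started at [mu]. *)
Definition semigroup_mass (mu : {measure set 'rV[R]_d -> \bar R}) : \bar R :=
  (\int[mu]_x stable_semigroup p t (\1_B) x)%E.

Let indic_ge0 (y : 'rV[R]_d) : 0 <= \1_B y :> R. Proof. by []. Qed.

Let m1B : measurable_fun setT (\1_B : 'rV[R]_d -> R).
Proof. exact: measurable_indic. Qed.

Lemma measurable_semigroup_indic : measurable_fun setT (stable_semigroup p t (\1_B)).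
Proof. exact: (measurable_stable_semigroup pst). Qed.

Lemma semigroup_indic_ge0 x : (0 <= stable_semigroup p t (\1_B) x)%E.
Proof. exact: (stable_semigroup_ge0 pst). Qed.

Lemma measurable_xi_mass : measurable_fun setT (fun w => xi t w B).
Proof. by apply: measurable_mass => // C mC; apply: (super_measurable super) => //; exact: ltW. Qed.

(** [V] is the integral of [v t] against [mu], for the solution [v] started at
    [l 1_B], which [mild_solution_bounds] compares with [l T_t 1_B]. *)
Lemma laplace_mass (l : R) (mu : M) : 0 < l -> t * l `^ beta <= 2^-1 ->
  exists V : R, [/\ 0 <= V,
    (\int[P mu]_w (expR (- (l * fine (xi t w B))))%:E = (expR (- V))%:E)%E,
    (V%:E <= l%:E * semigroup_mass mu)%E &
    (l%:E * semigroup_mass mu <= 2%:E * V%:E)%E].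
Proof.
move=> l0 tl; pose f (x : 'rV[R]_d) := l * \1_B x.
have mf : measurable_fun setT f by exact: measurable_funM.
have f01 y : 0 <= f y <= l.
  rewrite /f indicE; case: (_ \in _); rewrite ?mulr1 ?mulr0 ?lexx ?andbT//=; exact: ltW.
have f0 y : 0 <= f y by have /andP[] := f01 y.
have [|v vf lap] := super_laplace super mf f0.
  by exists l => y; have /andP[] := f01 y.
have v0 x : 0 <= v t x by apply: (mild_ge0 vf); exact: ltW.
have [bd1 bd2] : (forall x, (v t x)%:E <= stable_semigroup p t f x)%E /\
    (forall x, stable_semigroup p t f x <= 2%:E * (v t x)%:E)%E.
  by split=> x; have [] := mild_solution_bounds pst x beta0 mf f01 vf t0 tl.
have Tf x : stable_semigroup p t f x = (l%:E * stable_semigroup p t (\1_B) x)%E.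
  rewrite /stable_semigroup -ge0_integralZl//.
  - by apply: eq_integral => y _; rewrite -EFinM /f; congr EFin; ring.
  - apply/measurable_EFinP; apply: measurable_funM => //.
    apply: (measurableT_comp (measurable_stable pst t0)); exact: measurable_fun_rVB.
  - by move=> y _; rewrite lee_fin mulr_ge0// (stable_ge0 pst).
  - by rewrite lee_fin ltW.
have mv : measurable_fun setT (v t).
  have mD : measurable [set z : R * 'rV[R]_d | 0 <= z.1].
    rewrite (_ : [set z | _] = setT `&` fst @^-1` `[0, +oo[%classic); last first.
      by rewrite setTI; apply/seteqP; split => z /=; rewrite in_itv/= andbT.
    exact: measurable_fst.
  have mt : measurable_fun setT (fun x : 'rV[R]_d => (t, x)) by exact: pair1_measurable.
  apply: (measurable_comp (f := fun z : R * 'rV[R]_d => v z.1 z.2) mD _ (mild_measurable vf) mt).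
  by move=> _ [x _ <-] /=; exact: ltW.
have lS : (\int[mu]_x (l%:E * stable_semigroup p t (\1_B) x) = l%:E * semigroup_mass mu)%E.
  rewrite ge0_integralZl//.
  - exact: measurable_semigroup_indic.
  - by move=> x _; exact: semigroup_indic_ge0.
  - by rewrite lee_fin ltW.
have vl x : v t x <= l.
  by rewrite -lee_fin; apply: le_trans (bd1 x) (stable_semigroup_le pst x t0 f01).
have iv : mu.-integrable setT (EFin \o v t).
  apply: (dominated_integrable (g := cst l) mv) => [|x].
    exact: finite_measure_integrable_cst.
  by rewrite ger0_norm.
have VE : (\int[mu]_x (v t x)%:E = (\int[mu]_x v t x)%:E)%E.
  by rewrite /Rintegral fineK//; exact: (integrable_fin_num _ iv).
exists (\int[mu]_x v t x); split.
- exact: Rintegral_ge0.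
- rewrite -(lap mu t (ltW t0)) unlock; apply: eq_integral => w _.
  congr (expR (- _))%:E; rewrite /f RintegralZl//; last first.
    by apply: integrable_indic => //; exact: fin_num_measure.
  by rewrite /Rintegral integral_indic// setIT.
- rewrite -VE -lS; apply: ge0_integral_mono => x _; first by rewrite lee_fin.
  by rewrite -Tf.
- rewrite -lS -VE -ge0_integralZl//; last 2 first.
  - exact/measurable_EFinP.
  - by move=> x _; rewrite lee_fin.
  apply: ge0_integral_mono => x _; last by rewrite -Tf.
  by rewrite mule_ge0 ?semigroup_indic_ge0// lee_fin ltW.
Qed.

Lemma small_laplace_parameter : exists2 l : R, 0 < l & t * l `^ beta <= 2^-1.
Proof.
exists ((2 * t)^-1 `^ beta^-1); first by rewrite powR_gt0// invr_gt0 mulr_gt0.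
rewrite -powRrM mulVf ?gt_eqF// powRr1 ?invr_ge0 ?mulr_ge0 ?(ltW t0)//.
by rewrite invfM mulrCA divff ?mulr1// gt_eqF.
Qed.

(** [x / (1 + l x) <= (1 - exp (- l x)) / l], whose mean for [x = xi t w B] is at
    most [V / l <= semigroup_mass mu]; the left-hand side increases to [x] as [l]
    decreases to [0]. *)
Lemma mean_mass_le (mu : M) : (\int[P mu]_w xi t w B <= semigroup_mass mu)%E.
Proof.
have [l0 l00 tl0] := small_laplace_parameter.
pose l k : R := l0 / k.+1%:R.
have l_gt0 k : 0 < l k by rewrite divr_gt0.
have l_le k : l k <= l0.
  by rewrite ler_pdivrMr// ler_peMr ?(ltW l00)// ler1n.
have tl k : t * l k `^ beta <= 2^-1.
  apply: le_trans tl0; rewrite ler_wpM2l ?(ltW t0)//.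
  by rewrite ge0_ler_powR ?nnegrE ?(ltW beta0) ?(ltW (l_gt0 k)) ?(ltW l00).
pose N w : R := fine (xi t w B).
have N0 w : 0 <= N w by exact: fine_ge0.
have NE w : (N w)%:E = xi t w B by rewrite fineK// fin_num_measure.
have mN : measurable_fun setT N.
  by apply: measurableT_comp measurable_xi_mass; exact: fine_measurable.
have D0 k w : 0 < 1 + l k * N w.
  by rewrite ltr_pwDl// mulr_ge0// ltW.
pose g k w : \bar R := (N w / (1 + l k * N w))%:E.
have g0 k w : setT w -> (0 <= g k w)%E.
  by move=> _; rewrite lee_fin divr_ge0// ltW.
have mg k : measurable_fun setT (g k).
  apply/measurable_EFinP; apply: measurable_funM => //.
  rewrite (_ : (fun w => _) = (fun w => (1 + l k * N w) `^ (-1))); last first.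
    by apply/funext => w; rewrite powR_inv1// ltW.
  apply: (measurableT_comp (measurable_powR (-1))).
  by apply: measurable_funD => //; exact: measurable_funM.
have ndg w : setT w -> {homo g^~ w : i j / (i <= j)%N >-> (i <= j)%E}.
  move=> _ i j ij; rewrite lee_fin ler_wpM2l// lef_pV2 ?posrE// lerD2l ler_wpM2r//.
  by rewrite ler_wpM2l ?(ltW l00)// lef_pV2 ?posrE// ler_nat ltnS.
have limg w : limn (g^~ w) = xi t w B.
  apply/cvg_lim => //; rewrite -NE; apply: cvg_EFin; first exact: nearW.
  rewrite -[X in _ --> X]divr1; apply: cvgMl_tmp.
  rewrite -[X in X^-1]addr0; apply: cvgV; first by rewrite addr0.
  apply: cvgD; first exact: cvg_cst.
  rewrite -[X in _ --> X](mul0r (N w)); apply: cvgMr_tmp.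
  by rewrite -[X in _ --> X](mulr0 l0); apply: cvgMl_tmp; exact: cvg_harmonic.
have cvg := @cvg_monotone_convergence _ _ _ (P mu) _ measurableT _ mg g0 ndg.
rewrite (_ : (\int[P mu]_w xi t w B)%E = \int[P mu]_w limn (g^~ w))%E; last first.
  by apply: eq_integral => w _; rewrite limg.
apply: (cvge_to_le cvg); apply: nearW => k.
have [V [V0 VE V1 _]] := laplace_mass mu (l_gt0 k) (tl k).
have me : measurable_fun setT (fun w => - expR (- (l k * N w))).
  apply: measurableT_comp => //; apply: measurableT_comp => //.
  by apply: measurableT_comp => //; exact: measurable_funM.
have e1 w : `|- expR (- (l k * N w))| <= 1.
  by rewrite normrN ger0_norm ?expR_ge0// expR_le1 oppr_le0 mulr_ge0// ltW.
have int1 : (\int[P mu]_w (1%R)%:E = 1)%E.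
  by rewrite integral_cst// mul1e; exact: probability_setT.
have defect : (\int[P mu]_w (1 - expR (- (l k * N w)))%:E <= V%:E)%E.
  have := integral_1D_density (mu := P mu) (g := cst 1) (fun _ => ler01)
    (measurable_cst _) int1 me e1.
  under eq_integral do rewrite mulr1.
  move=> ->; rewrite lee_fin.
  have -> : \int[P mu]_w (- expR (- (l k * N w)) * cst 1 w) = - expR (- V).
    transitivity (\int[P mu]_w (-1 * expR (- (l k * N w)))).
      by apply: eq_Rintegral => w _; rewrite mulr1 mulN1r.
    rewrite RintegralZl//; first by rewrite {1}/Rintegral VE mulN1r.
    apply: (dominated_integrable (g := cst 1)) => [||w].
    - by apply: measurableT_comp => //; apply: measurableT_comp => //; exact: measurable_funM.
    - exact: finite_measure_integrable_cst.
    - by rewrite -normrN.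
  by have := expR_ge1Dx (- V); lra.
apply: (@le_trans _ _ ((l k)^-1%:E * V%:E)%E); last first.
  apply: (@le_trans _ _ ((l k)^-1%:E * ((l k)%:E * semigroup_mass mu))%E).
    by apply: lee_wpmul2l V1; rewrite lee_fin invr_ge0 ltW.
  by rewrite muleA -EFinM mulVf ?mul1e// gt_eqF.
apply: (@le_trans _ _ ((l k)^-1%:E * \int[P mu]_w (1 - expR (- (l k * N w)))%:E)%E); last first.
  by apply: lee_wpmul2l defect; rewrite lee_fin invr_ge0 ltW.
have il0 : (0 <= (l k)^-1%:E)%E by rewrite lee_fin invr_ge0 ltW.
rewrite -ge0_integralZl//; last 2 first.
- by apply/measurable_EFinP; exact: measurable_funD.
- by move=> w _; rewrite lee_fin subr_ge0 expR_le1 oppr_le0 mulr_ge0// ltW.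
apply: ge0_integral_mono => w _; first exact: g0.
have x0 : 0 <= l k * N w by rewrite mulr_ge0// ltW.
rewrite -EFinM lee_fin -(ler_pM2l (l_gt0 k)) !mulrA divff ?gt_eqF// mul1r.
exact: one_sub_expRN_ge.
Qed.
End superprocess_moments.

(** * Infinite initial measures *)

Section copies.
Context {R : realType} {d : nat} (alpha beta : R) (p : R -> 'rV[R]_d -> R).
Context {dO : measure_display} {Omega : measurableType dO}.
Local Notation M := (finite_measure_rV R d).
Variables (P : M -> probability Omega R) (xi : R -> Omega -> M).
Hypotheses (pst : stable_transition_density alpha p) (beta0 : 0 < beta).
Hypothesis super : superprocess p beta P xi.
Context {dW : measure_display} {W : measurableType dW} (Q : probability W R).
Variables (mu : {measure set 'rV[R]_d -> \bar R})
  (X : R -> W -> {measure set 'rV[R]_d -> \bar R}).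
Variables (mu_ : nat -> M) (Y : nat -> R -> W -> M).
Hypothesis muE : forall B, measurable B -> (mu B = \sum_(0 <= i <oo) mu_ i B)%E.
Hypothesis copies : independent_copies Q P xi mu_ Y.
Hypothesis XE : forall (t : R) w B, 0 <= t -> measurable B ->
  (X t w B = \sum_(0 <= i <oo) Y i t w B)%E.
Variables (t : R) (B : set 'rV[R]_d).
Hypotheses (t0 : 0 < t) (mB : measurable B).
Local Notation S := (semigroup_mass p t B).

Lemma measurable_copy_mass i : measurable_fun setT (fun w => Y i t w B).
Proof.
apply: measurable_mass => // C mC.
by apply: (copies_measurable copies) => //; exact: ltW.
Qed.

Lemma measurable_X_mass : measurable_fun setT (fun w => X t w B).
Proof.
rewrite (_ : (fun w => _) = (fun w => \sum_(0 <= i <oo) Y i t w B)%E).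
  by apply: ge0_emeasurable_sum => [i w _ _|i _]; [|exact: measurable_copy_mass].
by apply/funext => w; rewrite XE// ltW.
Qed.

Lemma integral_copy_mass i (h : \bar R -> \bar R) :
  measurable_fun setT h -> (forall y, 0 <= h y)%E ->
  (\int[Q]_w h (Y i t w B) = \int[P (mu_ i)]_w h (xi t w B))%E.
Proof.
move=> mh h0; apply: ge0_integral_eq_law => //.
- exact: measurable_copy_mass.
- exact: (measurable_xi_mass super).
- move=> D mD.
  exact: (copies_law copies i (paths_measurable_mass (ltW t0) mB mD)).
Qed.

Lemma semigroup_massE : (S mu = \sum_(0 <= i <oo) S (mu_ i))%E.
Proof.
rewrite /semigroup_mass.
transitivity (\int[mseries mu_ 0]_x stable_semigroup p t (\1_B) x)%E.
  by apply: eq_measure_integral => A mA _; rewrite muE.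
apply: ge0_integral_measure_series => //.
  by move=> x _; exact: (semigroup_indic_ge0 pst).
exact: (measurable_semigroup_indic pst).
Qed.

Lemma mean_X_mass_le : (\int[Q]_w X t w B <= S mu)%E.
Proof.
rewrite semigroup_massE.
rewrite (_ : (\int[Q]_w X t w B)%E = \int[Q]_w \sum_(0 <= i <oo) Y i t w B)%E; last first.
  by apply: eq_integral => w _; rewrite XE// ltW.
rewrite integral_nneseries//; last by move=> i; exact: measurable_copy_mass.
apply: lee_nneseries => [i _ _|i _]; first exact: integral_ge0.
(* the absolute value, to have a function nonnegative on all extended reals *)
pose h (y : \bar R) := `|y|%E.
have -> : (\int[Q]_w Y i t w B = \int[Q]_w h (Y i t w B))%E.
  by apply: eq_integral => w _; rewrite /h gee0_abs.
have mh : measurable_fun setT h by exact: abse_measurable.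
rewrite (integral_copy_mass i mh); last by move=> y; exact: abse_ge0.
rewrite (_ : (\int[_]_w h _)%E = \int[P (mu_ i)]_w xi t w B)%E.
  exact: (mean_mass_le pst beta0 super t0 mB).
by apply: eq_integral => w _; rewrite /h gee0_abs.
Qed.

(** If [X_t(B) <= K] with positive probability, then by independence
    [prod_(i < k) E exp (- l Y_i(B)) = exp (- sum_(i < k) V_i)] stays away from
    [0], so the sum of the [V_i], and with it [S mu], is finite. *)
Lemma semigroup_mass_finite :
  {ae Q, forall w, (X t w B < +oo)%E} -> (S mu < +oo)%E.
Proof.
move=> Xfin.
have mX := measurable_X_mass.
have mle (K : nat) : measurable [set w | (X t w B <= K%:R%:E)%E].
  rewrite -[X in measurable X]setTI; apply: emeasurable_fun_infty_c => //.
(* [X_t(B)] is finite almost surely, so some bound [K] has positive probability *)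
have [K QK] : exists K : nat, (0 < Q [set w | (X t w B <= K%:R%:E)%E])%E.
  apply: contrapT => /forallNP H.
  have H0 K : Q [set w | (X t w B <= K%:R%:E)%E] = 0.
    by apply/eqP; rewrite eq_le measure_ge0 andbT leNgt; apply/negP; exact: H.
  have neg : Q.-negligible (\bigcup_K [set w | (X t w B <= K%:R%:E)%E]).
    apply: negligible_bigcup => K; exists [set w | (X t w B <= K%:R%:E)%E].
    by split => //; exact: H0.
  have all : Q.-negligible setT.
    apply: negligibleS (negligibleU Xfin neg) => w _.
    have [Xw|Xw] := pselect ((X t w B < +oo)%E); last by left.
    right; have fX : X t w B \is a fin_num by rewrite ge0_fin_numE.
    exists (Num.truncn (fine (X t w B))).+1 => //=.
    by rewrite -(fineK fX) lee_fin ltW// truncnS_gt.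
  have := measure_negligible measurableT all.
  by rewrite [LHS]probability_setT => /eqP; rewrite gt_eqF.
have [l l0 tl] := small_laplace_parameter beta0 t0.
pose T i w : R := expR (- (l * fine (Y i t w B))).
have Y0 i w : 0 <= fine (Y i t w B) by exact: fine_ge0.
have T01 i w : 0 <= T i w <= 1.
  by rewrite expR_ge0 expR_le1 oppr_le0 mulr_ge0// ltW.
pose h (y : \bar R) : R := expR (- (l * fine y)).
have mh : measurable_fun setT h.
  apply: measurableT_comp => //; apply: measurableT_comp => //.
  by apply: measurable_funM => //; exact: fine_measurable.
have mT i : measurable_fun setT (T i).
  exact: (measurableT_comp mh (measurable_copy_mass i)).
have lap i : exists V : R, [/\ 0 <= V, (\int[Q]_w (T i w)%:E = (expR (- V))%:E)%E &
    (l%:E * S (mu_ i) <= 2%:E * V%:E)%E].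
  have [V [V0 VE _ V2]] := laplace_mass pst beta0 super t0 mB (mu_ i) l0 tl.
  exists V; split => //; rewrite -VE.
  have mhE : measurable_fun setT (fun y => (h y)%:E) by exact/measurable_EFinP.
  apply: (integral_copy_mass i mhE) => y; by rewrite lee_fin expR_ge0.
have /choice[V HV] := lap.
have V0 i : 0 <= V i by have [] := HV i.
pose q := fine (Q [set w | (X t w B <= K%:R%:E)%E]).
have QE : Q [set w | (X t w B <= K%:R%:E)%E] = q%:E.
  by rewrite fineK// fin_num_measure.
have q0 : 0 < q by rewrite -lte_fin -QE.
pose e := expR (- (l * K%:R)) * q.
have e0 : 0 < e by rewrite mulr_gt0// expR_gt0.
have prod_lower k : e <= expR (- \sum_(i < k) V i).
  have ind (D : nat -> set R) : (forall i, measurable (D i)) ->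
      (Q (\bigcap_(i in `I_k) T i @^-1` D i) = \prod_(i < k) Q (T i @^-1` D i))%E.
    move=> mD.
    have mG i : paths_measurable [set x : R -> M | (h @^-1` D i) (x t B)].
      apply: paths_measurable_mass; [exact: ltW|by []|].
      by rewrite -[X in measurable X]setTI; exact: mh.
    exact: (copies_independent copies k mG).
  have := integral_prod_independent mT T01 ind.
  rewrite (_ : (\prod_(i < k) _)%E = (expR (- \sum_(i < k) V i))%:E); last first.
    rewrite -sumrN expR_sum -prodEFin; apply: eq_bigr => i _.
    by have [] := HV i.
  move=> E; rewrite -lee_fin -E.
  apply: (@le_trans _ _ (\int[Q]_w ((expR (- (l * K%:R)))%:E *
      (\1_[set w | (X t w B <= K%:R%:E)%E] w)%:E))%E).
    rewrite ge0_integralZl//; last by apply/measurable_EFinP; exact: measurable_indic.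
    by rewrite integral_indic// setIT [X in (_ * X)%E]QE -EFinM.
  apply: ge0_integral_mono => w _; first by rewrite -EFinM lee_fin mulr_ge0// expR_ge0.
  rewrite -EFinM lee_fin indicE; case: (boolP (w \in _)) => [/set_mem /= Xw|_]; last first.
    by rewrite mulr0 prodr_ge0// => i _; have /andP[] := T01 i w.
  rewrite mulr1 -expR_sum ler_expR sumrN lerN2 -mulr_sumr ler_wpM2l ?(ltW l0)//.
  rewrite -lee_fin; apply: le_trans Xw; rewrite XE ?(ltW t0)//.
  rewrite -sumEFin; under eq_bigr do rewrite fineK ?fin_num_measure//.
  rewrite -(big_mkord xpredT (fun i => Y i t w B)).
  exact: nneseries_lim_ge.
have V_upper k : \sum_(i < k) V i <= - ln e.
  rewrite lerNr -[leRHS]expRK ler_ln ?posrE ?expR_gt0//; exact: prod_lower.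
rewrite semigroup_massE; apply: (@le_lt_trans _ _ (2 / l * - ln e)%:E); last exact: ltry.
apply: lime_le; first by apply: is_cvg_nneseries => i _ _; apply: integral_ge0 => x _;
  exact: (semigroup_indic_ge0 pst).
apply: nearW => k; rewrite big_mkord.
apply: (@le_trans _ _ (\sum_(i < k) (2 / l * V i)%:E)%E); last first.
  rewrite sumEFin lee_fin -mulr_sumr ler_wpM2l ?V_upper//.
  by rewrite divr_ge0// ltW.
apply: lee_sum => i _; have [_ _ h2] := HV i.
have il : (0 <= l^-1%:E)%E by rewrite lee_fin invr_ge0 ltW.
have := lee_wpmul2l il h2; rewrite muleA -EFinM mulVf ?gt_eqF// mul1e -!EFinM.
by rewrite mulrA (mulrC l^-1).
Qed.
End copies.

(** * Boundedness and integrability of the density *)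

Section bounded_sets.
Context {R : realType} {n : nat}.

Lemma coord_le_norm (x : 'rV[R]_n) i : `|x ord0 i| <= `|x|.
Proof.
rewrite [leRHS]mx_normrE.
exact: (le_bigmax _ (fun ij : 'I_1 * 'I_n => `|x ij.1 ij.2|) (ord0, i)).
Qed.

Lemma bounded_setP (B : set 'rV[R]_n) :
  bounded_set B <-> exists k : nat, B `<=` box (- k%:R) k%:R.
Proof.
split=> [[r [_ Br]]|[k Bk]].
  exists (Num.truncn `|r|).+2 => x Bx j; rewrite -ler_norml.
  apply: le_trans (coord_le_norm x j) (Br _ _ x Bx).
  apply: le_lt_trans (ler_norm r) (lt_trans (truncnS_gt _) _).
  by rewrite ltr_nat.
exists k%:R; split; first exact: num_real.
move=> r kr x Bx /=; rewrite [leLHS]mx_normrE.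
apply: bigmax_le => [|[i j] _ /=]; first by apply: le_trans (ltW kr).
by rewrite ord1; apply: le_trans (ltW kr); rewrite ler_norml; exact: Bk.
Qed.

Lemma bounded_dot (B : set 'rV[R]_n) : bounded_set B ->
  exists r : R, forall y, B y -> dot y y <= r ^+ 2.
Proof.
move=> /bounded_setP[k Bk]; exists (Num.sqrt n%:R * k%:R) => y By.
rewrite exprMn sqr_sqrtr//; apply: dot_le_box => j.
by rewrite ler_norml; exact: Bk.
Qed.

Lemma lebesgue_bounded (B : set 'rV[R]_n) : measurable B -> bounded_set B ->
  (lebesgue_rV n B < +oo)%E.
Proof.
move=> mB /bounded_setP[k Bk].
apply: (@le_lt_trans _ _ (lebesgue_rV n (box (- k%:R) k%:R))).
  by apply: le_measure => //; rewrite inE//; exact: measurable_box.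
by rewrite [X in (X < _)%E]lebesgue_box ?ltry// (@le_trans _ _ 0)// oppr_le0.
Qed.

Lemma locally_finite_box (m : {measure set 'rV[R]_n -> \bar R}) :
  (forall k : nat, m (box (- k%:R) k%:R) < +oo)%E -> locally_finite m.
Proof.
move=> mk B mB /bounded_setP[k Bk]; apply: le_lt_trans (mk k).
by apply: le_measure => //; rewrite inE//; exact: measurable_box.
Qed.
End bounded_sets.

Section semigroup_mass_density.
Context {R : realType} {n : nat} (alpha : R) (p : R -> 'rV[R]_n -> R).
Hypotheses (alpha0 : 0 < alpha) (alpha2 : alpha <= 2) (n0 : (0 < n)%N).
Hypothesis pst : stable_transition_density alpha p.
Variable mu : {measure set 'rV[R]_n -> \bar R}.
Local Notation leb := (lebesgue_rV n).

Let p0 t x : 0 < t -> 0 <= p t x. Proof. by move=> t0; exact: (stable_ge0 pst). Qed.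

Let integral_density_Zl (s C : R) : 0 < s -> 0 <= C ->
  (\int[mu]_x (C%:E * (p s x)%:E) = C%:E * \int[mu]_x (p s x)%:E)%E.
Proof.
move=> s0 C0; rewrite ge0_integralZl//.
- by apply/measurable_EFinP; exact: (measurable_stable pst s0).
- by move=> x _; rewrite lee_fin p0.
Qed.

(** For [y] in [B], [p t (x - y) <= C * p s x], so [T_t 1_B] is at most [C] times
    the volume of [B] times [p s]. *)
Lemma semigroup_mass_lty (t : R) (B : set 'rV[R]_n) :
  0 < t -> measurable B -> bounded_set B ->
  (forall s : R, 0 < s -> (\int[mu]_x (p s x)%:E < +oo)%E) ->
  (semigroup_mass p t B mu < +oo)%E.
Proof.
move=> t0 mB bB fin; have [r Br] := bounded_dot bB.
have [s s0 [C C0 pC]] := stable_comparison alpha0 n0 pst r alpha2 t0.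
have LB := lebesgue_bounded mB bB.
pose b := fine (leb B).
have bE : leb B = b%:E by rewrite fineK// ge0_fin_numE.
have b0 : 0 <= b by exact: fine_ge0.
apply: (@le_lt_trans _ _ (\int[mu]_x ((C * b)%:E * (p s x)%:E))%E).
  apply: ge0_integral_mono => x _; first exact: (semigroup_indic_ge0 pst).
  apply: (@le_trans _ _ (\int[leb]_y ((C * p s x)%:E * (\1_B y)%:E))%E).
    apply: ge0_integral_mono => y _; first by rewrite lee_fin mulr_ge0// p0.
    rewrite -EFinM lee_fin indicE; case: (boolP (y \in B)) => [/set_mem By|_].
      by rewrite !mulr1; apply: pC; exact: Br.
    by rewrite !mulr0.
  rewrite ge0_integralZl//; last 2 first.
  - by apply/measurable_EFinP; exact: measurable_indic.
  - by rewrite lee_fin mulr_ge0// p0.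
  by rewrite integral_indic// setIT [X in (_ * X)%E]bE -!EFinM lee_fin mulrAC.
rewrite integral_density_Zl ?mulr_ge0//.
have := fin s s0; set I := (\int[mu]_x _)%E => Ify.
have I0 : (0 <= I)%E by apply: integral_ge0 => x _; rewrite lee_fin p0.
by rewrite -(@fineK _ I) ?ge0_fin_numE// -EFinM ltry.
Qed.

(** For [y] in the unit box [B], [p t x <= C * p s (x - y)]; integration over [B],
    of volume [1], gives [p t <= C T_s 1_B]. *)
Lemma density_integral_lty (t : R) : 0 < t ->
  (forall (s : R) (B : set 'rV[R]_n), 0 < s -> measurable B -> bounded_set B ->
     (semigroup_mass p s B mu < +oo)%E) ->
  (\int[mu]_x (p t x)%:E < +oo)%E.
Proof.
move=> t0 fin.
have [s s0 [C C0 pC]] := stable_comparison alpha0 n0 pst (Num.sqrt n%:R) alpha2 t0.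
pose B : set 'rV[R]_n := box 0 1.
have mB : measurable B by exact: measurable_box.
have bB : bounded_set B.
  apply/bounded_setP; exists 1%N => x Bx j; have /andP[h1 h2] := Bx j.
  by rewrite h2 (le_trans _ h1)// oppr_le0.
have B1 : leb B = 1%E by rewrite [LHS]lebesgue_box// subr0 expr1n.
have mS := measurable_semigroup_indic pst s0 mB.
have S0 := semigroup_indic_ge0 pst B s0.
apply: (@le_lt_trans _ _ (\int[mu]_x (C%:E * stable_semigroup p s (\1_B) x))%E).
  apply: ge0_integral_mono => x _; first by rewrite lee_fin p0.
  have mpx : measurable_fun setT (fun y : 'rV[R]_n => (p s (x - y) * \1_B y)%:E).
    apply/measurable_EFinP; apply: measurable_funM; last exact: measurable_indic.
    apply: (measurableT_comp (measurable_stable pst s0)); exact: measurable_fun_rVB.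
  rewrite /stable_semigroup -ge0_integralZl//; last first.
    by move=> y _; rewrite lee_fin mulr_ge0// p0.
  rewrite (_ : (p t x)%:E = \int[leb]_y ((p t x)%:E * (\1_B y)%:E))%E; last first.
    rewrite ge0_integralZl//; last 2 first.
    - by apply/measurable_EFinP; exact: measurable_indic.
    - by rewrite lee_fin p0.
    by rewrite integral_indic// setIT [X in (_ * X)%E]B1 mule1.
  apply: ge0_integral_mono => y _; first by rewrite -EFinM lee_fin mulr_ge0// p0.
  rewrite -!EFinM lee_fin indicE; case: (boolP (y \in B)) => [/set_mem By|_].
    rewrite !mulr1 -[in leLHS](subrK y x) -[y in leLHS]opprK.
    have := pC (x - y) (- y); rewrite opprK; apply.
    rewrite sqr_sqrtr//; have := @dot_le_box R n (- y) 1.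
    rewrite expr1n mulr1; apply => j; rewrite mxE normrN.
    by have /andP[h1 h2] := By j; rewrite ger0_norm.
  by rewrite !mulr0.
rewrite ge0_integralZl//.
have := fin s B s0 mB bB; rewrite /semigroup_mass; set I := (\int[mu]_x _)%E => Ify.
have I0 : (0 <= I)%E by apply: integral_ge0.
by rewrite -(@fineK _ I) ?ge0_fin_numE// -EFinM ltry.
Qed.

Lemma density_integral_lty_lt2 (s t : R) : alpha < 2 -> 0 < s -> 0 < t ->
  (\int[mu]_x (p s x)%:E < +oo)%E -> (\int[mu]_x (p t x)%:E < +oo)%E.
Proof.
move=> a2 s0 t0; set I := (\int[mu]_x _)%E => Ify.
have [C C0 pC] := stable_comparison_lt2 alpha0 n0 pst 0 a2 t0 s0.
apply: (@le_lt_trans _ _ (\int[mu]_x (C%:E * (p s x)%:E))%E).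
  apply: ge0_integral_mono => x _; first by rewrite lee_fin p0.
  rewrite -EFinM lee_fin -[in leLHS](subr0 x); apply: pC.
  by rewrite /dot big1 ?expr0n// => i _; rewrite mxE mulr0.
have I0 : (0 <= I)%E by apply: integral_ge0 => x _; rewrite lee_fin p0.
by rewrite integral_density_Zl// -/I -(@fineK _ I) ?ge0_fin_numE// -EFinM ltry.
Qed.
End semigroup_mass_density.

Theorem lemma2p5 (R : realType) (d : nat) (alpha beta : R)
    (p : R -> 'rV[R]_d -> R)
    (dO : measure_display) (Omega : measurableType dO)
    (P : finite_measure_rV R d -> probability Omega R)
    (xi : R -> Omega -> finite_measure_rV R d)
    (mu : {measure set 'rV[R]_d -> \bar R})
    (dW : measure_display) (W : measurableType dW) (Pmu : probability W R)
    (X : R -> W -> {measure set 'rV[R]_d -> \bar R})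
    (d_gt0 : (0 < d)%N)
    (alpha_gt0 : 0 < alpha) (alpha_le2 : alpha <= 2)
    (beta_gt0 : 0 < beta) (beta_le1 : beta <= 1)
    (p_stable : stable_transition_density alpha p)
    (xi_super : superprocess p beta P xi)
    (mu_sigma_finite : sigma_finite setT mu)
    (X_super : superprocess_from Pmu P xi mu X) :
  let cond_i (t : R) := {ae Pmu, forall w, locally_finite (X t w)} in
  let cond_ii (t : R) := locally_finite (mean_measure Pmu X t) in
  let finite_at (t : R) := (\int[mu]_x (p t x)%:E < +oo)%E in
  let cond_iii := forall t : R, 0 < t -> finite_at t in
  let cond_iv := exists2 t : R, 0 < t & finite_at t in
  [/\ forall t : R, 0 < t -> (cond_i t <-> cond_ii t),
      (forall t : R, 0 < t -> cond_i t /\ cond_ii t) <-> cond_iii &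
      alpha < 2 -> (cond_iii <-> cond_iv)].
Proof.
move=> cond_i cond_ii finite_at cond_iii cond_iv.
have [mu_ [Y [muE copies XE]]] := X_super.
have i_mass (t : R) (B : set 'rV[R]_d) : 0 < t -> cond_i t -> measurable B ->
    bounded_set B -> (semigroup_mass p t B mu < +oo)%E.
  move=> t0 it mB bB.
  apply: (semigroup_mass_finite p_stable beta_gt0 xi_super muE copies XE t0 mB).
  by apply: filterS it => w; apply.
have mass_ii (t : R) : 0 < t -> (forall B : set 'rV[R]_d, measurable B ->
    bounded_set B -> (semigroup_mass p t B mu < +oo)%E) -> cond_ii t.
  move=> t0 mass B mB bB; apply: le_lt_trans (mass B mB bB).
  exact: (mean_X_mass_le p_stable beta_gt0 xi_super muE copies XE t0 mB).
have ii_i (t : R) : 0 < t -> cond_ii t -> cond_i t.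
  move=> t0 iit.
  (* countably many boxes suffice, so their exceptional sets form a null set *)
  have : {ae Pmu, forall w (k : nat), (X t w (box (- k%:R) k%:R) < +oo)%E}.
    apply: ae_foralln => k.
    have mb : measurable (@box R d (- k%:R) k%:R) by exact: measurable_box.
    have fin := iit _ mb (proj2 (bounded_setP _) (ex_intro _ k (fun x h => h))).
    have mX := measurable_X_mass copies XE t0 mb.
    have : Pmu.-integrable setT (fun w => X t w (box (- k%:R) k%:R)).
      apply/integrableP; split => //.
      by under eq_integral do rewrite gee0_abs//.
    move=> /(integrable_ae measurableT); apply: filterS => w /(_ I).
    by rewrite ge0_fin_numE.
  by apply: filterS => w; exact: locally_finite_box.
have i_ii (t : R) : 0 < t -> cond_i t -> cond_ii t.
  by move=> t0 it; apply: mass_ii => // B mB bB; exact: i_mass.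
split.
- by move=> t t0; split; [exact: i_ii|exact: ii_i].
- split=> [all t t0|fin t t0].
    apply: (density_integral_lty alpha_gt0 alpha_le2 d_gt0 p_stable t0).
    move=> s B s0 mB bB; apply: i_mass => //.
    by have [] := all s s0.
  have iit : cond_ii t.
    apply: mass_ii => // B mB bB.
    exact: (semigroup_mass_lty alpha_gt0 alpha_le2 d_gt0 p_stable).
  by split=> //; exact: ii_i.
- move=> alpha_lt2; split=> [fin|[s s0 fin] t t0]; first by exists 1 => //; exact: fin.
  exact: (density_integral_lty_lt2 alpha_gt0 d_gt0 p_stable alpha_lt2 s0 t0 fin).
Qed.
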